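(* Let $p$ be a prime with $p\equiv 3\pmod 4$ and let $\lambda\in\mathbb F_p^{\times}$. Then $$\#X_{\lambda}^4(\mathbb F_p)=\frac{p^3-1}{p-1}+{}_3G_3\left[\left.\begin{array}{ccc} 1/4&2/4&3/4\\ 0&0&0\end{array}\right|\lambda^4\right]_p-3p\,{}_2G_2\left[\left.\begin{array}{cc} 3/4&1/4\\ 0&1/2\end{array}\right|\lambda^4\right]_p.$$
   Context: For $\lambda\in\mathbb F_p$, $X_\lambda^4$ is the Dwork K3 surface in $\mathbb P^3$ defined by $x_1^4+x_2^4+x_3^4+x_4^4=4\lambda x_1x_2x_3x_4$, and $\#X_\lambda^4(\mathbb F_p)$ is its number of $\mathbb F_p$-rational points. Let $\omega$ be the Teichmüller character of $\mathbb F_p$ (the character with values in $\mathbb Z_p$ satisfying $\omega(x)\equiv x\pmod p$), $\overline\omega=\omega^{-1}$, extended by $\overline\omega^j(0)=0$. $\Gamma_p$ is Morita's $p$-adic Gamma function. For $x\in\mathbb Q$, $\lfloor x\rfloor$ is the floor and $\langle x\rangle=x-\lfloor x\rfloor$. McCarthy's $p$-adic hypergeometric function is defined, for $a_i,b_i\in\mathbb Q\cap\mathbb Z_p$ and $u\in\mathbb F_p$, by $${}_nG_n\left[\left.\begin{array}{ccc}a_1&\ldots&a_n\\ b_1&\ldots&b_n\end{array}\right|u\right]_p:=\frac{-1}{p-1}\sum_{j=0}^{p-2}(-1)^{jn}\,\overline\omega^j(u)\prod_{i=1}^n\frac{\Gamma_p(\langle a_i-\frac{j}{p-1}\rangle)}{\Gamma_p(\langle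 a_i\rangle)}\frac{\Gamma_p(\langle -b_i+\frac{j}{p-1}\rangle)}{\Gamma_p(\langle -b_i\rangle)}(-p)^{-\lfloor\langle a_i\rangle-\frac{j}{p-1}\rfloor-\lfloor\langle -b_i\rangle+\frac{j}{p-1}\rfloor}.$$ *)

(* Defs.v *)
From HB Require Import structures.
From mathcomp Require Import all_boot all_order all_algebra.
Set Implicit Arguments. Unset Strict Implicit. Unset Printing Implicit Defensive.
Import Order.TTheory GRing.Theory Num.Theory.
Local Open Scope ring_scope.

Definition vp (p : nat) (r : rat) : int :=
  (logn p `|numq r|%N)%:Z - (logn p `|denq r|%N)%:Z.

Definition padic_close (p m : nat) (x y : rat) : bool :=
  (x == y) || (m%:Z <= vp p (x - y)).

Definition padic_limit (p : nat) (s : nat -> rat) (L : rat) : Prop :=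
  forall m : nat, exists K : nat, forall k : nat, (K <= k)%N -> padic_close p m (s k) L.

Definition gammap_nat (p n : nat) : rat :=
  (-1) ^+ n * \prod_(1 <= j < n | ~~ (p %| j)%N) (j%:R : rat).

(* the unique n in [0, p^k) with n = x (mod p^k), for x in Q /\ Z_p *)
Definition padic_lift (p k : nat) (x : rat) : nat :=
  let N := (p ^ k)%N in
  `| ((numq x * (`|denq x|%N ^ (totient N).-1)%:Z) %% N%:Z)%Z |%N.

(* k-th approximation of Gamma_p(x): Gamma_p(n_k) where n_k -> x p-adically;
   Gamma_p(x) = lim_k gammap_approx p k x (Morita's definition by continuity). *)
Definition gammap_approx (p k : nat) (x : rat) : rat :=
  gammap_nat p (padic_lift p k x).

(* k-th approximation of omega(u) in Z_p: (lift of u)^(p^k) -> omega(u) *)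
Definition teich_approx (p k : nat) (u : 'F_p) : rat :=
  ((val u) ^ (p ^ k))%:R.

Definition omegabar_approx (p k j : nat) (u : 'F_p) : rat :=
  if u == 0 then 0 else (@teich_approx p k (u^-1)) ^+ j.

Definition frac (x : rat) : rat := x - (Num.floor x)%:~R.

(* a = [a_1..a_n], b = [b_1..b_n];  G[a;b|u]_p = lim_k G_approx p k a b u *)
Definition G_approx (p k : nat) (a b : seq rat) (u : 'F_p) : rat :=
  let n := size a in
  let q := (p.-1)%:R : rat in
  (-1) / q *
  \sum_(j < p.-1)
    ((-1) ^+ (j * n) * @omegabar_approx p k j u *
     \prod_(i < n)
       (let ai := nth 0 a i in let bi := nth 0 b i in
        let t := (j%:R : rat) / q in
        gammap_approx p k (frac (ai - t)) / gammap_approx p k (frac ai) *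
        (gammap_approx p k (frac (- bi + t)) / gammap_approx p k (frac (- bi))) *
        (- (p%:R : rat)) ^ (- Num.floor (frac ai - t) - Num.floor (frac (- bi) + t)))).

Definition dwork_eq (p : nat) (lam : 'F_p) (x : {ffun 'I_4 -> 'F_p}) : bool :=
  \sum_(i < 4) x i ^+ 4 == 4%:R * lam * \prod_(i < 4) x i.

(* #X_lam^4(F_p): number of points of P^3(F_p) on the surface
   = (number of nonzero solutions in F_p^4) / (p - 1). *)
Definition npoints (p : nat) (lam : 'F_p) : nat :=
  (#|[set x : {ffun 'I_4 -> 'F_p} | [exists i, x i != 0%R] && dwork_eq lam x]| %/ p.-1)%N.

(* Main.v *)
Require Import Defs.
From HB Require Import structures.
From mathcomp Require Import all_boot all_order all_algebra cyclic.
From mathcomp Require Import ring lra zify.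
Set Implicit Arguments. Unset Strict Implicit. Unset Printing Implicit Defensive.
Import Order.TTheory GRing.Theory Num.Theory.
Local Open Scope ring_scope.

(** Counting. Since p = 3 mod 4, -1 is not a square in F_p, so the nonzero fourth powers are the
    nonzero squares, each attained twice ([sum_fourth]). A nonzero solution has at most one
    vanishing coordinate, and each of the four hyperplane sections is a Fermat quartic curve with p
    + 1 points ([tri_countE]). On the open torus put m = x1 x2 x3 x4, u = x1^4/m, v = x2^4/m, w =
    x3^4/m: the equation becomes u + v + w + 1/(uvw) = 4 lam, and [npointsE] gives #X = S + 3 T + 4
    (p + 1). Here S counts the points of this torus hypersurface and T is the same count weighted by
    chi(u) chi(v), chi the quadratic character.

    Gauss sums. Fourier expansion ([twisted_torus_gauss]) writes S and T, up to trivial terms, as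
    sums over j modulo p - 1 of g(j + hh)^2 g(j)^2 g(-4j) times a character value at -4 lam, with hh
    = 0 for S and hh = (p - 1)/2 for T. The Gross-Koblitz formula ([gross_koblitz]) replaces g(a) by
    -pi^a Gamma_p(a/(p-1)), where pi^(p-1) = -p. The reflection formula and the multiplication
    formula by 4 for Gamma_p then turn each summand into a multiple of the corresponding summand of
    3G3 or 2G2 ([torus_term0], [torus_term_half]). Only j = 0 for S, and j = 0, (p - 1)/2 for T, are
    exceptional; they account for the polynomial parts of S = p^2 - 3p + 3 + 3G3 and T = -2 - p 2G2.
    Adding up gives p^2 + p + 1 + 3G3 - 3p 2G2.

    Gross-Koblitz itself is derived from Dwork's splitting function exp(pi (y - y^p)). Its
    coefficients satisfy a recurrence coming from a differential equation, and a telescoping double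
    sum turns this into an exact finite identity between a p-free factorial and the series of
    coefficients ([gross_koblitz_series]), in which a multiple of (p - 1) s + a is the error.
    Letting s tend p-adically to -a/(p-1) gives the formula. The p-th power of the splitting
    function at a Teichmuller point is 1, which makes it an additive character ([psiD]).

    Setting. All of this takes place modulo p^N: gamma values and Teichmuller representatives live
    in ['Z_(p ^ N)], and pi in an extension ring R by a root of X^(p-1) + p. As p is a zero divisor
    there, additivity of the character is proved only after multiplication by p, the final
    congruence carries a factor p^2, and a precision of N - 2 digits remains ([close_approximants]),
    which suffices for the limit. *)

(** * p-integral rationals, valuations, and reduction modulo p^N *)

Section PadicIntegers.
Variable p : nat.
Hypothesis p_pr : prime p.

Let p_gt0 : (0 < p)%N := prime_gt0 p_pr.
Let p_gt1 : (1 < p)%N := prime_gt1 p_pr.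

Lemma natr_prime_neq0 : p%:R != 0 :> rat.
Proof. by rewrite pnatr_eq0 -lt0n. Qed.
Let pR_neq0 := natr_prime_neq0.

Definition pint (x : rat) : Prop :=
  exists a : int, exists2 b : nat, ~~ (p %| b)%N & x = a%:~R / b%:R.

Lemma ndvd_neq0 b : ~~ (p %| b)%N -> b%:R != 0 :> rat.
Proof. by apply: contraNneq => /eqP; rewrite pnatr_eq0 => /eqP ->. Qed.

Lemma ndvdM b c : ~~ (p %| b)%N -> ~~ (p %| c)%N -> ~~ (p %| b * c)%N.
Proof. by rewrite Euclid_dvdM // negb_or => -> ->. Qed.

Lemma ndvd1 : ~~ (p %| 1)%N.
Proof. by rewrite dvdn1 neq_ltn p_gt1 orbT. Qed.

Lemma pint_int (a : int) : pint a%:~R.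
Proof. by exists a, 1%N; rewrite ?ndvd1 ?divr1. Qed.

Lemma pint_nat n : pint n%:R.
Proof. exact: (pint_int n). Qed.

Lemma pint0 : pint 0. Proof. exact: (pint_nat 0). Qed.
Lemma pint1 : pint 1. Proof. exact: (pint_nat 1). Qed.

Lemma pintN x : pint x -> pint (- x).
Proof. by case=> a [b pb ->]; exists (- a), b => //; rewrite mulrNz mulNr. Qed.

Lemma pintD x y : pint x -> pint y -> pint (x + y).
Proof.
case=> a [b pb ->] [c [d pd ->]]; exists (a * d%:Z + c * b%:Z), (b * d)%N.
  exact: ndvdM.
rewrite addf_div ?ndvd_neq0 //.
by rewrite natrM rmorphD !rmorphM.
Qed.

Lemma pintB x y : pint x -> pint y -> pint (x - y).
Proof. by move=> hx hy; apply: pintD => //; apply: pintN. Qed.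

Lemma pintM x y : pint x -> pint y -> pint (x * y).
Proof.
case=> a [b pb ->] [c [d pd ->]]; exists (a * c), (b * d)%N; first exact: ndvdM.
by rewrite mulf_div natrM rmorphM.
Qed.

Lemma pintX x n : pint x -> pint (x ^+ n).
Proof.
by move=> hx; elim: n => [|n IHn]; rewrite ?expr0 ?exprS; [exact: pint1|exact: pintM].
Qed.

Lemma pintV n : ~~ (p %| n)%N -> pint n%:R^-1.
Proof. by move=> pn; exists 1, n => //; rewrite mul1r. Qed.

Lemma pint_sum (I : Type) (r : seq I) (P : pred I) (F : I -> rat) :
  (forall i, P i -> pint (F i)) -> pint (\sum_(i <- r | P i) F i).
Proof. by move=> h; apply: big_ind => //; [exact: pint0|exact: pintD]. Qed.

Lemma pint_prod (I : Type) (r : seq I) (P : pred I) (F : I -> rat) :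
  (forall i, P i -> pint (F i)) -> pint (\prod_(i <- r | P i) F i).
Proof. by move=> h; apply: big_ind => //; [exact: pint1|exact: pintM]. Qed.

(* [vge e x] means v_p(x) >= e. *)
Definition vge (e : int) (x : rat) : Prop := pint (x * p%:R ^ (- e)).

Lemma vge0 x : vge 0 x <-> pint x.
Proof. by rewrite /vge oppr0 expr0z mulr1. Qed.

Lemma vge_0 e : vge e 0.
Proof. by rewrite /vge mul0r; exact: pint0. Qed.

Lemma vgeD e x y : vge e x -> vge e y -> vge e (x + y).
Proof. by rewrite /vge mulrDl; exact: pintD. Qed.

Lemma vgeN e x : vge e x -> vge e (- x).
Proof. by rewrite /vge mulNr; exact: pintN. Qed.

Lemma vgeM e f x y : vge e x -> vge f y -> vge (e + f) (x * y).
Proof.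
move=> hx hy; rewrite /vge opprD expfzDr // mulrACA; exact: pintM.
Qed.

Lemma vge_sum e (I : Type) (r : seq I) (P : pred I) (F : I -> rat) :
  (forall i, P i -> vge e (F i)) -> vge e (\sum_(i <- r | P i) F i).
Proof. by move=> h; apply: big_ind => //; [exact: vge_0|exact: vgeD]. Qed.

Lemma vge_exp (e : int) : vge e (p%:R ^ e).
Proof. by rewrite /vge -expfzDr // subrr expr0z; exact: pint1. Qed.

Lemma vge_expn n : vge n%:Z (p%:R ^+ n).
Proof. exact: (vge_exp n). Qed.

Lemma vge_le e f x : (f <= e)%R -> vge e x -> vge f x.
Proof.
move=> fe hx; rewrite /vge.
have -> : p%:R ^ (- f) = p%:R ^ (- e) * p%:R ^ (e - f) :> rat.
  by rewrite -expfzDr //; congr (_ ^ _); ring.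
rewrite mulrA; apply: pintM => //.
case: (e - f) (subr_ge0 f e) => n; last by rewrite fe.
by move=> _; apply: pintX; exact: pint_nat.
Qed.

Lemma vge_dvd n a : (p ^ n %| a)%N -> vge n%:Z a%:R.
Proof.
case/dvdnP=> b ->; rewrite natrM natrX -[n%:Z]add0r.
by apply: vgeM (vge_expn n); apply/vge0/pint_nat.
Qed.

(** Link with the valuation [vp] of the statement: cross-multiplying x = (a/b) p^e gives an identity
    between integers, on which [logn] is additive. A negative e is moved to the other side first. *)
Lemma vge_vp e x : vge e x -> (x == 0) || (e <= vp p x).
Proof.
case=> a [b pb xE]; case: eqVneq => //= x0.
have bR := ndvd_neq0 pb.
have a0 : a != 0.
  apply: contra_neq x0 => a0; move: xE; rewrite a0 mul0r => /eqP.
  by rewrite mulf_eq0 expfz_eq0 (negPf pR_neq0) andbF orbF => /eqP.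
have lb : logn p b = 0%N by rewrite lognE (negPf pb) !andbF.
have n0 : numq x != 0 by rewrite numq_eq0.
have xE2 : x = a%:~R / b%:R * p%:R ^ e.
  by rewrite -xE -mulrA -expfzDr // addNr expr0z mulr1.
have dR : (denq x)%:~R != 0 :> rat by rewrite intr_eq0 denq_neq0.
have pw n : (p ^ n)%N%:Z%:~R = p%:R ^+ n :> rat by rewrite -natrX.
have key : exists2 k : int, (k = e)%R & 
  ((logn p `|numq x|)%:Z + (logn p b)%:Z = (logn p `|a|)%:Z + (logn p `|denq x|)%:Z + k)%R.
  exists e => //.
  have num_b : (numq x)%:~R * b%:R = a%:~R * (denq x)%:~R * p%:R ^ e :> rat.
    rewrite numqE {1}xE2; field; exact: bR.
  case: e xE xE2 num_b => n _ _ H.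
    have /(congr1 (fun z : int => logn p `|z|)) : numq x * b%:Z = a * denq x * (p ^ n)%N%:Z.
      by apply: (@intr_inj rat); rewrite !rmorphM /= pw H.
    rewrite !abszM /= !lognM ?muln_gt0 ?absz_gt0 ?n0 ?a0 ?denq_neq0 ?expn_gt0 ?p_gt0 //.
      by rewrite pfactorK //; lia.
    by rewrite lt0n; apply: contraNneq pb => ->; rewrite dvdn0.
  have /(congr1 (fun z : int => logn p `|z|)) : numq x * b%:Z * (p ^ n.+1)%N%:Z = a * denq x.
    apply: (@intr_inj rat); rewrite !rmorphM /= pw H NegzE -exprnN.
    by rewrite mulfVK // expf_neq0.
  rewrite !abszM /= !lognM ?muln_gt0 ?absz_gt0 ?n0 ?a0 ?denq_neq0 ?expn_gt0 ?p_gt0 //.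
  - by rewrite pfactorK //; lia.
  - by rewrite lt0n; apply: contraNneq pb => ->; rewrite dvdn0.
  - by rewrite lt0n; apply: contraNneq pb => ->; rewrite dvdn0.
case: key => k -> ; rewrite lb /vp; lia.
Qed.

Lemma pint_denq x : pint x -> ~~ (p %| `|denq x|)%N.
Proof.
case=> a [b pb xE]; have bR := ndvd_neq0 pb.
have H : numq x * b%:Z = a * denq x.
  by apply: (@intr_inj rat); rewrite !rmorphM /= numqE xE; field; exact: bR.
apply: contraNN pb => /dvdn_trans; apply.
have : (`|denq x| %| `|numq x| * b)%N.
  by rewrite -[b in (_ * b)%N]absz_nat -abszM H abszM dvdn_mull.
by rewrite Gauss_dvdr // coprime_sym coprime_num_den.
Qed.

Section Reduction.
Variable N : nat.
Hypothesis N_gt0 : (0 < N)%N.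
Local Notation q := (p ^ N)%N.
Local Notation Z := 'Z_(p ^ N).

Lemma q_gt1 : (1 < q)%N.
Proof. by rewrite -(exp1n N) ltn_exp2r. Qed.

Lemma natZ_eq0 n : ((n%:R : Z) == 0) = (q %| n)%N.
Proof. by rewrite -val_eqE /= (val_Zp_nat q_gt1). Qed.

Lemma natZ_eq m n : ((m%:R : Z) == n%:R) = (m == n %[mod q])%N.
Proof. by rewrite -val_eqE /= !(val_Zp_nat q_gt1). Qed.

Lemma natZ_unit n : ((n%:R : Z) \is a GRing.unit) = ~~ (p %| n)%N.
Proof. by rewrite (unitZpE _ q_gt1) coprime_pexpl // prime_coprime. Qed.

(** The ring map from the localisation at p to Z/p^N, written as a total function; it is meaningful
    on [pint] only, where [redE] shows that any admissible fraction may be used. *)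
Definition red (x : rat) : Z := (numq x)%:~R / (denq x)%:~R.

Lemma redE (a : int) (b : nat) : ~~ (p %| b)%N ->
  red (a%:~R / b%:R) = a%:~R / b%:R.
Proof.
move=> pb; have bR := ndvd_neq0 pb; set x := a%:~R / b%:R.
have dR : (denq x)%:~R != 0 :> rat by rewrite intr_eq0 denq_neq0.
have H : numq x * b%:Z = a * denq x.
  apply: (@intr_inj rat); rewrite !rmorphM /= numqE /x; field; exact: bR.
have pd : ~~ (p %| `|denq x|)%N by apply: pint_denq; exists a, b.
have ub : (b%:R : Z) \is a GRing.unit by rewrite natZ_unit.
have ud : ((denq x)%:~R : Z) \is a GRing.unit.
  by rewrite -[denq x]gez0_abs // natZ_unit.
rewrite /red; apply: (mulIr ud); rewrite divrK //.
apply: (mulIr ub); rewrite mulrAC divrK //.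
by rewrite -[b%:R]/(b%:Z%:~R) -!intrM H.
Qed.

Lemma red_int (a : int) : red a%:~R = a%:~R.
Proof. by rewrite -[a%:~R in LHS]divr1 (@redE a 1%N) ?ndvd1 // divr1. Qed.

Lemma red_nat n : red n%:R = n%:R.
Proof. exact: (red_int n). Qed.

Lemma red0 : red 0 = 0. Proof. exact: (red_nat 0). Qed.
Lemma red1 : red 1 = 1. Proof. exact: (red_nat 1). Qed.

Lemma redD x y : pint x -> pint y -> red (x + y) = red x + red y.
Proof.
case=> a [b pb ->] [c [d pd ->]].
have -> : a%:~R / b%:R + c%:~R / d%:R = (a * d%:Z + c * b%:Z)%:~R / (b * d)%N%:R :> rat.
  by rewrite addf_div ?ndvd_neq0 // natrM rmorphD !rmorphM.
have ub : (b%:R : Z) \is a GRing.unit by rewrite natZ_unit.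
have ud : (d%:R : Z) \is a GRing.unit by rewrite natZ_unit.
rewrite !redE ?ndvdM // natrM rmorphD !rmorphM /= invrM // mulrDl.
rewrite mulrA mulrK // [d%:R^-1 * _]mulrC mulrA mulrK //.
Qed.

Lemma redM x y : pint x -> pint y -> red (x * y) = red x * red y.
Proof.
case=> a [b pb ->] [c [d pd ->]].
have ub : (b%:R : Z) \is a GRing.unit by rewrite natZ_unit.
have ud : (d%:R : Z) \is a GRing.unit by rewrite natZ_unit.
rewrite mulf_div -natrM -rmorphM /= !redE ?ndvdM // natrM rmorphM /= invrM //.
by rewrite [d%:R^-1 * _]mulrC mulrACA.
Qed.

Lemma redN x : pint x -> red (- x) = - red x.
Proof.
move=> hx; rewrite -[- x]mulN1r redM //; last exact: pint_int (-1).
by rewrite (red_int (-1)) mulN1r.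
Qed.

Lemma redB x y : pint x -> pint y -> red (x - y) = red x - red y.
Proof. by move=> hx hy; rewrite redD ?redN //; exact: pintN. Qed.

Lemma redX x n : pint x -> red (x ^+ n) = red x ^+ n.
Proof.
move=> hx; elim: n => [|n IHn]; first by rewrite !expr0 red1.
by rewrite !exprS redM ?IHn //; exact: pintX.
Qed.

Lemma redV n : ~~ (p %| n)%N -> red n%:R^-1 = n%:R^-1.
Proof. by move=> pn; rewrite -[n%:R^-1 in LHS]mul1r (@redE 1 n) // mul1r. Qed.

Lemma red_sum (I : Type) (r : seq I) (P : pred I) (F : I -> rat) :
  (forall i, P i -> pint (F i)) ->
  red (\sum_(i <- r | P i) F i) = \sum_(i <- r | P i) red (F i).
Proof.
move=> h; suff [] : pint (\sum_(i <- r | P i) F i) /\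
  red (\sum_(i <- r | P i) F i) = \sum_(i <- r | P i) red (F i) by [].
apply: (big_rec2 (fun x y => pint x /\ red x = y)).
  by split; [exact: pint0 | exact: red0].
by move=> i x y Pi [hy <-]; split; [apply: pintD => //; exact: h|rewrite redD //; exact: h].
Qed.

Lemma red_prod (I : Type) (r : seq I) (P : pred I) (F : I -> rat) :
  (forall i, P i -> pint (F i)) ->
  red (\prod_(i <- r | P i) F i) = \prod_(i <- r | P i) red (F i).
Proof.
move=> h; suff [] : pint (\prod_(i <- r | P i) F i) /\
  red (\prod_(i <- r | P i) F i) = \prod_(i <- r | P i) red (F i) by [].
apply: (big_rec2 (fun x y => pint x /\ red x = y)).
  by split; [exact: pint1 | exact: red1].
by move=> i x y Pi [hy <-]; split; [apply: pintM => //; exact: h|rewrite redM //; exact: h].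
Qed.

Lemma pchar_pow : (p%:R : Z) ^+ N = 0.
Proof. by rewrite -natrX; apply/eqP; rewrite natZ_eq0. Qed.

Lemma red_vge x : vge N%:Z x -> red x = 0.
Proof.
move=> hx; have -> : x = x * p%:R ^ (- N%:Z) * p%:R ^+ N.
  by rewrite -mulrA -[p%:R ^+ N]/(p%:R ^ N%:Z) -expfzDr // addNr expr0z mulr1.
by rewrite redM // ?redX ?red_nat ?pchar_pow ?mulr0 //; [exact: pint_nat|apply: pintX; exact: pint_nat].
Qed.

(** Together with [red_vge] this identifies the kernel of reduction, so that congruences proved in
    ['Z_(p ^ N)] can be read back as valuations of rationals. *)
Lemma red_eq0 x : pint x -> red x = 0 -> vge N%:Z x.
Proof.
case=> a [b pb ->]; have ub : (b%:R : Z) \is a GRing.unit by rewrite natZ_unit.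
rewrite redE // => /(congr1 (fun z => z * b%:R)); rewrite divrK // mul0r => a0.
have : (q %| `|a|)%N.
  rewrite -natZ_eq0; case: a a0 => n; first by move=> a0; apply/eqP.
  by rewrite NegzE mulrNz => /eqP; rewrite oppr_eq0 abszN.
case/dvdnP=> c aE.
have -> : a = (sgz a * c%:Z) * (q : int) by rewrite -mulrA -PoszM -aE -intEsg.
exists (sgz a * c%:Z), b => //.
rewrite rmorphM /= -[((p ^ N)%N%:Z)%:~R]/((p ^ N)%N%:R) natrX.
have pp1 : p%:R ^+ N * p%:R ^ (- N%:Z) = 1 :> rat.
  by rewrite -[p%:R ^+ N]/(p%:R ^ N%:Z) -expfzDr // subrr expr0z.
by rewrite mulrAC -!mulrA [_^-1 * _]mulrC !mulrA -[X in X / _]mulrA pp1 mulr1.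
Qed.

End Reduction.
End PadicIntegers.

(** * Finite differences, plain and twisted by a polynomial congruent to 1 modulo p *)

Section FiniteDifferences.
Variable V : pzRingType.

Definition fdiff (h : nat -> V) (l : nat) : V := h l.+1 - h l.

Lemma iter_fdiff m h l :
  iter m fdiff h l = \sum_(i < m.+1) (-1) ^+ (m - i) * h (l + i)%N *+ 'C(m, i).
Proof.
elim: m l => [|m IHm] l; first by rewrite big_ord1 /= addn0 bin0 expr0 mul1r.
rewrite iterS /fdiff !IHm [in RHS]big_ord_recl /= bin0 subn0 addn0 mulr1n.
under [X in _ = _ + X]eq_bigr => i _ do
  rewrite /bump leq0n add1n binS mulrnDr subSS -addSnnS.
rewrite big_split /= addrA [in RHS]addrC; congr (_ + _).
rewrite big_ord_recl /= bin0 subn0 addn0 mulr1n opprD exprS mulN1r mulNr; congr (_ + _).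
rewrite [in RHS]big_ord_recr /= bin_small // mulr0n addr0 -sumrN.
apply: eq_bigr => i _; rewrite /bump leq0n add1n addSnnS -mulNrn -mulNr; congr (_ * _ *+ _).
by rewrite -mulN1r -exprS -subSn ?subSS.
Qed.

End FiniteDifferences.

Section TwistedDifference.
Variable u : {poly int}.

(** The forward difference conjugated by the sequence of products u(0)...u(l-1) (see
    [iter_fdiff_tdiff]); differences of such products thus stay polynomial. *)
Definition tdiff (f : {poly int}) : {poly int} := u * (f \Po ('X + 1)) - f.

Lemma iter_tdiffZ a m f : iter m tdiff (a *: f) = a *: iter m tdiff f.
Proof.
elim: m => //= m ->.
by rewrite /tdiff comp_polyZ -scalerAr -scalerBr.
Qed.

Lemma iter_fdiff_tdiff m f l :
  iter m (@fdiff int) (fun l => \prod_(i < l) u.[i%:R] * f.[l%:R]) l =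
  \prod_(i < l) u.[i%:R] * (iter m tdiff f).[l%:R].
Proof.
elim: m l => // m IHm l; rewrite !iterS /fdiff !IHm big_ord_recr /= /tdiff.
rewrite !hornerE horner_comp !hornerE -mulrA -mulrBr -natr1; ring.
Qed.

Variable p : nat.
Hypothesis p_pr : prime p.
Hypothesis u1 : map_poly (intr : int -> 'F_p) u = 1.

Lemma Fp_poly_dvd (f : {poly int}) :
  map_poly (intr : int -> 'F_p) f = 0 -> exists g, f = p%:Z *: g.
Proof.
move=> f0; apply/polyOver_dvdzP/polyOverP => i.
have /(congr1 (fun g : {poly 'F_p} => g`_i)) := f0.
rewrite coef_map coef0 /= => /eqP.
by rewrite -(dvdz_pcharf (pchar_Fp p_pr)).
Qed.

Lemma map_tdiff f : map_poly (intr : int -> 'F_p) (tdiff f) =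
  (map_poly intr f \Po ('X + 1)) - map_poly intr f.
Proof.
have X1 : map_poly (intr : int -> 'F_p) ('X + 1) = 'X + 1.
  by rewrite rmorphD /= map_polyX rmorph1.
by rewrite /tdiff rmorphB rmorphM /= u1 mul1r map_comp_poly /= X1.
Qed.

(** Modulo p the twist u is 1, so [tdiff] becomes f(X + 1) - f(X), and its iterates are ordinary
    differences of the shifts of f. *)
Lemma map_iter_tdiff m f :
  map_poly (intr : int -> 'F_p) (iter m tdiff f) =
  iter m (@fdiff {poly 'F_p}) (fun l => map_poly intr f \Po ('X + l%:R)) 0.
Proof.
have gen l : map_poly (intr : int -> 'F_p) (iter m tdiff f) \Po ('X + l%:R) =
  iter m (@fdiff {poly 'F_p}) (fun l => map_poly intr f \Po ('X + l%:R)) l.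
  elim: m l => // m IHm l; rewrite !iterS {1}/fdiff -!IHm map_tdiff.
  rewrite rmorphB /= -comp_polyA; congr (_ \Po _ - _).
  by rewrite rmorphD /= comp_polyX rmorph1 -addrA natr1.
by rewrite -gen addr0 comp_polyXr.
Qed.

(** Modulo p, (shift - 1)^p = shift^p - 1 because p divides the inner binomial coefficients, and a
    shift by p is the identity. *)
Lemma iter_tdiff_prime f : odd p -> exists g, iter p tdiff f = p%:Z *: g.
Proof.
move=> p_odd; apply: Fp_poly_dvd; rewrite map_iter_tdiff iter_fdiff.
have pF : p%:R = 0 :> {poly 'F_p}.
  by rewrite -polyC_natr (pcharf0 (pchar_Fp p_pr)).
have pFM k : (p %| k)%N -> k%:R = 0 :> {poly 'F_p}.
  by case/dvdnP=> d ->; rewrite natrM pF mulr0.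
rewrite big_ord_recr /= subnn expr0 mul1r binn mulr1n add0n pF addr0 comp_polyXr.
case: p p_pr p_odd pFM => // p' pr' odd' pFM'.
rewrite big_ord_recl /= big1 => [|i _]; last first.
  rewrite -mulr_natr [X in _ * X]pFM' ?mulr0 //; apply: prime_dvd_bin => //.
  by case: i => i /= ip; rewrite /bump leq0n add1n.
rewrite subn0 bin0 mulr1n !addr0 comp_polyXr -signr_odd odd' mulN1r addNr //.
Qed.

(** The first difference of 1 is u - 1, which already gives one factor p; every further block of p
    differences gives one more by [iter_tdiff_prime]. *)
Lemma iter_tdiff_dvd m : odd p -> (0 < m)%N ->
  exists g, iter m tdiff 1 = (p ^ ((m.-1) %/ p).+1)%N%:Z *: g.
Proof.
move=> p_odd; case: m => // m _ /=.
have [g0 g0E] : exists g, tdiff 1 = p%:Z *: g.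
  by apply: Fp_poly_dvd; rewrite map_tdiff rmorph1 comp_polyC subrr.
have step k f : exists g, iter (p * k) tdiff f = (p ^ k)%N%:Z *: g.
  elim: k f => [|k IHk] f; first by exists f; rewrite muln0 scale1r.
  have [g gE] := iter_tdiff_prime f p_odd; have [h hE] := IHk g.
  exists h; rewrite mulnS addnC iterD gE iter_tdiffZ hE scalerA.
  by rewrite -PoszM -expnS.
have [h hE] := step (m %/ p)%N (iter (m %% p) tdiff g0).
exists h; rewrite -[tdiff _]/(iter m.+1 tdiff 1) iterSr g0E iter_tdiffZ.
by rewrite {1}(divn_eq m p) mulnC iterD hE scalerA -PoszM -expnS.
Qed.

End TwistedDifference.

(** * The coefficients of exp(X + X^p/p) *)

Section DworkCoefficients.
Variable p : nat.
Hypothesis p_pr : prime p.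
Let p_gt0 : (0 < p)%N := prime_gt0 p_pr.
Let p_gt1 : (1 < p)%N := prime_gt1 p_pr.
Let pR_neq0 := natr_prime_neq0 p_pr.

Lemma factR_neq0 n : n`!%:R != 0 :> rat.
Proof. by rewrite pnatr_eq0 -lt0n fact_gt0. Qed.

(** The coefficient of X^n in E(X) = exp(X + X^p/p). At X = pi y with pi^(p-1) = -p, E becomes
    Dwork's splitting function exp(pi (y - y^p)). *)
Definition dwc (n : nat) : rat :=
  \sum_(j < n.+1 | (p * j <= n)%N) ((n - p * j)`!%:R * j`!%:R * p%:R ^+ j)^-1.

Lemma dwcE J n : (n < J)%N -> dwc n =
  \sum_(j < J | (p * j <= n)%N) ((n - p * j)`!%:R * j`!%:R * p%:R ^+ j)^-1.
Proof.
move=> nJ; rewrite /dwc (big_ord_widen_cond _ (fun j => p * j <= n)%N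
  (fun j => ((n - p * j)`!%:R * j`!%:R * p%:R ^+ j)^-1) nJ).
apply: eq_bigl => j; rewrite ltnS; case: (leqP (p * j) n) => //= le.
by rewrite (leq_trans _ le) // leq_pmull.
Qed.

Lemma dwc_small n : (n < p)%N -> dwc n = n`!%:R^-1.
Proof.
move=> np; rewrite /dwc (bigD1 ord0) ?muln0 //= big1 ?addr0.
  by rewrite subn0 fact0 expr0 !mulr1.
case=> -[|j] jn /= /andP[le ne]; first by [].
by move: (leq_ltn_trans le np); rewrite mulnS; lia.

Qed.

(** Coefficient form of E' = (1 + X^(p-1)) E. In each summand, n + 1 is split as (n + 1 - pj) + pj,
    and either part cancels against one of the two factorials. *)
Lemma dwc_rec n : n.+1%:R * dwc n.+1 =
  dwc n + (if (p <= n.+1)%N then dwc (n.+1 - p) else 0).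
Proof.
pose A j : rat := ((n - p * j)`!%:R * j`!%:R * p%:R ^+ j)^-1.
pose B j : rat := ((n.+1 - p - p * j)`!%:R * j`!%:R * p%:R ^+ j)^-1.
have -> : n.+1%:R * dwc n.+1 =
   \sum_(j < n.+2 | (p * j <= n.+1)%N)
     ((if (p * j <= n)%N then A j else 0) + (if (j : nat) is i.+1 then B i else 0)).
  rewrite /dwc mulr_sumr; apply: eq_bigr => -[j jn] /= le.
  have -> : n.+1%:R = (n.+1 - p * j)%:R + (p * j)%:R :> rat by rewrite -natrD subnK.
  rewrite mulrDl; congr (_ + _).
    case: leqP => [le'|gt].
      by rewrite /A subSn // factS natrM !invfM !mulrA mulfV ?mul1r // pnatr_eq0.
    have -> : (n.+1 - p * j = 0)%N by apply/eqP; rewrite subn_eq0.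
    by rewrite mul0r.
  case: j jn le => [|i] jn le; first by rewrite muln0 mul0r.
  rewrite /B -subnDA -mulnS factS exprS !natrM.
  have iR : 1 + i%:R != 0 :> rat by rewrite addrC natr1 pnatr_eq0.
  by field; rewrite !factR_neq0 pR_neq0 expf_neq0 ?iR.
rewrite big_split /=; congr (_ + _).
  rewrite (@dwcE n.+2 n) // [LHS]big_mkcond [RHS]big_mkcond; apply: eq_bigr => j _.
  by case: (leqP (p * j) n) => [le|_]; rewrite ?if_same // leqW.
rewrite big_mkcond big_ord_recl /= muln0 add0r.
case: leqP => [le|gt]; last first.
  rewrite big1 // => i _; case: ifP => //; rewrite /bump leq0n add1n mulnS; lia.
rewrite (@dwcE n.+1); last by lia.
rewrite [RHS]big_mkcond; apply: eq_bigr => i _; rewrite /bump leq0n add1n mulnS.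
by congr (if _ then _ else _); lia.
Qed.

(** This is (-1)^(n+1) Gamma_p(n + 1). *)
Definition pfree_fact (n : nat) : nat := \prod_(1 <= j < n.+1 | ~~ (p %| j)%N) j.
Local Notation PA := pfree_fact.

Lemma pfree_factS n : PA n.+1 = (PA n * if p %| n.+1 then 1 else n.+1)%N.
Proof. by rewrite /pfree_fact big_mkcond big_nat_recr //= -big_mkcond; case: (p %| n.+1)%N. Qed.

Lemma pfree_fact0 : PA 0 = 1%N.
Proof. by rewrite /pfree_fact big_geq. Qed.

Lemma pfree_fact_ndvd n : ~~ (p %| PA n)%N.
Proof.
elim: n => [|n IHn]; first by rewrite pfree_fact0 ndvd1.
by rewrite pfree_factS; case: ifP => [_|/negbT h]; rewrite ?muln1 // ndvdM.
Qed.

Lemma fact_pfree n : n`! = (p ^ (n %/ p) * (n %/ p)`! * PA n)%N.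
Proof.
elim: n => [|n IHn]; first by rewrite div0n pfree_fact0.
rewrite factS IHn pfree_factS divnS //.
case: (boolP (p %| n.+1)%N) => [dv|_]; last by rewrite add0n; ring.
have e : n.+1 = (p * (n %/ p).+1)%N.
  by rewrite -{1}(divnK dv) divnS // dv add1n mulnC.
by rewrite {1}e add1n expnS factS; ring.
Qed.

Lemma fact_pfree_AP a m : (a < p)%N ->
  (a + p * m)`! = (p ^ m * m`! * PA (a + p * m))%N.
Proof.
move=> ap; rewrite fact_pfree; congr (p ^ _ * _`! * _)%N;
  by rewrite addnC mulnC divnMDl // divn_small // addn0.
Qed.

Lemma pfreeR_neq0 n : (PA n)%:R != 0 :> rat.
Proof. exact: ndvd_neq0 (pfree_fact_ndvd n). Qed.

Lemma dwc_AP a m : (a < p)%N -> dwc (a + p * m) =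
  \sum_(j < m.+1) ((a + p * (m - j))`!%:R * j`!%:R * p%:R ^+ j)^-1.
Proof.
move=> ap; rewrite /dwc.
rewrite [RHS](big_ord_widen (a + p * m).+1
  (fun j => ((a + p * (m - j))`!%:R * j`!%:R * p%:R ^+ j)^-1)); last first.
  by rewrite ltnS (leq_trans _ (leq_addl _ _)) // leq_pmull.
have cond j : (p * j <= a + p * m)%N = (j < m.+1)%N.
  by rewrite mulnC -leq_divRL // mulnC addnC divnMDl // divn_small // addn0 ltnS.
under eq_bigl => j do rewrite cond.
by apply: eq_bigr => j jm; rewrite mulnBr addnBA // leq_mul2l -ltnS jm orbT.
Qed.

(** Separating the multiples of p in (a + pi)! makes all powers of p equal. The coefficients in one
    residue class modulo p thus form a binomial transform of the inverse p-free factorials, which is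
    used both for divisibility and for inversion. *)
Lemma dwc_binomial a m : (a < p)%N ->
  m`!%:R * p%:R ^+ m * dwc (a + p * m) =
  \sum_(i < m.+1) 'C(m, i)%:R / (PA (a + p * i))%:R.
Proof.
move=> ap; rewrite dwc_AP // (reindex_inj rev_ord_inj) /= mulr_sumr.
apply: eq_bigr => -[i im] _ /=; rewrite subSS; move: im; rewrite ltnS => im.
rewrite subKn // fact_pfree_AP // !natrM !natrX -(bin_fact im) !natrM.
have -> : p%:R ^+ m = p%:R ^+ i * p%:R ^+ (m - i) :> rat by rewrite -exprD subnKC.
have := factR_neq0 i; have := factR_neq0 (m - i).
have := pfreeR_neq0 (a + p * i); have pX k := expf_neq0 k pR_neq0.
move: (pX i) (pX (m - i)%N) => h1 h2 h3 h4 h5.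
by field; rewrite h1 h2 h3 h4 h5.
Qed.

End DworkCoefficients.

(** * Divisibility of the Dwork coefficients by p *)

Section DworkEstimates.
Variable p : nat.
Hypothesis p_pr : prime p.
Hypothesis p_odd : odd p.
Let p_gt0 : (0 < p)%N := prime_gt0 p_pr.
Let p_gt1 : (1 < p)%N := prime_gt1 p_pr.
Let pR_neq0 := natr_prime_neq0 p_pr.
Local Notation PA := (pfree_fact p).
Local Notation dwc := (dwc p).

(** At X = l this is the product of the integers prime to p among the p successors of a + pl; having
    it as one polynomial in l is what makes [tdiff] applicable. *)
Definition pfree_block (a : nat) : {poly int} :=
  \prod_(1 <= j < p.+1 | ~~ (p %| a + j)%N) ((a + j)%:Z%:P + p%:Z *: 'X).

Lemma pfree_fact_block a l :
  (PA (a + p * l.+1))%:Z = (PA (a + p * l))%:Z * (pfree_block a).[l%:Z].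
Proof.
have -> : PA (a + p * l.+1) = (PA (a + p * l) *
    \prod_(1 <= j < p.+1 | ~~ (p %| a + j)%N) (a + j + p * l))%N.
  rewrite /pfree_fact mulnS addnA (big_cat_nat (n := (a + p * l).+1)) //=; last by lia.
  congr (_ * _)%N; rewrite -[(a + p * l).+1]add1n.
  have -> : (a + p + p * l).+1 = (p.+1 + (a + p * l))%N by lia.
  rewrite big_addn addnK; apply: eq_big => [j|j _]; last by lia.
  by rewrite addnC addnAC dvdn_addl // dvdn_mulr.
rewrite PoszM horner_prod; congr (_ * _).
rewrite (big_morph Posz PoszM (erefl 1)); apply: eq_bigr => j _.
by rewrite !hornerE PoszD PoszM.
Qed.

Lemma natF_eq0 n : ((n%:R : 'F_p) == 0) = (p %| n)%N.
Proof. by rewrite -(dvdn_pcharf (pchar_Fp p_pr)). Qed.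

(** Wilson's theorem for a = 0; sliding the window by one replaces its first element by one
    congruent to it modulo p. *)
Lemma block_modp a :
  \prod_(1 <= j < p.+1 | ~~ (p %| a + j)%N) ((a + j)%:R : 'F_p) = -1.
Proof.
elim: a => [|a IHa].
  have wilson : ((p.-1)`!%:R : 'F_p) = -1.
    by apply/eqP; rewrite -addr_eq0 natr1 natF_eq0 -Wilson.
  rewrite -wilson fact_prod.
  rewrite big_mkcond big_nat_recr //= add0n dvdnn /= mulr1 natr_prod.
  have -> : p = p.-1.+1 by rewrite prednK.
  rewrite /=; apply: eq_big_nat => j /andP[j0 jp].
  by rewrite add0n gtnNdvd // -[p.-1.+1]/(p.-1.+1) ltnS; lia.
rewrite -IHa !(big_mkcond (fun j => ~~ _)) /=.
rewrite big_nat_recr //= [RHS]big_ltn //= mulrC.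
have e : ((a.+1 + p)%:R : 'F_p) = (a.+1)%:R.
  by rewrite natrD (pcharf0 (pchar_Fp p_pr)) addr0.
congr (_ * _); last first.
  by rewrite (big_addn 1 p.+1 1) subSS subn0; apply: eq_big_nat => j _; rewrite addn1 addnS addSn.
by rewrite addn1 e dvdn_addl.
Qed.

Lemma pfree_block_modp a : map_poly (intr : int -> 'F_p) (pfree_block a) = -1.
Proof.
rewrite /pfree_block rmorph_prod -[-1 in RHS]/(- 1%:P) -polyCN -(block_modp a) rmorph_prod.
apply: eq_bigr => j _; rewrite rmorphD /= map_polyZ map_polyX map_polyC /=.
by rewrite -[_%:~R]/((p%:R : 'F_p)) (pcharf0 (pchar_Fp p_pr)) scale0r addr0.
Qed.

(** Multiplied by the p-free factorial of a + pm, the terms of [dwc_binomial] become signed products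
    of blocks. The sum is then an m-th twisted difference at 0, whose divisibility is
    [iter_tdiff_dvd]. *)
Lemma dwc_integral a m : (a < p)%N -> (0 < m)%N -> exists z : int,
  m`!%:R * p%:R ^+ m * dwc (a + p * m) * (PA (a + p * m))%:R =
  (p ^ (m.-1 %/ p).+1)%N%:R * z%:~R.
Proof.
(* The blocks are read downwards from a + pm, hence the argument m - 1 - X; the sign makes u
   congruent to 1 modulo p. *)
move=> ap m0; pose u := - (pfree_block a \Po ((m.-1)%:Z%:P - 'X)).
have u1 : map_poly (intr : int -> 'F_p) u = 1.
  by rewrite /u rmorphN /= map_comp_poly /= pfree_block_modp rmorphN1 opprK.
have [g gE] := iter_tdiff_dvd p_pr u1 p_odd m0.
have ratio i : (i <= m)%N -> (PA (a + p * m))%:Z =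
    (PA (a + p * (m - i)))%:Z * ((-1) ^+ i * \prod_(l < i) u.[l%:Z]).
  elim: i => [|i IHi] im; first by rewrite subn0 big_ord0 expr0 !mulr1.
  rewrite IHi ?(ltnW im) // big_ord_recr /= -(subnSK im) pfree_fact_block.
  have -> : u.[i%:Z] = - (pfree_block a).[(m - i.+1)%:Z].
    rewrite /u hornerN horner_comp !hornerE; congr (- (_.[_])).
    by rewrite -subzn //; lia.
  by rewrite exprS; ring.
(* An m-th difference carries the signs (-1)^(m-i), whereas the block products carry (-1)^i; the
   factor (-1)^m reconciles them. *)
exists ((-1) ^+ m * g.[0]).
have -> : (p ^ (m.-1 %/ p).+1)%N%:R * ((-1) ^+ m * g.[0])%:~R =
   ((-1) ^+ m * (iter m (tdiff u) 1).[0])%:~R :> rat.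
  by rewrite gE hornerZ mulrCA [RHS]rmorphM.
have -> : (iter m (tdiff u) 1).[0] =
    \sum_(i < m.+1) (-1) ^+ (m - i) * \prod_(l < i) u.[l%:Z] *+ 'C(m, i).
  have := iter_fdiff_tdiff u m 1 0; rewrite big_ord0 mul1r => <-.
  rewrite iter_fdiff; apply: eq_bigr => i _.
  rewrite add0n hornerC mulr1; congr (_ * _ *+ _).
  by apply: eq_bigr => l _; rewrite natz.
rewrite dwc_binomial // (reindex_inj rev_ord_inj) /= mulr_suml mulr_sumr rmorph_sum.
apply: eq_bigr => -[i] /=; rewrite ltnS subSS => im _; rewrite bin_sub //.
have /(congr1 (fun z : int => z%:~R : rat)) := ratio i im.
rewrite rmorphM /= -!pmulrn => ->.
rewrite mulrA divfK ?pfreeR_neq0 //.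
have sgn : (-1) ^+ m * (-1) ^+ (m - i) = (-1) ^+ i :> int.
  rewrite -[in X in X * _](subnK im) exprD mulrAC -exprMn mulrNN mulr1 expr1n mul1r //.
by rewrite mulrnAr mulrA sgn rmorphMn /= mulr_natl.
Qed.

End DworkEstimates.

(** * Binomial inversion *)

Section BinomialInversion.
Variable V : pzRingType.

Lemma sum_binomialS (r : nat -> V) m :
  \sum_(i < m.+2) r i *+ 'C(m.+1, i) =
  \sum_(i < m.+1) r i *+ 'C(m, i) + \sum_(i < m.+1) r i.+1 *+ 'C(m, i).
Proof.
rewrite big_ord_recl /= bin0 mulr1n.
under eq_bigr => i _ do rewrite /bump leq0n add1n binS mulrnDr.
rewrite big_split /= addrA; congr (_ + _).
rewrite [RHS]big_ord_recl big_ord_recr /= bin_small // mulr0n addr0 bin0 mulr1n.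
by congr (_ + _); apply: eq_bigr => i _.
Qed.

Lemma fdiff_binomial (r : nat -> V) s j m :
  iter s (@fdiff V) (fun m => \sum_(i < m.+1) r (i + j)%N *+ 'C(m, i)) m =
  \sum_(i < m.+1) r (i + j + s)%N *+ 'C(m, i).
Proof.
elim: s m => [|s IHs] m; first by apply: eq_bigr => i _; rewrite addn0.
rewrite iterS /fdiff !IHs (sum_binomialS (fun i => r (i + j + s)%N)) addrC addKr.
by apply: eq_bigr => i _; congr (r _ *+ _); lia.
Qed.

(** By Pascal's rule a forward difference of the binomial transform shifts r by one, so s
    differences taken at 0 isolate r(s). *)
Lemma binomial_inversion (r : nat -> V) s :
  \sum_(m < s.+1) (-1) ^+ m * (\sum_(i < m.+1) r i *+ 'C(m, i)) *+ 'C(s, m) =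
  (-1) ^+ s * r s.
Proof.
have := fdiff_binomial r s 0 0; rewrite big_ord1 bin0 mulr1n !add0n => <-.
rewrite iter_fdiff mulr_sumr; apply: eq_bigr => -[m] /=; rewrite ltnS => ms _.
rewrite mulrnAr mulrA add0n; congr (_ * _ *+ _); last first.
  by apply: eq_bigr => i _; rewrite addn0.
by rewrite -exprD -signr_odd -[RHS]signr_odd oddD oddB // addKb.
Qed.

End BinomialInversion.

(** * An exact finite form of the Gross-Koblitz formula *)

Section GrossKoblitzSeries.
Variable p : nat.
Hypothesis p_pr : prime p.
Let p_gt0 : (0 < p)%N := prime_gt0 p_pr.
Let p_gt1 : (1 < p)%N := prime_gt1 p_pr.
Let pR_neq0 := natr_prime_neq0 p_pr.
Local Notation PA := (pfree_fact p).
Local Notation c := (dwc p).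

Variables a s : nat.
Hypothesis a_lt : (a < p)%N.

(** A triangular array joining the terms of the binomial inversion (column k = 0) to those of the
    Gross-Koblitz series (diagonal m = k). Between neighbouring columns the change splits into
    [gk_flux], which telescopes in m, and [gk_error], which carries the factor (p - 1) s + a. *)
Definition gk_term m k : rat := (- p%:R) ^+ m * ((s - k) ^_ (m - k))%:R * c (a + p * m - k).
Definition gk_flux m k : rat := p%:R * (- p%:R) ^+ m * ((s - k.+1) ^_ (m - k))%:R * c (a + p * m - k).
Definition gk_error i k : rat := (- p%:R) ^+ i.+1 * ((s - k.+1) ^_ (i - k))%:R * c (a + p * i.+1 - k).
Local Notation T := gk_term.
Local Notation U := gk_flux.
Local Notation E := gk_error.
Local Notation D := ((p.-1 * s + a)%:R : rat).

(** The recurrence [dwc_rec] at index a + p(i+1) - k eliminates the coefficient of the next column.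
    The falling factorials are all multiples of a single one, and a polynomial identity remains. *)
Lemma telescope_step k i : (k <= i < s)%N ->
  T i.+1 k - T i.+1 k.+1 = U i.+1 k - U i k - D * E i k.
Proof.
move=> /andP[ki si]; rewrite /gk_term /gk_flux /gk_error.
have pik : (k <= p * i)%N by apply: leq_trans ki _; rewrite leq_pmull.
have n1 : (a + p * i.+1 - k = (a + p * i.+1 - k.+1).+1)%N by rewrite mulnS; lia.
have n2 : (a + p * i - k = (a + p * i.+1 - k.+1).+1 - p)%N by rewrite mulnS; lia.
have := dwc_rec p_pr (a + p * i.+1 - k.+1).
rewrite -n1 n2 -n1; have -> : (p <= a + p * i.+1 - k)%N by rewrite mulnS; lia.
have nE : (a + p * i.+1 - k)%:R = a%:R + p%:R * i%:R + p%:R - k%:R :> rat.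
  by rewrite natrB ?natrD ?natrM ?mulnS; [rewrite -natr1; ring|lia].
rewrite nE.
set c1 := c (a + p * i.+1 - k); set c2 := c (a + p * i.+1 - k.+1).
set c3 := c (_ - p) => /esym/(canRL (addrK _)) cE.
rewrite subSS (subSn ki).
have -> : (s - k) ^_ (i - k).+1 = ((s - k) * (s - k.+1) ^_ (i - k))%N.
  by rewrite -[in LHS](subnSK (leq_ltn_trans ki si)) ffactSS subnSK ?(leq_ltn_trans ki si).
rewrite ffactnSr !natrM.
have -> : (s - k.+1 - (i - k) = s - i.+1)%N by lia.
rewrite !natrB ?natrD ?natrM //; try lia.
have -> : p.-1%:R = p%:R - 1 :> rat by rewrite -subn1 natrB.
by rewrite exprS cE -natr1; ring.
Qed.

Definition gk_row k : rat := \sum_(k <= m < s.+1) T m k.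
Local Notation S := gk_row.

(** Of the boundary terms of the flux, the upper one vanishes with its falling factorial and the
    lower one is p times the diagonal term. *)
Lemma telescope_row k : (k < s)%N ->
  S k = S k.+1 + (1 - p%:R) * T k k - D * \sum_(k <= i < s) E i k.
Proof.
move=> ks; have ks' : (k < s.+1)%N by exact: ltnW.
rewrite /gk_row (big_ltn ks') [in LHS]big_add1 [in RHS]big_add1 /=.
have -> : \sum_(k <= i < s) T i.+1 k = \sum_(k <= i < s) T i.+1 k.+1
    + \sum_(k <= i < s) (U i.+1 k - U i k) - D * \sum_(k <= i < s) E i k.
  rewrite mulr_sumr -big_split -sumrB /=; apply: eq_big_nat => i ik.
  by rewrite -addrA -telescope_step // addrC subrK.
rewrite telescope_sumr ?(ltnW ks) //.
have -> : U s k = 0 by rewrite /gk_flux ffact_small ?mulr0 ?mul0r //; lia.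
have -> : U k k = p%:R * T k k by rewrite /gk_flux /gk_term subnn !ffactn0 !mulrA.
ring.
Qed.

Lemma telescope_total :
  \sum_(m < s.+1) (-1) ^+ m * (m`!%:R * p%:R ^+ m * c (a + p * m)) *+ 'C(s, m) =
  (1 - p%:R) * \sum_(k < s.+1) T k k + p%:R * T s s
  - D * \sum_(k < s) \sum_(k <= i < s) E i k.
Proof.
have gen j : (j <= s)%N -> S 0 = S j + (1 - p%:R) * \sum_(k < j) T k k
    - D * \sum_(k < j) \sum_(k <= i < s) E i k.
  elim: j => [|j IHj] js; first by rewrite !big_ord0 !mulr0 subr0 addr0.
  by rewrite IHj ?(ltnW js) // telescope_row // !big_ord_recr /=; ring.
have -> : \sum_(m < s.+1) (-1) ^+ m * (m`!%:R * p%:R ^+ m * c (a + p * m)) *+ 'C(s, m) = S 0.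
  rewrite /gk_row big_mkord; apply: eq_bigr => m _.
  rewrite /gk_term !subn0 -bin_ffact natrM [(- p%:R) ^+ m]exprNn -mulr_natr; ring.
rewrite (gen s) // /gk_row big_nat1 big_ord_recr /=; ring.
Qed.

(** The left side is the binomial inversion of [dwc_binomial]. When s tends p-adically to -a/(p-1),
    the factor (p - 1) s + a tends to 0 and the left side to a value of Gamma_p up to sign. *)
Lemma gross_koblitz_series :
  (-1) ^+ s / (PA (a + p * s))%:R =
  (1 - p%:R) * \sum_(k < s.+1) (- p%:R) ^+ k * c (a + p.-1 * k)
  + p%:R * ((- p%:R) ^+ s * c (a + p.-1 * s))
  - D * \sum_(k < s) \sum_(k <= i < s) E i k.
Proof.
have TE k : T k k = (- p%:R) ^+ k * c (a + p.-1 * k).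
  rewrite /gk_term subnn ffactn0 mulr1 -subn1 mulnBl mul1n addnBA //.
  by rewrite leq_pmull.
rewrite -TE -(eq_bigr _ (fun k _ => TE _)) -telescope_total.
rewrite -(binomial_inversion (fun i => (PA (a + p * i))%:R^-1) s); apply: eq_bigr => m _.
by rewrite dwc_binomial //; congr (_ * _ *+ _); apply: eq_bigr => i _; rewrite mulr_natl.
Qed.

End GrossKoblitzSeries.

(** * Valuations of the Dwork coefficients and of the error terms *)

Section Growth.
Variable p : nat.
Hypothesis p_pr : prime p.
Hypothesis p_odd : odd p.
Let p_gt0 : (0 < p)%N := prime_gt0 p_pr.
Let p_gt1 : (1 < p)%N := prime_gt1 p_pr.
Let pR_neq0 := natr_prime_neq0 p_pr.
Local Notation PA := (pfree_fact p).
Local Notation c := (dwc p).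
Local Notation v n := (logn p n).

Lemma p_gt2 : (2 < p)%N.
Proof. by case: p p_pr p_odd => [|[|[|]]]. Qed.

Lemma logn_fact_rec n : v n`! = (n %/ p + v (n %/ p)`!)%N.
Proof.
rewrite {1}(fact_pfree p_pr) !lognM ?expn_gt0 ?p_gt0 ?muln_gt0 ?expn_gt0 ?p_gt0 ?fact_gt0 //.
- rewrite pfactorK // [X in (_ + X)%N]lognE (negPf (pfree_fact_ndvd p_pr n)) !andbF.
  by rewrite addn0.
- rewrite lt0n; apply: contraNneq (pfree_fact_ndvd p_pr n) => ->; exact: dvdn0.
Qed.

Lemma logn_fact_le n : (p.-1 * v n`! <= n)%N.
Proof.
elim/ltn_ind: n => n IHn.
case: (ltnP n p) => [np|pn].
  by rewrite logn_fact_rec divn_small // fact0 logn1 addn0 muln0.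
rewrite logn_fact_rec; have lt : (n %/ p < n)%N by rewrite ltn_Pdiv // (leq_trans p_gt0).
have := IHn _ lt; have := leq_trunc_div n p.
move: (n %/ p)%N (v _) => d w; move: p_gt0; case: p => // p' _ /=; nia.
Qed.

(** Legendre: n - (p - 1) v(n!) is the base p digit sum of n, at most p - 1 for each of l digits. *)
Lemma logn_fact_ge n l : (n < p ^ l)%N -> (n <= p.-1 * (v n`! + l))%N.
Proof.
elim: l n => [|l IHl] n; first by rewrite expn0; case: n.
rewrite expnSr -ltn_divLR // => /IHl; rewrite (logn_fact_rec n).
have := ltn_mod n p; have := divn_eq n p; rewrite p_gt0.
move: (n %/ p)%N (n %% p)%N (v _) => d r w -> .
move: p_gt0; case: p => // p' _ /=; nia.
Qed.

Lemma vge_natV n : (0 < n)%N -> vge p (- (v n)%:Z) n%:R^-1.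
Proof.
move=> n0; have [m pm nE] := pfactor_coprime p_pr n0.
rewrite prime_coprime // in pm.
rewrite {2}nE natrM invfM natrX mulrC -[- _]addr0; apply: vgeM => //.
  by rewrite -[p%:R ^+ _]/(p%:R ^ (v n)%:Z) invr_expz; exact: vge_exp.
by apply/vge0; exact: pintV.
Qed.

Lemma vge_nat n : (0 < n)%N -> vge p (v n)%:Z n%:R.
Proof. by move=> n0; apply: vge_dvd => //; exact: pfactor_dvdnn. Qed.

Lemma vge_pexp m : vge p m%:Z ((- p%:R) ^+ m).
Proof.
rewrite exprNn -[m%:Z]add0r; apply: vgeM (vge_expn p_pr m) => //.
by apply/vge0; apply: pintX => //; apply: pintN; exact: pint1.
Qed.

(** A lower bound for the valuation of c(n) pi^n, where v(pi) = 1/(p-1). For n at least p it is the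
    exponent of [dwc_integral]; it grows like n/p^2. *)
Definition dwc_order (n : nat) : nat :=
  if (n < p)%N then 0%N else ((n %/ p).-1 %/ p).+1.

(** With n = a + pm, the division by m! p^m in [dwc_integral] costs at most m/(p-1) + m = pm/(p-1),
    which is compensated by pi^n. *)
Lemma vge_dwc n : exists2 e : int,
  vge p e (c n) & (p.-1 * dwc_order n)%N%:Z <= p.-1%:Z * e + n%:Z.
Proof.
rewrite /dwc_order; case: ltnP => [np|pn].
  exists 0; last by rewrite muln0 mulr0 add0r.
  rewrite dwc_small //; have := vge_natV (fact_gt0 n).
  by rewrite logn_fact_rec divn_small // fact0 logn1.
set a := (n %% p)%N; set m := (n %/ p)%N.
have ap : (a < p)%N by rewrite ltn_mod.
have m0 : (0 < m)%N by rewrite divn_gt0.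
have nE : n = (a + p * m)%N by rewrite addnC mulnC -divn_eq.
have [z zE] := dwc_integral p_pr p_odd ap m0.
have cE : c n = (p ^ (m.-1 %/ p).+1)%N%:R * (z%:~R * (PA (a + p * m))%:R^-1) *
     (m`!%:R^-1 * (p%:R ^+ m)^-1).
  have h1 := factR_neq0 m; have h2 := pfreeR_neq0 p_pr (a + p * m).
  have h3 := expf_neq0 m pR_neq0.
  by rewrite mulrA -zE [in LHS]nE; field; rewrite h1 h2 h3.
exists ((m.-1 %/ p).+1%:Z + 0 + (- (v m`!)%:Z + - m%:Z)).
  rewrite cE; apply: vgeM => //; apply: vgeM => //.
  - exact: vge_dvd.
  - apply/vge0; apply: pintM => //; first exact: pint_int.
    by apply: pintV => //; exact: pfree_fact_ndvd.
  - exact: vge_natV (fact_gt0 m).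
  - by rewrite -[p%:R ^+ m]/(p%:R ^ m%:Z) invr_expz; exact: vge_exp.
have := logn_fact_le m; rewrite -(ler_nat int) nE.
rewrite !natrM !mulrDr mulr0 addr0; move: ((m.-1 %/ p).+1) (v _) => K w.
have -> : p = p.-1.+1 by rewrite prednK.
move: p.-1 => p' /=; nia.
Qed.

(** The leftover a/(p-1) is less than 1, so it is absorbed because valuations are integers. *)
Lemma vge_dwc_term a k : (a < p.-1)%N ->
  vge p (dwc_order (a + p.-1 * k))%:Z ((- p%:R) ^+ k * c (a + p.-1 * k)).
Proof.
move=> ap; have [e he le] := vge_dwc (a + p.-1 * k).
apply: (@vge_le p p_pr (k%:Z + e)); last by apply: vgeM => //; exact: vge_pexp.
move: le; rewrite PoszM PoszD PoszM.
move: (dwc_order _) => K; move: ap; move: p.-1 => p' ap; nia.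
Qed.

Lemma dwc_order_mono m n : (m <= n)%N -> (dwc_order m <= dwc_order n)%N.
Proof.
move=> mn; rewrite /dwc_order; case: (ltnP n p) => np.
  by rewrite (leq_ltn_trans mn np).
by case: ltnP => // _; rewrite ltnS leq_div2r // -!subn1 leq_sub2r // leq_div2r.
Qed.

Lemma leq_dwc_order k : (k <= dwc_order (p ^ 2 * k))%N.
Proof.
rewrite /dwc_order; case: ltnP => [h|h].
  by move: h; case: k => // k; rewrite mulnS; have := p_gt1; nia.
rewrite expnS expn1 -mulnA mulKn //.
case: k h => // k _; rewrite mulnS.
have -> : ((p + p * k).-1 = k * p + p.-1)%N by lia.
by rewrite divnMDl // divn_small ?addn0 // prednK.
Qed.

(** The falling factorial is a binomial coefficient times (i-k)!, whose valuation is linear up to a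
    logarithmic loss; the linear growth of [dwc_order] outweighs that loss. A bound uniform in s is
    what allows the limit. *)
Lemma vge_gk_error a s i k : (a < p.-1)%N -> (k <= i < s)%N ->
  vge p (-3) (gk_error p a s i k).
Proof.
move=> ap /andP[ki si]; rewrite /gk_error.
set L := (i - k)%N; set n := (a + p * i.+1 - k)%N.
have [e he le] := vge_dwc n.
rewrite -bin_ffact natrM.
(* With this t, L has at most t + 3 digits in base p, while [dwc_order n] is at least t + 1. *)
pose t := ((p.-1 * L) %/ p ^ 2)%N.
have Lt : (L < p ^ t.+3)%N.
  have h1 : (p.-1 * L < p ^ 2 * t.+1)%N.
    by rewrite [X in (_ < X)%N]mulnC -ltn_divLR ?expn_gt0 ?p_gt0.
  have h2 : (p ^ 2 * t.+1 <= p ^ t.+3)%N.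
    have -> : (t.+3 = 2 + t.+1)%N by [].
    by rewrite expnD leq_mul2l ltnW ?orbT // ltn_expl.
  by apply: leq_trans h2; apply: leq_ltn_trans h1; rewrite leq_pmull // -ltnS prednK.
have Lv := logn_fact_ge Lt.
have tK : (t.+1 <= dwc_order n)%N.
  have pn : (p + p.-1 * L <= n)%N.
    have iE : i = (k + L)%N by rewrite subnKC.
    have kn : (k <= a + p * (k + L).+1)%N.
      by have := leq_pmull (k + L).+1 p_gt0; lia.
    rewrite /n iE -(leq_add2r k) subnK //; have := p_gt0.
    case: (p) => // p' _ /=; have := leq0n (p' * k); lia.
  apply: leq_trans (dwc_order_mono pn); rewrite /dwc_order [(p + _ < p)%N]ltnNge leq_addr /= ltnS.
  by rewrite divnDl ?dvdnn // divnn p_gt0 add1n /= /t expnS expn1 divnMA.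
apply: (@vge_le p p_pr (i.+1%:Z + (0 + (v L`!)%:Z) + e)); last first.
  apply: vgeM => //; apply: vgeM => //; first exact: vge_pexp.
  by apply: vgeM => //; [apply/vge0; exact: pint_nat | exact: vge_nat (fact_gt0 L)].
have nE : (n + k = a + p.-1.+1 * i.+1)%N.
  by rewrite prednK // /n subnK //; have := leq_pmull i.+1 p_gt0; lia.
have iE : (i = k + L)%N by rewrite subnKC.
clearbody n L; move: le Lv tK nE ap; rewrite iE.
have p'0 : (0 < p.-1)%N by have := p_gt2; lia.
move: (dwc_order n) (v L`!) => K w.
move: p.-1 p'0 => p' p'0 le Lv tK nE ap.
have tK' : (p' * t.+1 <= p' * K)%N by rewrite leq_mul2l tK orbT.
(* The constant 3 is made of 2 from t + 3 against t + 1, and 1 from a + 1 <= p - 1. *)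
suff : 0 <= p'%:Z * ((k + L).+1%:Z + (0 + w%:Z) + e + 3).
  by rewrite pmulr_rge0 //; lia.
by move: le; rewrite PoszM; lia.
Qed.

Lemma vge_gk_difference a s r : (a < p.-1)%N -> (p ^ r %| p.-1 * s + a)%N ->
  vge p (r%:Z - 3) ((-1) ^+ s / (PA (a + p * s))%:R -
    ((1 - p%:R) * \sum_(k < s.+1) (- p%:R) ^+ k * c (a + p.-1 * k)
     + p%:R * ((- p%:R) ^+ s * c (a + p.-1 * s)))).
Proof.
move=> ap rD; have ap' : (a < p)%N by apply: leq_trans ap (leq_pred p).
rewrite (gross_koblitz_series p_pr s ap') addrAC subrr add0r.
apply: vgeN; apply: vgeM => //; first exact: vge_dvd.
apply: vge_sum => // k _; rewrite big_seq_cond; apply: vge_sum => // i.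
by rewrite andbT mem_index_iota => iks; apply: vge_gk_error.
Qed.

End Growth.

(** * Adjoining a root to a commutative ring *)

Section QuotientPoly.
Variables (A : comNzRingType) (h : {poly A}).
Hypotheses (h_monic : h \is monic) (h_size : (1 < size h)%N).

Lemma mk_monic_id : mk_monic h = h.
Proof. by rewrite /mk_monic h_size h_monic. Qed.

Lemma qpolyC_inj : injective (qpolyC h).
Proof.
move=> x y /(congr1 (fun u : {poly %/ h} => (u : {poly A})`_0)).
by rewrite !qpolyCE !coefC.
Qed.

Lemma in_qpolyC a : in_qpoly h a%:P = qpolyC h a.
Proof.
apply: val_inj; rewrite /= -[RHS]/(a%:P) Pdiv.CommonRing.rmodp_small // mk_monic_id.
by rewrite size_polyC; case: (_ != _); rewrite // ltnW.
Qed.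

Lemma in_qpoly_modulus : in_qpoly h h = 0.
Proof. by apply: val_inj; rewrite /= mk_monic_id Pdiv.RingMonic.rmodpp. Qed.

Lemma in_qpolyXn f n : in_qpoly h (f ^+ n) = in_qpoly h f ^+ n.
Proof.
by elim: n => [|n IHn]; rewrite ?expr0 ?exprS ?in_qpoly1 // in_qpolyM IHn.
Qed.

Lemma root_extension (a : A) (d : nat) : h = 'X^d - a%:P ->
  (in_qpoly h 'X) ^+ d = qpolyC h a.
Proof.
move=> hE; rewrite -in_qpolyXn -in_qpolyC; have -> : 'X^d = h + a%:P by rewrite hE subrK.
by rewrite in_qpolyD in_qpoly_modulus add0r.
Qed.

End QuotientPoly.

(** Used to adjoin pi with pi^(p-1) = -p to ['Z_(p ^ N)]. Constants embed because the modulus is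
    monic of positive degree, and this injectivity lets identities be pulled back from R. *)
Lemma exists_root_extension (A : comNzRingType) (a : A) (d : nat) : (0 < d)%N ->
  exists (R : comNzRingType) (iota : {rmorphism A -> R}) (x : R),
    injective iota /\ x ^+ d = iota a.
Proof.
move=> d1; have hm := monicXnsubC a d1; have hs := size_XnsubC a d1.
move: hm hs; move hE : ('X^d - a%:P) => h hm hs.
have hs1 : (1 < size h)%N by rewrite hs.
exists ({poly %/ h} : comNzRingType).
exists (qpolyC h : {rmorphism A -> {poly %/ h}}).
exists (in_qpoly h 'X).
split; [exact: qpolyC_inj | exact: root_extension].
Qed.

(** * Truncated exponentials and their differential equations *)

Section TruncatedODE.

Lemma polyXn_factor (A : nzRingType) m (f : {poly A}) :
  (forall i, (i < m)%N -> f`_i = 0) -> exists r, f = 'X^m * r.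
Proof.
move=> h; exists (drop_poly m f); apply/polyP => i.
rewrite coefXnM coef_drop_poly; case: ltnP => [/h //|mi].
by rewrite subnK.
Qed.

Lemma deriv_Xn_coef (f r : {poly rat}) m n :
  f^`() = 'X^m * r -> (0 < n <= m)%N -> f`_n = 0.
Proof.
move=> fE /andP[n0 nm]; have := congr1 (fun g : {poly rat} => g`_n.-1) fE.
rewrite coef_deriv coefXnM prednK // nm => /eqP.
by rewrite mulrn_eq0 -leqn0 leqNgt n0 => /eqP.
Qed.

Definition expp (c : rat) (L : nat) : {poly rat} := \poly_(n < L) (c ^+ n / n`!%:R).

Lemma deriv_expp c L : exists r, (expp c L)^`() = c *: expp c L + 'X^(L.-1) * r.
Proof.
have [i iL|r rE] := @polyXn_factor _ L.-1 ((expp c L)^`() - c *: expp c L).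
  rewrite coefB coefZ coef_deriv !coef_poly.
  have -> : (i.+1 < L)%N by case: L iL.
  have -> : (i < L)%N by case: L iL => // L /leqW.
  have h := factR_neq0 i; have h' : i.+1%:R != 0 :> rat by rewrite pnatr_eq0.
  have -> : c ^+ i.+1 / (i.+1)`!%:R *+ i.+1 = c * (c ^+ i / i`!%:R).
    rewrite -[LHS]mulr_natr factS natrM exprS; move: h' h.
    by move: (i.+1%:R) (i`!%:R) => u v hu hv; field; rewrite hu hv.
  by rewrite subrr.
by exists r; rewrite -rE addrC subrK.
Qed.

Lemma expp_coef0 c L : (0 < L)%N -> (expp c L)`_0 = 1.
Proof. by move=> L0; rewrite coef_poly L0 expr0 fact0 divr1. Qed.

Variable p : nat.
Hypothesis p_pr : prime p.
Let p_gt0 : (0 < p)%N := prime_gt0 p_pr.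
Let p_gt1 : (1 < p)%N := prime_gt1 p_pr.

Definition dwp (L : nat) : {poly rat} := \poly_(n < L) dwc p n.

Lemma deriv_dwp L : exists r, (dwp L)^`() = (1 + 'X^(p.-1)) * dwp L + 'X^(L.-1) * r.
Proof.
have [i iL|r rE] := @polyXn_factor _ L.-1 ((dwp L)^`() - (1 + 'X^(p.-1)) * dwp L).
  rewrite coefB mulrDl mul1r coefD coefXnM coef_deriv !coef_poly.
  have -> : (i.+1 < L)%N by case: L iL.
  have iL' : (i < L)%N by case: L iL => // L /leqW.
  rewrite iL' -mulr_natl dwc_rec // (leq_ltn_trans (leq_subr _ _) iL').
  have -> : (i < p.-1)%N = ~~ (p <= i.+1)%N by rewrite -ltnNge -{2}(prednK p_gt0) ltnS.
  case: leqP => _ /=; last by rewrite subrr.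
  by have -> : (i.+1 - p = i - p.-1)%N; [lia | rewrite subrr].
by exists r; rewrite -rE addrC subrK.
Qed.

Lemma dwp_coef0 L : (0 < L)%N -> (dwp L)`_0 = 1.
Proof. by move=> L0; rewrite coef_poly L0 dwc_small // fact0 invr1. Qed.

(** For full series E(X)^p = exp(pX + X^p), so the product would be 1. The truncations satisfy the
    same differential equations up to order L - 1, and the logarithmic derivatives cancel. *)
Lemma dwp_expp L : (0 < L)%N -> exists r,
  (dwp L ^+ p * expp (- p%:R) L * (expp (-1) L \Po 'X^p))^`() = 'X^(L.-1) * r.
Proof.
move=> L0.
have [r1 e1] := deriv_dwp L; have [r2 e2] := deriv_expp (- p%:R) L.
have [r3 e3] := deriv_expp (-1) L.
set f := dwp L in e1 *; set g := expp (- p%:R) L in e2 *; set k := expp (-1) L in e3 *.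
have e4 : (k \Po 'X^p)^`() = (- (k \Po 'X^p) +
    'X^(L.-1) * ('X^(L.-1 * p.-1) * (r3 \Po 'X^p))) * (p%:R * 'X^(p.-1)).
  rewrite deriv_comp e3 derivXn comp_polyD comp_polyZ comp_polyM scaleN1r.
  rewrite comp_Xn_poly -exprM mulr_natl; congr ((_ + _) * _).
  have -> : (p * L.-1 = L.-1 + L.-1 * p.-1)%N by rewrite -{1}(prednK p_gt0) mulSn [(p.-1 * _)%N]mulnC.
  by rewrite mulrA -exprD.
exists (f ^+ p.-1 * p%:R * r1 * g * (k \Po 'X^p) + f ^+ p * r2 * (k \Po 'X^p) +
   f ^+ p * g * ('X^(L.-1 * p.-1) * (r3 \Po 'X^p)) * (p%:R * 'X^(p.-1))).
rewrite !derivM deriv_exp -[f^`() * _ *+ p]mulr_natr e1 e2 e4; clear e1 e2 e3 e4.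
have -> : f ^+ p = f * f ^+ p.-1 by rewrite -exprS prednK.
rewrite -mul_polyC polyCN polyC_natr.
clearbody f g k; move: (f ^+ p.-1) (k \Po 'X^p) ('X^(L.-1)) ('X^(p.-1)) => a b u v.
move: ('X^(_)) (p%:R) (r3 \Po _) => w x y. ring.
Qed.

Lemma expp_inverse c L : exists r,
  (expp (- c) L * expp c L)^`() = 'X^(L.-1) * r.
Proof.
have [r1 e1] := deriv_expp (- c) L; have [r2 e2] := deriv_expp c L.
exists (r1 * expp c L + expp (- c) L * r2).
by rewrite derivM e1 e2 -!mul_polyC polyCN; ring.
Qed.

End TruncatedODE.

(** * Weights: valuations of polynomial coefficients after X = pi y *)

Section Weights.
Variable p : nat.
Hypothesis p_pr : prime p.
Hypothesis p_odd : odd p.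
Let p_gt0 : (0 < p)%N := prime_gt0 p_pr.
Let p_gt1 : (1 < p)%N := prime_gt1 p_pr.
Let p_gt2' : (2 < p)%N := p_gt2 p_pr p_odd.
Let pR_neq0 := natr_prime_neq0 p_pr.

(* [fil w n x]: the monomial x y^n has valuation >= w / (p - 1) at y = pi, pi^(p-1) = - p. *)
Definition fil (w : int) (n : nat) (x : rat) : Prop :=
  exists2 e : int, vge p e x & w <= p.-1%:Z * e + n%:Z.

Lemma fil_le w w' n x : w' <= w -> fil w n x -> fil w' n x.
Proof. by move=> le [e he h]; exists e => //; apply: le_trans h. Qed.

Lemma fil_0 w n : fil w n 0.
Proof.
exists `|w|%N%:Z; first exact: vge_0.
have : `|w|%N%:Z <= p.-1%:Z * `|w|%N%:Z.
  by rewrite -{1}[`|w|%N%:Z]mul1r ler_wpM2r // lez_nat; lia.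
by have := lez_abs w; lia.
Qed.

Lemma filD w n x y : fil w n x -> fil w n y -> fil w n (x + y).
Proof.
move=> [e he le] [f hf lf]; case: (lerP e f) => ef.
  by exists e => //; apply: vgeD => //; apply: vge_le hf.
by exists f => //; apply: vgeD => //; apply: vge_le he => //; exact: ltW.
Qed.

Lemma filN w n x : fil w n x -> fil w n (- x).
Proof. by move=> [e he le]; exists e => //; exact: vgeN. Qed.

Lemma filM w w' n m x y : fil w n x -> fil w' m y -> fil (w + w') (n + m) (x * y).
Proof.
move=> [e he le] [f hf lf]; exists (e + f); first exact: vgeM.
by rewrite PoszD mulrDr; lia.
Qed.

Lemma fil_sum w n (I : Type) (r : seq I) (P : pred I) (F : I -> rat) :
  (forall i, P i -> fil w n (F i)) -> fil w n (\sum_(i <- r | P i) F i).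
Proof. by move=> h; apply: big_ind => //; [exact: fil_0|exact: filD]. Qed.

(* Multiplying by (-p)^(n / (p-1)) moves the valuation of x y^n to its residual exponent. *)
Lemma fil_residual m n x : fil (p.-1 * m)%N%:Z n x ->
  vge p m%:Z (x * (- p%:R) ^+ (n %/ p.-1)).
Proof.
move=> [e he le]; apply: (@vge_le p p_pr (e + (n %/ p.-1)%:Z)).
  have := divn_eq n p.-1; have : (n %% p.-1 < p.-1)%N by rewrite ltn_mod; lia.
  move: le; rewrite PoszM; move: (n %/ p.-1)%N (n %% p.-1)%N => d r le rp nE.
  rewrite -ltzD1; have : p.-1%:Z * m%:Z < p.-1%:Z * (e + d%:Z + 1) by rewrite nE in le; lia.
  by rewrite ltr_pM2l //; lia.
by apply: vgeM => //; exact: vge_pexp.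
Qed.

Definition weighted (w : nat -> int) (f : {poly rat}) : Prop :=
  forall n, fil (w n) n f`_n.

Lemma weightedM w w' w'' f g : weighted w f -> weighted w' g ->
  (forall i j, w'' (i + j)%N <= w i + w' j) -> weighted w'' (f * g).
Proof.
move=> hf hg le n; rewrite coefM; apply: fil_sum => -[i] /=; rewrite ltnS => im _.
rewrite -{1 2}(subnKC im); apply: fil_le (le _ _) _; exact: filM.
Qed.

Lemma weighted1 w : w 0%N <= 0 -> weighted w 1.
Proof.
move=> w0 n; rewrite coef1; case: eqP => [->|_]; last exact: fil_0.
by exists 0; [apply/vge0; exact: pint1 | rewrite mulr0 addr0].
Qed.

(** A linear lower bound in units of 1/(p-1). The offset d records the loss in products: the integer
    parts of i/p^2 and j/p^2 may miss a carry, so each multiplication costs 1 ([slopeD]). *)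
Definition slope (d n : nat) : int := p.-1%:Z * ((n %/ p ^ 2)%N%:Z - d%:Z).

Lemma slope_ge0 n : 0 <= slope 0 n.
Proof. by rewrite /slope subr0 mulr_ge0. Qed.

Lemma slopeD d d' i j : slope (d + d').+1 (i + j) <= slope d i + slope d' j.
Proof.
rewrite /slope -mulrDr ler_wpM2l //.
suff : ((i + j) %/ p ^ 2 <= i %/ p ^ 2 + j %/ p ^ 2 + 1)%N by lia.
rewrite -ltnS ltn_divLR ?expn_gt0 ?p_gt0 //.
have p2 : (0 < p ^ 2)%N by rewrite expn_gt0 p_gt0.
have := ltn_mod i (p ^ 2); have := ltn_mod j (p ^ 2); rewrite p2.
have := divn_eq i (p ^ 2); have := divn_eq j (p ^ 2).
move: (p ^ 2)%N (i %/ _)%N (j %/ _)%N (i %% _)%N (j %% _)%N => q a b u v; lia.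
Qed.

Lemma weighted0M f g : weighted (fun=> 0) f -> weighted (fun=> 0) g -> weighted (fun=> 0) (f * g).
Proof. by move=> hf hg; apply: weightedM hf hg _ => i j; rewrite addr0. Qed.

Lemma weighted0X f n : weighted (fun=> 0) f -> weighted (fun=> 0) (f ^+ n).
Proof.
move=> hf; elim: n => [|n IHn]; first by rewrite expr0; exact: weighted1.
by rewrite exprS; exact: weighted0M.
Qed.

Lemma weighted_slopeX f n : weighted (slope 0) f -> weighted (slope n) (f ^+ n).
Proof.
move=> hf; elim: n => [|n IHn].
  by rewrite expr0; apply: weighted1; rewrite /slope div0n subr0 mulr0.
by rewrite exprS; apply: weightedM hf IHn _ => i j; rewrite -[n.+1]/((0 + n).+1); exact: slopeD.
Qed.

Lemma slope_weighted0 f : weighted (slope 0) f -> weighted (fun=> 0) f.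
Proof. by move=> hf n; apply: fil_le (slope_ge0 n) _. Qed.

Lemma weighted_dwp L : weighted (slope 0) (dwp p L).
Proof.
move=> n; rewrite coef_poly; case: ifP => _; last exact: fil_0.
have [e he le] := vge_dwc p_pr p_odd n; exists e => //; apply: le_trans le.
rewrite /slope subr0 PoszM ler_wpM2l // lez_nat.
by apply: leq_trans (leq_dwc_order p_pr p_odd _) _; apply: dwc_order_mono; rewrite mulnC leq_trunc_div.
Qed.

Lemma fil_exp (m : nat) (c : int) n : fil (p.-1 * m)%N%:Z (n + p.-1 * m) (c%:~R / n`!%:R).
Proof.
exists (0 + - (logn p n`!)%:Z).
  apply: vgeM => //; last exact: vge_natV (fact_gt0 n).
  by apply/vge0; exact: pint_int.
have := logn_fact_le p_pr p_odd n; move: (logn _ _) p.-1 => l p'.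
by rewrite PoszD !PoszM add0r mulrN; lia.
Qed.

Lemma weighted_expp (s : int) L : weighted (slope 0) (expp (s * p%:Z)%:~R L).
Proof.
move=> n; rewrite coef_poly; case: ifP => _; last exact: fil_0.
exists (n%:Z + - (logn p n`!)%:Z).
  apply: vgeM => //; last exact: vge_natV (fact_gt0 n).
  rewrite rmorphM exprMn -[n%:Z]add0r; apply: vgeM => //; last exact: vge_expn.
  by apply/vge0; apply: pintX => //; exact: pint_int.
have := logn_fact_le p_pr p_odd n; rewrite /slope subr0 mulrDr mulrN.
have : (p.-1 * (n %/ p ^ 2) <= p.-1 * n)%N by rewrite leq_mul2l leq_div orbT.
move: (logn _ _) p.-1 (n %/ _)%N => l p' d; lia.
Qed.

(** In degree pm = m + (p-1) m, the part m of the exponent of pi makes up for 1/m!, and the weight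
    (p-1) m remains. *)
Lemma weighted_expp_comp L : weighted (slope 0) (expp (-1) L \Po 'X^p).
Proof.
move=> n; rewrite coef_comp_poly_Xn // coef_poly; case: ifP => [dv|_]; last exact: fil_0.
case: ifP => _; last exact: fil_0.
have [m ->] := dvdnP dv; rewrite mulnK //.
have -> : (-1) ^+ m = ((-1) ^+ m : int)%:~R :> rat by rewrite rmorphXn /= rmorphN1.
have -> : (m * p = m + p.-1 * m)%N by rewrite -{1}(prednK p_gt0); lia.
apply: fil_le (fil_exp m _ m); rewrite /slope subr0 PoszM ler_wpM2l // lez_nat.
have -> : (m + p.-1 * m = p * m)%N by rewrite -{2}(prednK p_gt0); lia.
by rewrite expnS expn1 divnMl // leq_div.
Qed.

End Weights.

(** * Dwork's splitting function over R *)

Section SplittingFunction.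
Variables (p N : nat).
Hypotheses (p_pr : prime p) (p_odd : odd p) (N_gt0 : (0 < N)%N).
Let p_gt0 : (0 < p)%N := prime_gt0 p_pr.
Let p_gt1 : (1 < p)%N := prime_gt1 p_pr.
Let p_gt2' : (2 < p)%N := p_gt2 p_pr p_odd.
Let pR_neq0 := natr_prime_neq0 p_pr.
Local Notation Z := 'Z_(p ^ N).
Local Notation red := (@red p N).
Variables (R : comNzRingType) (iota : {rmorphism Z -> R}) (pi : R).
Hypothesis pi_exp : pi ^+ p.-1 = - p%:R.

(** The element x pi^n of R. Full powers pi^(p-1) = -p are moved into the rational factor before
    reduction, since x alone need not be p-integral. *)
Definition mono (n : nat) (x : rat) : R :=
  iota (red (x * (- p%:R) ^+ (n %/ p.-1))) * pi ^+ (n %% p.-1).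

Lemma fil0_pint n x : fil p 0 n x -> pint p (x * (- p%:R) ^+ (n %/ p.-1)).
Proof. by move=> h; apply/vge0; apply: fil_residual => //; rewrite muln0. Qed.

Lemma mono0 n : mono n 0 = 0.
Proof. by rewrite /mono mul0r red0 // rmorph0 mul0r. Qed.

Lemma monoD n x y : fil p 0 n x -> fil p 0 n y -> mono n (x + y) = mono n x + mono n y.
Proof.
by move=> /fil0_pint hx /fil0_pint hy; rewrite /mono mulrDl redD // rmorphD mulrDl.
Qed.

Lemma mono_sum n (I : Type) (r : seq I) (P : pred I) (F : I -> rat) :
  (forall i, P i -> fil p 0 n (F i)) ->
  mono n (\sum_(i <- r | P i) F i) = \sum_(i <- r | P i) mono n (F i).
Proof.
move=> h; suff [] : fil p 0 n (\sum_(i <- r | P i) F i) /\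
  mono n (\sum_(i <- r | P i) F i) = \sum_(i <- r | P i) mono n (F i) by [].
apply: (big_rec2 (fun x y => fil p 0 n x /\ mono n x = y)).
  by split; [exact: fil_0 | exact: mono0].
by move=> i x y Pi [hy <-]; split; [apply: filD => //; exact: h|rewrite monoD //; exact: h].
Qed.

Lemma mono_shift n m x : mono (n + p.-1 * m) x = mono n (x * (- p%:R) ^+ m).
Proof.
have p10 : (0 < p.-1)%N by lia.
by rewrite /mono addnC mulnC divnMDl // modnMDl exprD mulrA.
Qed.

Lemma red_negp : red (- p%:R) = - p%:R.
Proof. by rewrite redN ?red_nat //; exact: pint_nat. Qed.

Lemma iota_negp : iota (- p%:R) = pi ^+ p.-1.
Proof. by rewrite pi_exp rmorphN rmorph_nat. Qed.

Lemma monoM n m x y : fil p 0 n x -> fil p 0 m y ->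
  mono (n + m) (x * y) = mono n x * mono m y.
Proof.
move=> hx hy; have px := fil0_pint hx; have py := fil0_pint hy.
have p10 : (0 < p.-1)%N by lia.
have pp : pint p (- p%:R) by apply: pintN; exact: pint_nat.
rewrite {2 3}/mono mulrACA -rmorphM -redM // -exprD.
rewrite {1}(divn_eq n p.-1) {1}(divn_eq m p.-1).
set d := (n %/ p.-1)%N; set r := (n %% p.-1)%N; set d' := (m %/ p.-1)%N; set r' := (m %% p.-1)%N.
have -> : (d * p.-1 + r + (d' * p.-1 + r') = (r + r') + p.-1 * (d + d'))%N by lia.
rewrite mono_shift /mono.
have -> : x * (- p%:R) ^+ d * (y * (- p%:R) ^+ d') = x * y * (- p%:R) ^+ (d + d').
  by rewrite exprD; ring.
have pxy : pint p (x * y * (- p%:R) ^+ (d + d')).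
  by rewrite exprD mulrACA; apply: pintM.
rewrite redM //; last exact: pintX.
rewrite redX // red_negp rmorphM rmorphXn iota_negp -exprM -mulrA -exprD.
by congr (_ * _ ^+ _); rewrite mulnC -divn_eq.
Qed.

Lemma mono_high n x : fil p (p.-1 * N)%N%:Z n x -> mono n x = 0.
Proof.
by move=> h; rewrite /mono red_vge ?rmorph0 ?mul0r //; exact: fil_residual.
Qed.

(** Either pi^2 is visible in the residual power of pi, or weight 2 forces a further factor p =
    -pi^(p-1), and p - 1 >= 2. *)
Lemma mono_pi2 n x : fil p 2 n x -> exists s, mono n x = pi ^+ 2 * s.
Proof.
move=> h; have p10 : (0 < p.-1)%N by lia.
case: (ltnP 1 (n %% p.-1)) => r2.
  exists (iota (red (x * (- p%:R) ^+ (n %/ p.-1))) * pi ^+ (n %% p.-1 - 2)).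
  by rewrite mulrCA -exprD subnKC.
have [e he le] := h.
have hv : vge p 1%:Z (x * (- p%:R) ^+ (n %/ p.-1)).
  apply: (@vge_le p p_pr (e + (n %/ p.-1)%:Z)); last by apply: vgeM => //; exact: vge_pexp.
  have nE := divn_eq n p.-1; move: le r2; rewrite {1}nE.
  move: (n %/ p.-1)%N (n %% p.-1)%N => d r le r2.
  have : 0 < p.-1%:Z * (e + d%:Z) by lia.
  by rewrite pmulr_rgt0 //; lia.
have hp : pint p (x * (- p%:R) ^+ (n %/ p.-1) * (- p%:R)^-1).
  have := hv; rewrite /vge -[p%:R ^ (- 1%:Z)]/(p%:R^-1) => h1.
  by rewrite invrN mulrN; apply: pintN.
exists (iota (red (x * (- p%:R) ^+ (n %/ p.-1) * (- p%:R)^-1)) *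
   pi ^+ (p.-1 - 2 + n %% p.-1)).
have -> : mono n x = iota (red (x * (- p%:R) ^+ (n %/ p.-1) * (- p%:R)^-1 * (- p%:R)))
    * pi ^+ (n %% p.-1) by rewrite divfK // oppr_eq0.
rewrite redM //; last by apply: pintN; exact: pint_nat.
rewrite red_negp rmorphM iota_negp -mulrA -exprD mulrCA -exprD.
by congr (_ * _ ^+ _); lia.
Qed.

(** The substitution X = pi y followed by reduction into R; it is multiplicative on polynomials of
    nonnegative weight ([ThetaM]). *)
Definition Theta (f : {poly rat}) : {poly R} := \poly_(n < size f) mono n f`_n.

Lemma coef_Theta f n : (Theta f)`_n = mono n f`_n.
Proof. by rewrite coef_poly; case: ltnP => // h; rewrite nth_default // mono0. Qed.

Lemma ThetaM f g : weighted p (fun=> 0) f -> weighted p (fun=> 0) g ->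
  Theta (f * g) = Theta f * Theta g.
Proof.
move=> hf hg; apply/polyP => n; rewrite coef_Theta !coefM.
rewrite mono_sum => [|[i] /=]; last first.
  by rewrite ltnS => im _; rewrite -{1}(subnKC im) -[0 : int]addr0; exact: filM.
apply: eq_bigr => -[i] /=; rewrite ltnS => im _.
by rewrite !coef_Theta -{1}(subnKC im) monoM.
Qed.

Lemma mono_1 : mono 0 1 = 1.
Proof. by rewrite /mono div0n mod0n !expr0 !mulr1 red1 // rmorph1. Qed.

Lemma Theta_1 : Theta 1 = 1.
Proof.
by apply/polyP => n; rewrite coef_Theta !coef1; case: n => [|n]; rewrite ?mono0 ?mono_1.
Qed.

Lemma ThetaX f n : weighted p (fun=> 0) f -> Theta (f ^+ n) = Theta f ^+ n.
Proof.
move=> hf; elim: n => [|n IHn]; first by rewrite !expr0 Theta_1.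
by rewrite !exprS ThetaM ?IHn //; exact: weighted0X.
Qed.

Variable L : nat.
Hypothesis L_big : (N + p.+2 < L %/ p ^ 2)%N.

Let L_gt0 : (0 < L)%N.
Proof. by case: L L_big => //; rewrite div0n. Qed.

(** The derivative kills the coefficients in degrees 1 to L - 1, and from degree L on the weight
    exceeds N by [L_big], even after a loss of p + 2. That loss is p for a p-th power and 1 for each
    of two more products. *)
Lemma Theta_eq1 d f r : (d <= p.+2)%N -> weighted p (slope p d) f -> f`_0 = 1 ->
  f^`() = 'X^(L.-1) * r -> Theta f = 1.
Proof.
move=> dp hf f0 fr; apply/polyP => n; rewrite coef_Theta coef1.
case: n => [|n]; first by rewrite f0 mono_1.
case: (ltnP n.+1 L) => nL.
  by rewrite (deriv_Xn_coef fr) ?mono0 //; lia.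
apply: mono_high; apply: fil_le (hf _); rewrite /slope PoszM ler_wpM2l //.
have : (L %/ p ^ 2 <= n.+1 %/ p ^ 2)%N by exact: leq_div2r.
by lia.
Qed.

Let f := dwp p L.
Let A := expp (- p%:R) L.
Let A' := expp p%:R L.
Let B := expp (-1) L \Po 'X^p.

Let A_w : weighted p (slope p 0) A.
Proof. by have := weighted_expp p_pr p_odd (-1) L; rewrite mulN1r rmorphN. Qed.
Let A'_w : weighted p (slope p 0) A'.
Proof. by have := weighted_expp p_pr p_odd 1 L; rewrite mul1r. Qed.
Let B_w : weighted p (slope p 0) B.
Proof. exact: weighted_expp_comp. Qed.
Let f_w : weighted p (slope p 0) f.
Proof. exact: weighted_dwp. Qed.

Lemma Theta_dwp_expp : Theta f ^+ p * Theta A * Theta B = 1.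
Proof.
have [r rE] := dwp_expp p_pr L_gt0.
have fX := weighted_slopeX p_pr p_odd p f_w.
have fA : weighted p (slope p p.+1) (f ^+ p * A).
  by apply: weightedM fX A_w _ => // i j; have := slopeD p_pr p_odd p 0 i j; rewrite addn0.
have fAB : weighted p (slope p p.+2) (f ^+ p * A * B).
  by apply: weightedM fA B_w _ => // i j; have := slopeD p_pr p_odd p.+1 0 i j; rewrite addn0.
have f0 := slope_weighted0 f_w; have A0 := slope_weighted0 A_w.
have B0 := slope_weighted0 B_w; have fX0 := weighted0X p_pr p_odd p f0.
rewrite -ThetaX // -!ThetaM //; last exact: weighted0M.
apply: (@Theta_eq1 p.+2) rE => //.
have f00 : f`_0 = 1 by exact: dwp_coef0.
have B00 : B`_0 = 1 by rewrite coef_comp_poly_Xn // dvdn0 div0n expp_coef0.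
rewrite !coef0M B00 expp_coef0 // !mulr1.
by rewrite -horner_coef0 horner_exp horner_coef0 f00 expr1n.
Qed.

Lemma Theta_expp_inverse : Theta A * Theta A' = 1.
Proof.
have [r rE] := expp_inverse p%:R L.
rewrite -ThetaM; [|exact: slope_weighted0|exact: slope_weighted0].
apply: (@Theta_eq1 1) rE => //.
  by apply: weightedM A_w A'_w _ => // i j; have := slopeD p_pr p_odd 0 0 i j; rewrite addn0.
by rewrite coef0M !expp_coef0 // mulr1.
Qed.

(** At X = pi y, exp(-X^p) is exp(p pi y^p), because -pi^p = p pi. *)
Lemma Theta_expp_comp : Theta B = Theta A' \Po 'X^p.
Proof.
apply/polyP => n; rewrite coef_comp_poly_Xn // !coef_Theta coef_comp_poly_Xn //.
case: ifP => [/dvdnP[m ->]|_]; last exact: mono0.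
rewrite mulnK // !coef_poly; case: ifP => _; last by rewrite !mono0.
have -> : (m * p = m + p.-1 * m)%N by rewrite -{1}(prednK p_gt0); lia.
by rewrite mono_shift mulrAC -exprMn mulrNN mul1r.
Qed.

(** When t^p = t, the last two factors of [Theta_dwp_expp] become exp(-p pi t) and exp(p pi t),
    inverse to each other. *)
Lemma Theta_dwp_root t : t ^+ p = t -> (Theta f).[t] ^+ p = 1.
Proof.
move=> tp; have := congr1 (fun g : {poly R} => g.[t]) Theta_dwp_expp.
have := congr1 (fun g : {poly R} => g.[t]) Theta_expp_inverse.
rewrite Theta_expp_comp !hornerM horner_exp horner_comp hornerXn tp hornerC => AA.
by rewrite -mulrA AA mulr1.
Qed.

(** The coefficients c(0) and c(1) are 1. The others have weight at least 2: for n < p from n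
    itself, and for n >= p because [dwc_order] is then positive and p - 1 >= 2. *)
Lemma Theta_dwp_pi2 t : exists s, (Theta f).[t] = 1 + pi * t + pi ^+ 2 * s.
Proof.
have f0 : mono 0 f`_0 = 1 by rewrite dwp_coef0 // mono_1.
have L2 : (2 <= L)%N.
  by apply: leq_trans (leq_div L (p ^ 2)); apply: leq_trans L_big; lia.
have f1 : mono 1 f`_1 = pi.
  rewrite coef_poly (leq_trans _ L2) // dwc_small // invr1 /mono.
  by rewrite divn_small ?modn_small ?expr0 ?mulr1 ?red1 ?rmorph1 ?mul1r ?expr1 //; lia.
have fn n : exists s, mono n.+2 f`_n.+2 = pi ^+ 2 * s.
  apply: mono_pi2; rewrite coef_poly; case: ifP => _; last exact: fil_0.
  case: (ltnP n.+2 p) => np.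
    exists 0; last by rewrite mulr0 add0r.
    rewrite dwc_small //; have := vge_natV p_pr (fact_gt0 n.+2).
    by rewrite (logn_fact_rec p_pr) divn_small // fact0 logn1.
  have [e he le] := vge_dwc p_pr p_odd n.+2; exists e => //; apply: le_trans le.
  rewrite /dwc_order ltnNge np /= lez_nat.
  by apply: (@leq_trans p.-1); [lia | rewrite leq_pmulr].
have {fn} [s0 s0E] : exists s, \sum_(i < (size (Theta f)).-2)
     mono i.+2 f`_i.+2 * t ^+ i.+2 = pi ^+ 2 * s.
  apply: (big_ind (fun x => exists s, x = pi ^+ 2 * s)).
  - by exists 0; rewrite mulr0.
  - by move=> _ _ [u ->] [v ->]; exists (u + v); rewrite mulrDr.
  - by move=> i _; have [s ->] := fn i; exists (s * t ^+ i.+2); rewrite mulrA.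
exists s0; rewrite (@horner_coef_wide _ (size (Theta f)).-2.+2); last by lia.
rewrite !big_ord_recl /= !coef_Theta f0 /bump /= f1 expr0 expr1 mulr1 addrA -s0E.
by congr (_ + _); apply: eq_bigr => i _; rewrite coef_Theta /bump /= !add1n.
Qed.

End SplittingFunction.

(** * Congruences between p-th powers, and Teichmuller representatives *)

Section CongruencePower.
Variables (A : comNzRingType) (p : nat).

Lemma cong_expr (x y u : A) n : x = y + u -> exists v, x ^+ n = y ^+ n + u * v.
Proof.
move=> ->; elim: n => [|n [v vE]]; first by exists 0; rewrite mulr0 addr0.
by exists (y ^+ n + y * v + u * v); rewrite !exprS vE; ring.
Qed.

(** Factor x^p - y^p: besides x - y there is a sum of p terms, each congruent to y^(p-1) modulo p,
    hence divisible by p. *)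
Lemma cong_exprp j (x y z : A) : x = y + p%:R ^+ j.+1 * z ->
  exists w, x ^+ p = y ^+ p + p%:R ^+ j.+2 * w.
Proof.
move=> xE; have : exists w, \sum_(i < p) x ^+ (p.-1 - i) * y ^+ i = p%:R * w.
  have term (i : 'I_p) : exists w, x ^+ (p.-1 - i) * y ^+ i = y ^+ p.-1 + p%:R * w.
    have [v vE] := cong_expr (p.-1 - i) xE.
    exists (p%:R ^+ j * z * v * y ^+ i).
    have ip : (i <= p.-1)%N by rewrite -ltnS (leq_trans (ltn_ord i)) // leqSpred.
    rewrite vE mulrDl -exprD subnK //.
    by rewrite exprS; ring.
  have [w wE] : exists w, \sum_(i < p) (x ^+ (p.-1 - i) * y ^+ i - y ^+ p.-1) = p%:R * w.
    apply: (big_ind (fun s => exists w, s = p%:R * w)).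
    - by exists 0; rewrite mulr0.
    - by move=> _ _ [u ->] [v ->]; exists (u + v); rewrite mulrDr.
    - by move=> i _; have [w ->] := term i; exists w; rewrite addrC addKr.
  exists (w + y ^+ p.-1); rewrite mulrDr -wE sumrB sumr_const card_ord.
  by rewrite [p%:R * _]mulr_natl subrK.
move=> [w wE]; exists (z * w).
have e : x - y = p%:R ^+ j.+1 * z by rewrite xE addrC addKr.
have := subrXX x y p; rewrite wE e => /eqP; rewrite subr_eq => /eqP ->.
by rewrite addrC [in RHS]exprSr; ring.
Qed.

Lemma cong_exprpk k (x y z : A) : x = y + p%:R * z ->
  exists w, x ^+ (p ^ k) = y ^+ (p ^ k) + p%:R ^+ k.+1 * w.
Proof.
move=> xE; elim: k => [|k [w /cong_exprp [v vE]]]; first by exists z; rewrite !expr1.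
by exists v; rewrite expnSr !exprM.
Qed.

End CongruencePower.

Section Teichmuller.
Variables (p N : nat).
Hypotheses (p_pr : prime p) (N_gt0 : (0 < N)%N).
Let p_gt0 : (0 < p)%N := prime_gt0 p_pr.
Let p_gt1 : (1 < p)%N := prime_gt1 p_pr.
Local Notation Z := 'Z_(p ^ N).

Lemma natF_eq a b : ((a%:R : 'F_p) == b%:R) = (a == b %[mod p])%N.
Proof. by rewrite -val_eqE /= !val_Fp_nat. Qed.

Lemma natF_eq0' a : ((a%:R : 'F_p) == 0) = (p %| a)%N.
Proof. by rewrite (natF_eq a 0) mod0n. Qed.

Lemma natr_F (x : 'F_p) : (val x)%:R = x.
Proof. by apply: natr_Zp. Qed.

Lemma Fermat (x : 'F_p) : x ^+ p = x.
Proof.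
by apply/eqP; rewrite -[x]natr_F -natrX natF_eq; apply/eqP; exact: fermat_little.
Qed.

(** By [cong_exprpk] a p^N-th power modulo p^N depends only on the residue modulo p, so this is the
    exact Teichmuller representative and not an approximation. *)
Definition teich (x : 'F_p) : Z := (val x)%:R ^+ (p ^ N).

Lemma natZ_cong_pow a b k : (a = b %[mod p])%N -> (N <= k.+1)%N ->
  (a%:R : Z) ^+ (p ^ k) = b%:R ^+ (p ^ k).
Proof.
wlog ab : a b / (a <= b)%N => [W|] e Nk.
  by case: (leqP a b) => [/W|/ltnW /W h]; [exact | symmetry; exact: h].
have /dvdnP[m mE] : (p %| b - a)%N by rewrite -eqn_mod_dvd //; apply/eqP.
have bE : b%:R = a%:R + p%:R * m%:R :> Z.
  by rewrite -natrM -natrD mulnC -mE subnKC.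
have [w ->] := cong_exprpk k bE.
have -> : p%:R ^+ k.+1 = 0 :> Z.
  by rewrite -(subnKC Nk) exprD pchar_pow // mul0r.
by rewrite mul0r addr0.
Qed.

Lemma teich_nat a : teich a%:R = a%:R ^+ (p ^ N).
Proof. by apply: natZ_cong_pow => //; rewrite /= val_Fp_nat // modn_mod. Qed.

Lemma teichM x y : teich (x * y) = teich x * teich y.
Proof.
by rewrite -(natr_F x) -(natr_F y) -natrM !teich_nat natrM exprMn.
Qed.

Lemma teich0 : teich 0 = 0.
Proof. by rewrite /teich expr0n expn_eq0 -leqn0 leqNgt p_gt0. Qed.

Lemma teich1 : teich 1 = 1.
Proof. by rewrite (teich_nat 1) expr1n. Qed.

Lemma teichX x n : teich (x ^+ n) = teich x ^+ n.
Proof. by elim: n => [|n IHn]; rewrite ?expr0 ?teich1 // !exprS teichM IHn. Qed.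

Lemma teich_exp x : teich x ^+ p = teich x.
Proof. by rewrite -teichX Fermat. Qed.

Lemma expf_Fermat (x : 'F_p) : x != 0 -> x ^+ p.-1 = 1.
Proof.
by move=> x0; apply: (mulfI x0); rewrite -exprS prednK // Fermat mulr1.
Qed.

Lemma teich_exp1 x : x != 0 -> teich x ^+ p.-1 = 1.
Proof. by move=> x0; rewrite -teichX expf_Fermat // teich1. Qed.

Lemma teich_pow x k : (N <= k.+1)%N -> (val x)%:R ^+ (p ^ k) = teich x.
Proof.
move=> Nk; rewrite /teich; have [le|/ltnW le] := leqP k N.
  have e : (p ^ N = p ^ (N - k) * p ^ k)%N by rewrite -expnD subnK.
  rewrite [X in _ = _ ^+ X]e exprM -[X in _ = X ^+ _]natrX; apply: natZ_cong_pow => //.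
  apply/eqP; rewrite -natF_eq natrX natr_F eq_sym.
  elim: (N - k)%N => [|j IHj]; first by rewrite expr1.
  by rewrite expnS exprM Fermat.
have -> : (p ^ k = p ^ (k - N) * p ^ N)%N by rewrite -expnD subnK.
rewrite exprM -[X in X ^+ _ = _]natrX; apply: natZ_cong_pow => //.
apply/eqP; rewrite -natF_eq natrX natr_F.
elim: (k - N)%N => [|j IHj]; first by rewrite expr1.
by rewrite expnS exprM Fermat.
Qed.

Lemma teich_nat_pow a k : (N <= k.+1)%N -> a%:R ^+ (p ^ k) = teich a%:R.
Proof.
move=> Nk; rewrite -(@teich_pow _ k Nk); apply: natZ_cong_pow => //.
by rewrite /= val_Fp_nat // modn_mod.
Qed.

Lemma teich_mod x : exists m, teich x = (val x + p * m)%:R.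
Proof.
rewrite /teich -natrX.
have le : (val x <= val x ^ (p ^ N))%N.
  have q0 : (0 < p ^ N)%N by rewrite expn_gt0 p_gt0.
  have gen a : (a <= a ^ (p ^ N))%N.
    by case: a => [|a]; [rewrite exp0n | rewrite -{1}[a.+1]expn1; apply: leq_pexp2l].
  exact: gen.
have : (p %| val x ^ (p ^ N) - val x)%N.
  rewrite -eqn_mod_dvd // -natF_eq natrX natr_F.
  by elim: N => [|j IHj]; rewrite ?expr1 // expnS exprM Fermat.
by case/dvdnP=> m mE; exists m; rewrite mulnC -mE subnKC.
Qed.

Lemma teichD x y : exists w, teich (x + y) = teich x + teich y + p%:R * w.
Proof.
have [a aE] := teich_mod x; have [b bE] := teich_mod y; have [c cE] := teich_mod (x + y).
have e : (val (x + y)%R == val x + val y %[mod p])%N by rewrite -natF_eq natrD !natr_F.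
have := divn_eq (val x + val y) p; rewrite -(eqP e) => eE.
have := divn_eq (val (x + y)) p => fE.
exists ((val (x + y)%R %/ p)%N%:R - ((val x + val y) %/ p)%N%:R + c%:R - a%:R - b%:R).
have := congr1 (fun n => n%:R : Z) eE; have := congr1 (fun n => n%:R : Z) fE.
rewrite aE bE cE !natrD !natrM.
move: (_ %% p)%N%:R => r h1 h2; rewrite h1 [X in _ = X + _]addrACA h2; ring.
Qed.

Lemma teich_unit x : x != 0 -> teich x \is a GRing.unit.
Proof.
move=> x0; have [m ->] := teich_mod x; rewrite natZ_unit //.
by rewrite dvdn_addl ?dvdn_mulr // -natF_eq0' natr_F.
Qed.

(** A representative is congruent to x modulo p. This replaces cancellation in a domain in all
    orthogonality arguments below. *)
Lemma teich_sub1_unit x : x != 1 -> teich x - 1 \is a GRing.unit.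
Proof.
move=> x1; have [m ->] := teich_mod x.
(* Here -1 is represented by p^N - 1, so that the unit criterion for natural numbers applies. *)
have -> : (val x + p * m)%:R - 1 = (val x + p * m + (p ^ N).-1)%N%:R :> Z.
  rewrite [RHS]natrD; congr (_ + _); apply/eqP; rewrite eq_sym -addr_eq0 natr1 prednK ?expn_gt0 ?p_gt0 //.
  by rewrite natrX pchar_pow.
rewrite natZ_unit // -natF_eq0' !natrD natr_F natrM.
have p0 : (p%:R : 'F_p) = 0 by apply/eqP; rewrite natF_eq0'.
have -> : ((p ^ N).-1)%:R = -1 :> 'F_p.
  by apply/eqP; rewrite -addr_eq0 natr1 prednK ?expn_gt0 ?p_gt0 // natrX p0 expr0n -leqn0 leqNgt N_gt0.
by rewrite p0 mul0r addr0 subr_eq0.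
Qed.

Lemma sum_teich_exp z : z != 0 ->
  \sum_(j < p.-1) teich z ^+ j = if z == 1 then p.-1%:R else 0.
Proof.
move=> z0; case: eqVneq => [->|z1].
  by rewrite teich1; under eq_bigr do rewrite expr1n; rewrite sumr_const card_ord.
apply: (mulrI (teich_sub1_unit z1)).
by rewrite mulr0 -subrX1 teich_exp1 // subrr.
Qed.

(** The remainder of m modulo p - 1 is positive, and a polynomial X^r - 1 with 0 < r < p - 1 cannot
    vanish on all p - 1 nonzero elements. *)
Lemma exists_nonroot m : ~~ (p.-1 %| m)%N -> exists2 g : 'F_p, g != 0 & g ^+ m != 1.
Proof.
move=> pm; have p10 : (0 < p.-1)%N by rewrite -ltnS prednK.
case: (boolP [exists g : 'F_p, (g != 0) && (g ^+ m != 1)]) => [/existsP[g /andP[]]|].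
  by exists g.
rewrite negb_exists => /forallP h.
have r0 : (0 < m %% p.-1)%N by rewrite lt0n.
pose rs := [seq x : 'F_p <- enum 'F_p | x != 0].
have le : (size rs <= m %% p.-1)%N.
  apply: max_unity_roots => //; last by rewrite filter_uniq // enum_uniq.
  apply/allP => g; rewrite mem_filter => /andP[g0 _].
  rewrite unity_rootE; have := h g; rewrite g0 /= negbK {1}(divn_eq m p.-1) exprD mulnC exprM.
  by rewrite expf_Fermat // expr1n mul1r.
have := ltn_pmod m p10; rewrite ltnNge; case/negP; apply: leq_trans le.
have <- : #|rs| = size rs by apply/card_uniqP; rewrite filter_uniq // enum_uniq.
have -> : #|rs| = #|predC1 (0 : 'F_p)|.
  by apply: eq_card => x; rewrite mem_filter mem_enum andbT !inE.
by rewrite cardC1 card_Fp.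
Qed.

Lemma sum_teich m :
  \sum_(x : 'F_p | x != 0) teich x ^+ m = if (p.-1 %| m)%N then p.-1%:R else 0.
Proof.
case: ifP => [/dvdnP[k ->]|/negbT /exists_nonroot[g g0 gm]].
  rewrite (eq_bigr (fun=> 1)) => [|x x0]; last by rewrite mulnC exprM teich_exp1 // expr1n.
  rewrite sumr_const; congr (_ *+ _); transitivity #|predC1 (0 : 'F_p)|.
    by apply: eq_card => x; rewrite !inE.
  by rewrite cardC1 card_Fp.
apply: (mulrI (teich_sub1_unit gm)); rewrite mulr0 mulrBl mul1r teichX.
apply/eqP; rewrite subr_eq0; apply/eqP; rewrite mulr_sumr.
rewrite [RHS](reindex_inj (mulfI g0)) /=; apply: eq_big => [x|x _].
  by rewrite mulf_eq0 negb_or g0.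
by rewrite teichM exprMn.
Qed.

Lemma teichV_exp x a : x != 0 -> (a <= p.-1)%N -> teich x^-1 ^+ a = teich x ^+ (p.-1 - a).
Proof.
move=> x0 ap; apply: (mulIr (unitrX a (teich_unit x0))).
by rewrite -exprMn -teichM mulVf // teich1 expr1n -exprD subnK // teich_exp1.
Qed.

End Teichmuller.

(** * Gamma_p modulo p^N: periodicity, reflection and multiplication formulas *)

Section GammaModq.
Variables (p N : nat).
Hypotheses (p_pr : prime p) (p_odd : odd p) (N_gt0 : (0 < N)%N).
Let p_gt0 : (0 < p)%N := prime_gt0 p_pr.
Let p_gt1 : (1 < p)%N := prime_gt1 p_pr.
Local Notation q := (p ^ N)%N.
Local Notation Z := 'Z_(p ^ N).
Local Notation PA := (pfree_fact p).

(** Gamma_p(n) modulo p^N. By [gm_eq] it depends only on n modulo p^N, so Gamma_p at a p-adic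
    integer is read off from any natural representative. *)
Definition gm (n : nat) : Z := (-1) ^+ n * \prod_(1 <= j < n | ~~ (p %| j)%N) j%:R.

Lemma pint_gammap n : pint p (gammap_nat p n).
Proof.
apply: pintM => //; first by apply: pintX => //; exact: pint_int p_pr (-1).
by apply: pint_prod => // i _; exact: pint_nat.
Qed.

Lemma red_gammap n : @red p N (gammap_nat p n) = gm n.
Proof.
have m1 : pint p (-1) by exact: pint_int p_pr (-1).
rewrite /gammap_nat redM //; [|exact: pintX|by apply: pint_prod => // i _; exact: pint_nat].
rewrite redX // redN ?red1 //; last exact: pint1.
rewrite red_prod // => [|i _]; last exact: pint_nat.
by congr (_ * _); apply: eq_bigr => i _; rewrite red_nat.
Qed.

Lemma gm0 : gm 0 = 1.
Proof. by rewrite /gm big_geq // mulr1. Qed.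

Lemma gmS n : gm n.+1 = - (gm n * if (p %| n)%N then 1 else n%:R).
Proof.
rewrite /gm; case: n => [|n]; first by rewrite !big_geq // dvdn0 expr1 expr0 !mulr1.
rewrite big_mkcond big_nat_recr //= -big_mkcond exprS mulN1r mulNr mulrA.
by case: (p %| n.+1)%N.
Qed.

Lemma gm_unit n : gm n \is a GRing.unit.
Proof.
elim: n => [|n IHn]; first by rewrite gm0 unitr1.
rewrite gmS unitrN unitrM IHn; case: ifP => /=; first by rewrite unitr1.
by move/negbT; rewrite natZ_unit.
Qed.

Lemma gmS_pfree_fact n : gm n.+1 = (-1) ^+ n.+1 * (PA n)%:R.
Proof. by rewrite /gm /pfree_fact natr_prod. Qed.

Lemma q_dvd : (p %| q)%N.
Proof. by apply: dvdn_exp. Qed.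

(** The product P of all units satisfies P^2 = 1 by pairing x with its inverse, and P = -1 modulo p
    by p^(N-1) blocks of Wilson type. As p is odd, P - 1 is a unit, hence P = -1. *)
Lemma wilson_q : (PA q)%:R = -1 :> Z.
Proof.
have q1 := q_gt1 p_pr N_gt0.
have prodE : (PA q)%:R = \prod_(x : Z | x \is a GRing.unit) x.
  have -> : PA q = (\prod_(0 <= j < q | ~~ (p %| j)) j)%N.
    rewrite /pfree_fact big_mkcond big_nat_recr //=; last by rewrite expn_gt0 p_gt0.
    rewrite q_dvd muln1 -big_mkcond [RHS]big_mkcond [RHS]big_ltn ?(ltnW q1) //.
    by rewrite dvdn0 /= mul1n big_mkcond.
  rewrite natr_prod; transitivity (\prod_(0 <= j < (Zp_trunc q).+2 | ~~ (p %| j)%N) (j%:R : Z)).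
    by apply: congr_big => //; rewrite Zp_cast.
  rewrite big_mkord; apply: eq_big => [i|i _].
    by rewrite -(natZ_unit p_pr N_gt0) natr_Zp.
  by rewrite natr_Zp.
have sq : ((PA q)%:R : Z) * (PA q)%:R = 1.
  have {1}-> : (PA q)%:R = \prod_(x : Z | x \is a GRing.unit) x^-1.
    by rewrite prodE (reindex_inj invr_inj); apply: eq_bigl => x; rewrite unitrV.
  by rewrite prodE -big_split /=; apply: big1 => x xu; rewrite mulVr.
have modp : ((PA q)%:R : 'F_p) = -1.
  have gen l : ((PA (p * l))%:R : 'F_p) = (-1) ^+ l.
    elim: l => [|l IHl]; first by rewrite muln0 pfree_fact0.
    have := congr1 (fun z : int => z%:~R : 'F_p) (pfree_fact_block p_pr p_odd 0 l).
    rewrite !add0n rmorphM /= -!pmulrn IHl => ->.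
    rewrite -horner_map /= pfree_block_modp //.
    by rewrite hornerN hornerC exprSr.
  rewrite -(prednK N_gt0) expnS gen -signr_odd oddX p_odd orbT //.
have u : ((PA q)%:R - 1 : Z) \is a GRing.unit.
  have -> : (PA q)%:R - 1 = (PA q + q.-1)%N%:R :> Z.
    rewrite natrD; congr (_ + _); apply/eqP; rewrite eq_sym -addr_eq0 natr1.
    by rewrite prednK ?(ltnW q1) // natrX pchar_pow.
  rewrite natZ_unit // -natF_eq0 // natrD modp.
  have -> : (q.-1)%:R = -1 :> 'F_p.
    by apply/eqP; rewrite -addr_eq0 natr1 prednK ?(ltnW q1) // natF_eq0 // q_dvd.
  rewrite -opprD oppr_eq0 -(natrD _ 1 1) natF_eq0 //.
  by rewrite gtnNdvd // ltn_neqAle p_gt1 andbT; apply: contraTneq p_odd => <-.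
apply/eqP; rewrite -addr_eq0; apply/eqP; apply: (mulrI u).
by rewrite mulr0 mulrDr mulr1 mulrBl mul1r sq; ring.
Qed.

Lemma gmDq n : gm (n + q) = gm n.
Proof.
elim: n => [|n IHn]; last first.
  rewrite addSn !gmS IHn dvdn_addl ?q_dvd // natrD natrX pchar_pow // addr0 //.
have := gmS_pfree_fact q; rewrite wilson_q gmS q_dvd mulr1 add0n gm0 => /eqP.
by rewrite eqr_oppLR => /eqP ->; rewrite -signr_odd /= oddX p_odd orbT /= mul1r opprK.
Qed.

Lemma gm_eq m n : m%:R = n%:R :> Z -> gm m = gm n.
Proof.
have gen k : gm k = gm (k %% q).
  rewrite {1}(divn_eq k q) addnC; elim: (k %/ q)%N => [|j IHj]; first by rewrite addn0.
  by rewrite mulSn [(q + _)%N]addnC addnA gmDq.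
by move/eqP; rewrite natZ_eq // => /eqP e; rewrite gen [RHS]gen e.
Qed.

Lemma natZ_opp_dvd n x : (n + x)%:R = 0 :> Z -> (p %| n)%N = (p %| x)%N.
Proof.
move/eqP; rewrite natZ_eq0 // => /(dvdn_trans q_dvd) h.
by apply/idP/idP => h'; [rewrite -(dvdn_addr _ h') | rewrite -(dvdn_addl _ h')].
Qed.

Lemma subn_divS x : (x.+1 - x.+1 %/ p = x - x %/ p + ~~ (p %| x.+1))%N.
Proof. by rewrite divnS //; have := leq_div x p; case: (p %| x.+1)%N => /=; lia. Qed.

(** Induction on x = -n along the functional equation; the exponent counts the integers up to x
    prime to p, each of which contributes a sign. *)
Lemma gm_reflection n x : (n + x)%:R = 0 :> Z ->
  gm n * gm x.+1 = - (-1) ^+ (x - x %/ p).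
Proof.
elim: x n => [|x IHx] n h.
  have -> : gm n = gm 0 by apply: gm_eq; move: h; rewrite addn0.
  by rewrite gmS gm0 dvdn0 sub0n !mulr1 mul1r.
have h' : (n.+1 + x)%:R = 0 :> Z by rewrite addSnnS.
have := IHx _ h'; rewrite gmS [gm x.+2]gmS subn_divS (natZ_opp_dvd h).
case: ifP => /= _; rewrite ?addn0 ?addn1.
  by rewrite !mulr1 mulNr mulrN.
have nE : n%:R = - x.+1%:R :> Z by apply/eqP; rewrite -addr_eq0 -natrD h.
rewrite nE exprS mulN1r opprK => e; rewrite -[RHS]opprK -e; ring.
Qed.

(** Gauss multiplication with b = 1/4. Passing from n + 1 to n replaces the argument n/4 + 1 by n/4
    on the left and n + 1 by n on the right; the functional equation compares n/4 with n, a factor 4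
    for each n prime to p. *)
Lemma gm_multiplication b n x : (4 * b)%:R = 1 :> Z -> (n + x)%:R = 0 :> Z ->
  \prod_(i < 4) gm ((n + i) * b) =
  4%:R ^+ (x - x %/ p) * gm n * \prod_(i < 4) gm (i * b).
Proof.
move=> b4; elim: x n => [|x IHx] n h.
  rewrite sub0n expr0 mul1r; have n0 : n%:R = 0 :> Z by rewrite -h addn0.
  have -> : gm n = gm 0 by apply: gm_eq; rewrite n0.
  rewrite gm0 mul1r; apply: eq_bigr => i _; apply: gm_eq.
  by rewrite natrM natrD n0 add0r -natrM.
have h' : (n.+1 + x)%:R = 0 :> Z by rewrite addSnnS.
have pn : (p %| n * b)%N = (p %| n)%N.
  rewrite Euclid_dvdM //; apply: orb_idr => pb; exfalso.
  have : ((4 * b)%:R : Z) \is a GRing.unit by rewrite b4 unitr1.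
  by rewrite natZ_unit // dvdn_mull.
have e4 : gm ((n + 4) * b) = - (gm (n * b) * (if (p %| n)%N then 1 else (n * b)%:R)).
  rewrite -pn -gmS; apply: gm_eq.
  by rewrite mulnDl natrD b4 -natr1.
have := IHx _ h'; rewrite !big_ord_recl !big_ord0 /= /bump /= !mulr1 !addn0 !add1n.
rewrite !addSnnS e4 gmS subn_divS (natZ_opp_dvd h).
set P0 := gm (0 * b); set P1 := gm (1 * b); set P2 := gm (2 * b); set P3 := gm (3 * b).
set G0 := gm (n * b); set G1 := gm (n.+1 * b).
set G2 := gm ((n + 2) * b); set G3 := gm ((n + 3) * b).
have b4' : b%:R * 4%:R = 1 :> Z by rewrite mulrC -natrM.
case: (boolP (p %| x.+1)%N) => /= pn0; rewrite ?addn0 ?addn1 -/G0 -/G1 => e.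
  have -> : G0 * (G1 * (G2 * G3)) = - (G1 * (G2 * (G3 * - (G0 * 1)))) by ring.
  by rewrite e; ring.
have un : (n%:R : Z) \is a GRing.unit by rewrite natZ_unit // (natZ_opp_dvd h).
apply: (mulIr un).
have -> : G0 * (G1 * (G2 * G3)) * n%:R =
    - (G1 * (G2 * (G3 * - (G0 * (n * b)%:R)))) * 4%:R.
  transitivity (G0 * (G1 * (G2 * G3)) * n%:R * (b%:R * 4%:R)); first by rewrite b4' mulr1.
  by rewrite natrM; ring.
by rewrite e exprS; ring.
Qed.

Lemma gm_opp_eq n x : (n + x)%:R = 0 :> Z -> (-1) ^+ (x - x %/ p) / (PA x)%:R * (-1) ^+ x = gm n.
Proof.
move=> h; have uP : ((PA x)%:R : Z) \is a GRing.unit by rewrite natZ_unit // pfree_fact_ndvd.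
apply: (mulIr uP); rewrite mulrAC divrK //.
have := gm_reflection h; rewrite gmS_pfree_fact exprS.
move: (gm n) (PA x)%:R (_ ^+ (x - _)) => g P e0 e1.
have s1 : (-1) ^+ x * (-1) ^+ x = 1 :> Z by rewrite -exprMn mulrNN mulr1 expr1n.
have : e0 * (-1) ^+ x = - (g * (-1 * (-1) ^+ x * P)) * (-1) ^+ x by rewrite e1 opprK.
move=> ->; transitivity (g * P * ((-1) ^+ x * (-1) ^+ x)); first by ring.
by rewrite s1 mulr1.
Qed.

(* [repunit k] = (p^k - 1) / (p - 1), so that [- repunit k] approximates 1 / (p - 1). *)
Definition repunit (k : nat) : nat := (\sum_(i < k) p ^ i)%N.

Lemma repunitE k : (p.-1 * repunit k = (p ^ k).-1)%N.
Proof. by rewrite predn_exp. Qed.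

Lemma repunitS k : repunit k.+1 = (1 + p * repunit k)%N.
Proof.
rewrite /repunit big_ord_recl expn0 big_distrr /=; congr (_ + _)%N.
by apply: eq_bigr => i _; rewrite -expnS.
Qed.

Lemma repunitSr k : repunit k.+1 = (repunit k + p ^ k)%N.
Proof. by rewrite /repunit big_ord_recr. Qed.

Lemma p1_unit : (p.-1%:R : Z) \is a GRing.unit.
Proof.
rewrite natZ_unit // gtnNdvd ?prednK //; by have := p_gt2 p_pr p_odd; lia.
Qed.

Lemma repunit_opp r n : (p.-1 * n)%:R = r%:R :> Z -> (n + r * repunit N)%:R = 0 :> Z.
Proof.
move=> h; apply: (mulrI p1_unit); rewrite mulr0 -natrM mulnDr mulnCA repunitE.
rewrite natrD h -natrD -{1}[r]muln1 -mulnDr add1n prednK ?expn_gt0 ?p_gt0 //.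
by rewrite natrM natrX pchar_pow // mulr0.
Qed.

(** At x = -r/(p-1) the count of integers prime to p becomes r p^(N-1). It has the parity of r, and
    as an exponent of 4 it produces the r-th power of the Teichmuller representative. *)
Lemma repunit_free r : (r < p)%N ->
  (r * repunit N - (r * repunit N) %/ p = r * p ^ N.-1)%N.
Proof.
move=> rp; have -> : ((r * repunit N) %/ p = r * repunit N.-1)%N.
  rewrite -{1}(prednK N_gt0) repunitS mulnDr muln1 mulnCA mulnC addnC divnMDl //.
  by rewrite divn_small // addn0 mulnC.
by rewrite -{1}(prednK N_gt0) repunitSr mulnDr addKn.
Qed.

Lemma gm_reflection_frac r n m : (r < p)%N -> (p.-1 * n)%:R = r%:R :> Z ->
  (n + m)%:R = 1 :> Z -> gm n * gm m = - (-1) ^+ r.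
Proof.
move=> rp h nm; have h' := repunit_opp h.
have -> : gm m = gm (r * repunit N).+1.
  apply: gm_eq; apply: (addrI n%:R).
  by rewrite -!natrD nm addnS -natr1 h' add0r.
rewrite gm_reflection // repunit_free // -signr_odd oddM oddX p_odd.
by rewrite orbT andbT signr_odd.
Qed.

Lemma gm_multiplication_frac b r n : (r < p)%N -> (4 * b)%:R = 1 :> Z ->
  (p.-1 * n)%:R = r%:R :> Z ->
  \prod_(i < 4) gm ((n + i) * b) =
  teich N (4%:R : 'F_p) ^+ r * gm n * \prod_(i < 4) gm (i * b).
Proof.
move=> rp b4 h; rewrite (gm_multiplication b4 (repunit_opp h)) repunit_free //.
congr (_ * _ * _); rewrite mulnC exprM; congr (_ ^+ _).
by apply: teich_nat_pow; rewrite ?prednK.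
Qed.

End GammaModq.

(** * The additive character and the Gross-Koblitz formula *)

Lemma sum_residue (V : nmodType) (F : nat -> V) K d a : (a < d)%N ->
  \sum_(n < d * K | (n %% d == a)%N) F n = \sum_(k < K) F (a + d * k)%N.
Proof.
move=> ad; elim: K => [|K IHK]; first by rewrite muln0 !big_ord0.
rewrite mulnSr big_mkcond big_split_ord /= -big_mkcond IHK big_ord_recr /=; congr (_ + _).
rewrite -big_mkcond (big_pred1 (Ordinal ad)) /=; first by rewrite addnC.
by move=> i; rewrite mulnC modnMDl modn_small.
Qed.

Lemma sum_ends (V : nmodType) (F : nat -> V) m :
  \sum_(i < m.+3) F i = F 0%N + F 1%N + \sum_(i < m) F i.+2 + F m.+2.
Proof. by rewrite big_ord_recr 2!big_ord_recl /= addrA. Qed.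

Section AdditiveCharacter.
Variables (p N : nat).
Hypotheses (p_pr : prime p) (p_odd : odd p) (N_gt0 : (0 < N)%N).
Let p_gt0 : (0 < p)%N := prime_gt0 p_pr.
Let p_gt1 : (1 < p)%N := prime_gt1 p_pr.
Let p_gt2' : (2 < p)%N := p_gt2 p_pr p_odd.
Local Notation Z := 'Z_(p ^ N).
Local Notation red := (@red p N).
Local Notation PA := (pfree_fact p).
Local Notation tau := (@teich p N).
Local Notation c := (dwc p).
Variables (R : comNzRingType) (iota : {rmorphism Z -> R}) (pi : R).
Hypothesis pi_exp : pi ^+ p.-1 = - p%:R.

Variable K : nat.
Hypothesis K_big : (p ^ 2 * (N + p.+3) <= K)%N.
Local Notation L := (p.-1 * K)%N.

Let L_big : (N + p.+2 < L %/ p ^ 2)%N.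
Proof.
have p2 : (0 < p ^ 2)%N by rewrite expn_gt0 p_gt0.
have p10 : (0 < p.-1)%N by lia.
have : ((p ^ 2 * (N + p.+3)) %/ p ^ 2 <= L %/ p ^ 2)%N.
  by apply: leq_div2r; apply: leq_trans K_big _; rewrite leq_pmull.
by rewrite mulKn //; apply: leq_trans; lia.
Qed.

(** Dwork's additive character, truncated so far out that the discarded terms vanish in R. The
    length L is a multiple of p - 1, so each residue class of exponents modulo p - 1 has exactly K
    members. *)
Definition psi (x : 'F_p) : R := (Theta iota pi (dwp p L)).[iota (tau x)].

Lemma psiE x : psi x = \sum_(n < L) mono iota pi n (c n) * iota (tau x) ^+ n.
Proof.
rewrite /psi (@horner_coef_wide _ L).
  by apply: eq_bigr => n _; rewrite coef_Theta // coef_poly ltn_ord.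
by rewrite (leq_trans (size_poly _ _)) // size_poly.
Qed.

Lemma red_gk_tail a k : (a < p.-1)%N -> (K <= k)%N ->
  red ((- p%:R) ^+ k * c (a + p.-1 * k)) = 0.
Proof.
move=> ap Kk; apply: red_vge => //; apply: (@vge_le p p_pr (dwc_order p (a + p.-1 * k))%:Z).
  rewrite lez_nat; apply: (@leq_trans (dwc_order p (p ^ 2 * (N + p.+3)))).
    by apply: leq_trans (leq_dwc_order p_pr p_odd _); rewrite leq_addr.
  apply: dwc_order_mono; rewrite (leq_trans K_big) // (leq_trans Kk) // (leq_trans _ (leq_addl _ _)) //.
  by rewrite leq_pmull //; lia.
exact: vge_dwc_term.
Qed.

Lemma pint_gk_term a k : (a < p.-1)%N -> pint p ((- p%:R) ^+ k * c (a + p.-1 * k)).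
Proof. by move=> ap; apply/vge0; apply: vge_le (vge_dwc_term p_pr p_odd k ap). Qed.

(** This is [gross_koblitz_series] for an s close to -a/(p-1). Then a + ps is close to -a/(p-1) =
    -n, and [gm_opp_eq] turns the left side into Gamma_p(n). *)
Lemma gross_koblitz_Z a n : (a < p.-1)%N -> (p.-1 * n)%:R = a%:R :> Z ->
  p.-1%:R * \sum_(k < K) red ((- p%:R) ^+ k * c (a + p.-1 * k)) = - gm p N n.
Proof.
(* This s gives (p - 1) s + a = (a + p - 1) p^r; the summand p^r of s also ensures s >= K when a =
   0. The 3 in r offsets the loss in [vge_gk_error]. *)
move=> ap h; pose r := (N + 3 + K)%N; pose s := (a * repunit p r + p ^ r)%N.
have sD : (p.-1 * s + a = (a + p.-1) * p ^ r)%N.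
  rewrite /s mulnDr mulnCA repunitE.
  have : (0 < p ^ r)%N by rewrite expn_gt0 p_gt0.
  by case: (p ^ r)%N => // Q _ /=; lia.
have rs : (r <= s)%N.
  by rewrite /s (leq_trans (ltnW (ltn_expl r p_gt1))) // leq_addl.
have Ks : (K <= s)%N by apply: leq_trans rs; rewrite /r leq_addl.
clearbody s; have dv : (p ^ r %| p.-1 * s + a)%N by rewrite sD dvdn_mull.
have uP : ((PA (a + p * s))%:R : Z) \is a GRing.unit by rewrite natZ_unit // pfree_fact_ndvd.
have ap' : (a < p)%N by lia.
have pT k := pint_gk_term k ap.
have Ks1 : (K <= s.+1)%N by exact: leqW.
have p1 : pint p (1 - p%:R) by apply: pintB => //; [exact: pint1 | exact: pint_nat].
have key : red ((-1) ^+ s / (PA (a + p * s))%:R) =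
   - (p.-1%:R * \sum_(k < K) red ((- p%:R) ^+ k * c (a + p.-1 * k))).
  have hv := vge_gk_difference p_pr p_odd ap dv.
  have m1 : pint p (-1) by exact: pint_int p_pr (-1).
  have pL : pint p ((-1) ^+ s / (PA (a + p * s))%:R).
    by apply: pintM => //; [exact: pintX | apply: pintV => //; exact: pfree_fact_ndvd].
  have pS : pint p (\sum_(k < s.+1) (- p%:R) ^+ k * c (a + p.-1 * k)).
    by apply: pint_sum => // i _; exact: pT.
  have pp : pint p p%:R by exact: pint_nat.
  have : vge p N%:Z ((-1) ^+ s / (PA (a + p * s))%:R -
    ((1 - p%:R) * \sum_(k < s.+1) (- p%:R) ^+ k * c (a + p.-1 * k)
     + p%:R * ((- p%:R) ^+ s * c (a + p.-1 * s)))).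
    by apply: vge_le hv => //; rewrite /r; lia.
  move/(red_vge p_pr N_gt0).
  rewrite redB //; last by apply: pintD => //; apply: pintM.
  move/eqP; rewrite subr_eq0 => /eqP ->.
  rewrite redD //; [|exact: pintM|exact: pintM].
  (* As K <= s, the boundary term vanishes modulo p^N, and so do, below, all terms of index at least
     K. *)
  rewrite (redM p_pr N_gt0 p1 pS) (redM p_pr N_gt0 pp (pT s)) (red_gk_tail ap Ks) mulr0 addr0 -mulNr; congr (_ * _).
    rewrite redB //; last exact: pint1.
    have e : p%:R = p.-1%:R + 1 :> Z by rewrite natr1 prednK.
    by rewrite red1 // red_nat // e; ring.
  rewrite red_sum // (big_ord_widen s.+1 (fun k => red ((- p%:R) ^+ k * c (a + p.-1 * k))) Ks1).
  rewrite [LHS](bigID (fun k : 'I_s.+1 => (k < K)%N)) /= [X in _ + X]big1 ?addr0 // => k.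
  by rewrite -leqNgt => Kk; exact: red_gk_tail.
have nx : (n + (a + p * s))%:R = 0 :> Z.
  apply: (mulrI (p1_unit p_pr p_odd N_gt0)); rewrite mulr0 -natrM mulnDr natrD h -natrD.
  have -> : (a + p.-1 * (a + p * s) = p * ((a + p.-1) * p ^ r))%N.
    by rewrite -sD -{2 4}(prednK p_gt0) /=; lia.
  rewrite !natrM natrX.
  have -> : p%:R ^+ r = 0 :> Z by rewrite /r -addnA exprD pchar_pow // mul0r.
  by rewrite !mulr0.
apply: oppr_inj; rewrite -key opprK -(gm_opp_eq p_pr p_odd N_gt0 nx).
have m1 : pint p (-1) by exact: pint_int p_pr (-1).
rewrite redM //; [|exact: pintX|apply: pintV => //; exact: pfree_fact_ndvd].
rewrite redX // redN ?red1 //; last exact: pint1.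
rewrite redV ?pfree_fact_ndvd // mulrAC; congr (_ / _).
have -> : ((a + p * s) %/ p = s)%N by rewrite addnC mulnC divnMDl // divn_small // addn0.
rewrite -exprD -signr_odd -[RHS]signr_odd; congr (_ ^+ _); apply: congr1.
rewrite oddD oddB ?oddD ?oddM ?p_odd /=; first by case: (odd a); case: (odd s).
by rewrite (leq_trans _ (leq_addl _ _)) // leq_pmull.
Qed.

(** Orthogonality of Teichmuller powers keeps only the exponents a + (p-1) k, for which c(n) pi^n =
    pi^a (-p)^k c(n); the sum over k is [gross_koblitz_Z]. *)
Lemma gross_koblitz a n : (a < p.-1)%N -> (p.-1 * n)%:R = a%:R :> Z ->
  \sum_(x : 'F_p | x != 0) iota (tau x^-1) ^+ a * psi x = - (pi ^+ a * iota (gm p N n)).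
Proof.
move=> ap h; have le : (a <= p.-1)%N by exact: ltnW.
have p10 : (0 < p.-1)%N by lia.
transitivity (\sum_(n < L) mono iota pi n (c n) *
    iota (\sum_(x : 'F_p | x != 0) tau x ^+ (p.-1 - a + n))).
  under eq_bigr => x x0.
    rewrite psiE mulr_sumr; under eq_bigr => i _ do
      rewrite mulrCA -rmorphXn teichV_exp // -rmorphXn -rmorphM -exprD.
    over.
  rewrite exchange_big /=; apply: eq_bigr => i _.
  by rewrite rmorph_sum mulr_sumr.
transitivity (\sum_(n < p.-1 * K | (n %% p.-1 == a)%N) mono iota pi n (c n) * iota p.-1%:R).
  rewrite [RHS]big_mkcond; apply: eq_bigr => i _.
  rewrite sum_teich //.
  have -> : (p.-1 %| p.-1 - a + i)%N = (i %% p.-1 == a)%N.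
    rewrite -{2}(modn_small ap) -[RHS](eqn_modDl (p.-1 - a)) subnK // modnn.
    by rewrite /dvdn.
  by case: ifP; rewrite ?rmorph0 ?mulr0.
rewrite -mulr_suml (sum_residue (fun n => mono iota pi n (c n)) K ap) -mulrN -rmorphN.
rewrite -(gross_koblitz_Z ap h) mulrC rmorphM rmorph_sum mulrCA; congr (_ * _).
rewrite mulr_sumr; apply: eq_bigr => k _.
rewrite mono_shift // /mono divn_small // modn_small // expr0 mulr1 mulrC.
by rewrite [c _ * _]mulrC.
Qed.

(** Put e = w - 1 = pi^2 s. In the expansion of (1 + e)^p every term after p e is p e times a
    multiple of pi, so p e (1 + pi r) = 0, and 1 + pi r is invertible since pi is nilpotent. The
    factor p remains because it is a zero divisor. *)
Lemma root_of_unity_cong (w s : R) : w ^+ p = 1 -> w = 1 + pi ^+ 2 * s -> p%:R * w = p%:R.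
Proof.
move=> wp wE; have pip : p%:R = - pi ^+ p.-1 by rewrite pi_exp opprK.
have pi_nil : exists n, pi ^+ n = 0.
  exists (p.-1 * N)%N; rewrite exprM pi_exp exprNn -[p%:R](rmorph_nat iota) -rmorphXn.
  by rewrite pchar_pow // rmorph0 mulr0.
suff [r rE] : exists r, w ^+ p = 1 + p%:R * (pi ^+ 2 * s) * (1 + pi * r).
  have [n n0] := pi_nil.
  have h0 : p%:R * (pi ^+ 2 * s) * (1 + pi * r) = 0.
    by apply: (addrI 1); rewrite -rE wp addr0.
  suff [v vE] : exists v, (1 + pi * r) * v = 1.
    rewrite wE mulrDr mulr1; have -> : p%:R * (pi ^+ 2 * s) = 0 :> R.
      transitivity (p%:R * (pi ^+ 2 * s) * ((1 + pi * r) * v)); first by rewrite vE mulr1.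
      by rewrite mulrA h0 mul0r.
    by rewrite addr0.
  have := subrX1 (- (pi * r)) n; rewrite exprNn exprMn n0 mul0r mulr0 sub0r => e.
  exists (\sum_(i < n) (- (pi * r)) ^+ i).
  by apply: oppr_inj; rewrite e -mulNr; congr (_ * _); rewrite opprD addrC.
set e := pi ^+ 2 * s in wE *.
(* The last term is not covered by divisibility of binomials; pi^(2p) = pi^(p-1) pi^(p-1) pi^2
   yields the factor p e, and p >= 3 leaves a spare pi. *)
have ep : e ^+ p = p%:R * e * (pi * (- (pi ^+ p.-2 * s ^+ p.-1))).
  have -> : p%:R * e * (pi * - (pi ^+ p.-2 * s ^+ p.-1)) =
     - p%:R * (pi ^+ p.-2 * pi) * e * s ^+ p.-1 by ring.
  rewrite -pi_exp -exprSr prednK; last by lia.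
  rewrite /e exprMn -[in s ^+ p](prednK p_gt0) [s ^+ p.-1.+1]exprS.
  have -> : pi ^+ 2 ^+ p = pi ^+ p.-1 * pi ^+ p.-1 * pi ^+ 2.
    by rewrite -exprM -!exprD; congr (_ ^+ _); lia.
  by ring.
have mid : exists r, \sum_(i < p.-2) e ^+ i.+2 *+ 'C(p, i.+2) = p%:R * e * (pi * r).
  apply: (big_ind (fun x => exists r, x = p%:R * e * (pi * r))).
  - by exists 0; rewrite !mulr0.
  - by move=> _ _ [u ->] [v ->]; exists (u + v); rewrite !mulrDr.
  move=> i _; have /dvdnP[d ->] : (p %| 'C(p, i.+2))%N.
    apply: prime_dvd_bin => //; have := ltn_ord i; lia.
  exists (pi * s * e ^+ i * d%:R).
  rewrite -mulr_natr natrM.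
  have -> : e ^+ i.+2 = e * (pi * (pi * s * e ^+ i)) by rewrite !exprS /e; ring.
  by ring.
have [r rE] := mid.
exists (r - pi ^+ p.-2 * s ^+ p.-1).
have split (F : nat -> R) :
    \sum_(i < p.+1) F i = F 0%N + F 1%N + \sum_(i < p.-2) F i.+2 + F p.
  by have := sum_ends F p.-2; have -> : p.-2.+2 = p by lia.
rewrite wE exprDn (split (fun i => 1 ^+ (p - i) * e ^+ i *+ 'C(p, i))).
under eq_bigr do rewrite expr1n mul1r.
rewrite rE !expr1n bin0 bin1 binn expr0 expr1 !mul1r !mulr1n ep -[e *+ p]mulr_natl.
by ring.
Qed.

Lemma psi_expp x : psi x ^+ p = 1.
Proof. by apply: Theta_dwp_root => //; rewrite -rmorphXn teich_exp. Qed.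

Lemma psi_pi2 x : exists s, psi x = 1 + pi * iota (tau x) + pi ^+ 2 * s.
Proof. exact: Theta_dwp_pi2. Qed.

(** The product psi(x) psi(y) psi(x+y)^(p-1) has p-th power 1, and its terms linear in pi cancel
    modulo pi^2, so [root_of_unity_cong] applies. *)
Lemma psiD x y : p%:R * psi (x + y) = p%:R * (psi x * psi y).
Proof.
have [a aE] := psi_pi2 x; have [b bE] := psi_pi2 y; have [d dE] := psi_pi2 (x + y).
have [w wE] : exists w, tau (x + y) = tau x + tau y + p%:R * w by exact: teichD.
have pE : p%:R = pi ^+ 2 * - pi ^+ (p - 3) :> R.
  rewrite mulrN -exprD; have -> : (2 + (p - 3) = p.-1)%N by lia.
  by rewrite pi_exp opprK.
have pow n : exists r, psi (x + y) ^+ n = 1 + n%:R * (pi * iota (tau (x + y))) + pi ^+ 2 * r.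
  elim: n => [|n [r rE]]; first by exists 0; rewrite expr0 mul0r mulr0 !addr0.
  exists (d + r + n%:R * iota (tau (x + y)) ^+ 2 + pi * iota (tau (x + y)) * r
     + n%:R * pi * iota (tau (x + y)) * d + pi ^+ 2 * d * r).
  by rewrite exprS rE dE -natr1; ring.
have [r rE] := pow p.-1.
have [s sE] : exists s, psi x * psi y * psi (x + y) ^+ p.-1 = 1 + pi ^+ 2 * s.
  rewrite rE aE bE wE.
  have -> : p.-1%:R = pi ^+ 2 * - pi ^+ (p - 3) - 1 :> R.
    by rewrite -pE -subn1 natrB.
  rewrite !rmorphD rmorphM rmorph_nat pE.
  move: (iota (tau x)) (iota (tau y)) (iota w) (pi ^+ (p - 3)) => t u v g.
  (* With these, psi(x) psi(y) = 1 + pi (t + u) + pi^2 m and psi(x+y)^(p-1) = 1 - pi (t + u) + pi^2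
     h. *)
  pose m := t * u + a + b + pi * (t * b + a * u) + pi ^+ 2 * (a * b).
  pose h := - g * pi * (t + u + pi ^+ 2 * - g * v) + pi * g * v + r.
  exists (m + h - (t + u) ^+ 2 + pi * ((t + u) * h - (t + u) * m) + pi ^+ 2 * (m * h)).
  by rewrite /m /h; ring.
have wp : (psi x * psi y * psi (x + y) ^+ p.-1) ^+ p = 1.
  by rewrite !exprMn exprAC !psi_expp expr1n !mulr1.
have := root_of_unity_cong wp sE => /(congr1 (fun z => z * psi (x + y))).
by rewrite -!mulrA -exprSr prednK // psi_expp mulr1 => ->.
Qed.

Lemma psi0 : psi 0 = 1.
Proof.
rewrite /psi teich0 // rmorph0 horner_coef0 coef_Theta // dwp_coef0 ?mono_1 //.
have K0 : (0 < K)%N by apply: leq_trans K_big; rewrite muln_gt0 expn_gt0 p_gt0 addnS.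
by rewrite muln_gt0 K0 andbT; lia.
Qed.

(** The case a = 0 of Gross-Koblitz: the nonzero arguments contribute -Gamma_p(0) = -1. *)
Lemma sum_psi : \sum_(x : 'F_p) psi x = 0.
Proof.
rewrite (bigD1 0) //= psi0.
have p10 : (0 < p.-1)%N by lia.
rewrite (eq_bigr (fun x => iota (tau x^-1) ^+ 0 * psi x)) => [|x _]; last by rewrite expr0 mul1r.
rewrite (@gross_koblitz 0 0) ?muln0 // gm0 rmorph1 expr0 mulr1 subrr //.
Qed.

End AdditiveCharacter.

(** * The quadratic character and fourth powers for p = 3 mod 4 *)

Section QuadraticCharacter.
Variable p : nat.
Hypotheses (p_pr : prime p) (p_mod4 : (p %% 4 = 3)%N).
Local Notation F := 'F_p.
Let p_gt0 : (0 < p)%N := prime_gt0 p_pr.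
Local Notation h := (p.-1./2).

Let p1E : (p.-1 = h + h)%N.
Proof. by have := divn_eq p 4; rewrite p_mod4; lia. Qed.

Let h_odd : odd h.
Proof. by have := divn_eq p 4; rewrite p_mod4; lia. Qed.

Lemma FN1_neq1 : (-1 : F) != 1.
Proof.
rewrite -subr_eq0 -opprD oppr_eq0 -(natrD _ 1 1) natF_eq0' //.
rewrite gtnNdvd //; have := divn_eq p 4; rewrite p_mod4; lia.
Qed.

Definition qchar (w : F) : int := if w == 0 then 0 else if w ^+ h == 1 then 1 else -1.

Lemma qchar0 : qchar 0 = 0. Proof. by rewrite /qchar eqxx. Qed.

Lemma expf_half (w : F) : w != 0 -> w ^+ h = 1 \/ w ^+ h = -1.
Proof.
move=> w0; have : (w ^+ h - 1) * (w ^+ h + 1) = 0.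
  by rewrite -subr_sqr_1 -exprM muln2 -addnn -p1E expf_Fermat // subrr.
move/eqP; rewrite mulf_eq0 subr_eq0 addr_eq0 => /orP[] /eqP; by [left|right].
Qed.

Lemma qcharM a b : qchar (a * b) = qchar a * qchar b.
Proof.
rewrite /qchar mulf_eq0; case: eqVneq => [|a0] /=; first by rewrite mul0r.
case: eqVneq => [|b0] /=; first by rewrite mulr0.
rewrite exprMn; case: (expf_half a0) => ->; case: (expf_half b0) => ->.
all: by rewrite ?mulr1 ?mul1r ?mulrNN ?mulr1 ?eqxx ?(negPf FN1_neq1).
Qed.

Lemma qchar_sqr a : a != 0 -> qchar a * qchar a = 1.
Proof. by move=> a0; rewrite /qchar (negPf a0); case: ifP. Qed.

Lemma qcharN1 : qchar (-1) = -1.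
Proof.
by rewrite /qchar oppr_eq0 oner_eq0 -signr_odd h_odd expr1 (negPf FN1_neq1).
Qed.

Lemma qchar1 : qchar 1 = 1.
Proof. by rewrite /qchar oner_eq0 expr1n eqxx. Qed.

Lemma qcharV a : qchar a^-1 = qchar a.
Proof.
case: (eqVneq a 0) => [->|a0]; first by rewrite invr0.
have h1 : qchar a * qchar a^-1 = 1 by rewrite -qcharM mulfV // qchar1.
by rewrite -[LHS]mul1r -(qchar_sqr a0) -mulrA h1 mulr1.
Qed.

Lemma sum_qchar : \sum_(w : F | w != 0) qchar w = 0.
Proof.
have : \sum_(w : F | w != 0) qchar w = - \sum_(w : F | w != 0) qchar w.
  rewrite {1}(reindex_inj oppr_inj) -sumrN /=; apply: eq_big => [w|w _].
    by rewrite oppr_eq0.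
  by rewrite -mulN1r qcharM qcharN1 mulN1r.
by lia.
Qed.

(** The other possibility, x^2 = -y^2, would make -1 a square. *)
Lemma exp4_eq (x y : F) : y != 0 -> (x ^+ 4 == y ^+ 4) = (x == y) || (x == - y).
Proof.
move=> y0; apply/idP/idP => [|/orP[] /eqP ->]; rewrite ?eqxx //; last by rewrite exprNn -signr_odd mul1r.
move/eqP=> e; rewrite -eqf_sqr.
have : (x ^+ 2 - y ^+ 2) * (x ^+ 2 + y ^+ 2) = 0.
  by rewrite -subr_sqr -!exprM e subrr.
move/eqP; rewrite mulf_eq0 subr_eq0 => /orP[//|]; rewrite addr_eq0 => /eqP e2.
have := qcharN1; have -> : -1 = (x / y) * (x / y) :> F.
  by rewrite mulrACA -expr2 e2 -invfM -expr2 mulNr mulfV // expf_neq0.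
rewrite qcharM; case: (eqVneq (x / y) 0) => [->|/qchar_sqr -> //].
by rewrite qchar0 mul0r.
Qed.

(** As -1 is not a square, every nonzero square has exactly two fourth roots, which are opposite,
    and a non-square has none. *)
Lemma sum_fourth (V : pzRingType) (G : F -> V) :
  \sum_(x : F | x != 0) G (x ^+ 4) = \sum_(w : F | w != 0) (1 + (qchar w)%:~R) * G w.
Proof.
rewrite (partition_big (fun x => x ^+ 4) (fun w => w != 0)) /=; last first.
  by move=> x x0; rewrite expf_neq0.
apply: eq_bigr => w w0.
rewrite (eq_bigr (fun=> G w)) => [|x /andP[_ /eqP ->] //].
rewrite sumr_const -mulr_natl; congr (_ * _).
rewrite /qchar (negPf w0); case: (expf_half w0) => wh; rewrite wh ?eqxx ?(negPf FN1_neq1).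
  (* If w^h = 1, raising to the power (h+1)/2 gives a square root of w; doing it twice gives a
     fourth root. *)
  pose z := w ^+ (h.+1./2 ^ 2).
  have zw : z ^+ 4 = w.
    have w2 : (w ^+ h.+1./2) ^+ 2 = w.
      by rewrite -exprM; have -> : (h.+1./2 * 2 = h.+1)%N by [lia]; rewrite exprS wh mulr1.
    rewrite /z expnS expn1 exprM -exprM.
    have -> : (h.+1./2 * 4 = 2 * h.+1./2 * 2)%N by lia.
    by rewrite !exprM w2 w2.
  have z0 : z != 0 by apply: contraNneq w0 => z0; rewrite -zw z0 expr0n.
  have zN : z != - z.
    apply: contraNneq FN1_neq1 => e; apply/eqP/(mulIf z0).
    by rewrite mulN1r mul1r -e.
  rewrite (_ : #|_| = 2%N) //; transitivity #|[set z; - z]|; last by rewrite cards2 zN.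
  apply: eq_card => x.
  rewrite !inE unfold_in /= -zw exp4_eq //.
  by apply: andb_idl => /orP[] /eqP ->; rewrite ?oppr_eq0.
rewrite (_ : #|_| = 0%N) ?addrN //; apply: eq_card0 => x.
rewrite unfold_in /=; apply/negbTE/negP => /andP[x0 /eqP xw].
have := congr1 (fun y => y ^+ h) xw; rewrite wh -exprM.
have -> : (4 * h = p.-1 * 2)%N by rewrite p1E; lia.
by rewrite exprM expf_Fermat // expr1n => /eqP; rewrite eq_sym (negPf FN1_neq1).
Qed.

End QuadraticCharacter.

(** * Reduction of the point count to sums over a torus *)

Lemma sum_ffun4 (F : finType) (V : nmodType) (G : F -> F -> F -> F -> V) :
  \sum_(x : {ffun 'I_4 -> F}) G (x 0) (x 1) (x 2%:R) (x 3%:R) =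
  \sum_a \sum_b \sum_c \sum_d G a b c d.
Proof.
pose to (t : F * F * F * F) : {ffun 'I_4 -> F} :=
  [ffun i : 'I_4 => nth t.1.1.1 [:: t.1.1.1; t.1.1.2; t.1.2; t.2] i].
pose from (x : {ffun 'I_4 -> F}) := (x 0, x 1, x 2%:R, x 3%:R).
rewrite (reindex to) /=; last first.
  exists from => [[[[a b] c] d]|x] _; first by rewrite /from !ffunE.
  apply/ffunP => i; rewrite ffunE /from /=; case: i => [[|[|[|[|]]]]] // im /=;
    by congr (x _); apply: val_inj.
under eq_bigr do rewrite !ffunE /=.
rewrite -(pair_bigA _ (fun abc d => G abc.1.1 abc.1.2 abc.2 d)) /=.
rewrite -(pair_bigA _ (fun ab c => \sum_d G ab.1 ab.2 c d)) /=.
by rewrite -(pair_bigA _ (fun a b => \sum_c \sum_d G a b c d)).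
Qed.

Section PointCount.
Variable p : nat.
Hypotheses (p_pr : prime p) (p_mod4 : (p %% 4 = 3)%N).
Local Notation F := 'F_p.
Let p_gt0 : (0 < p)%N := prime_gt0 p_pr.
Local Notation qchar := (@qchar p).
Local Notation "\sumx_ x f" := (\sum_(x : F | x != 0) f)
  (at level 41, x name, right associativity).

Lemma sumF (f : F -> int) : \sum_x f x = f 0 + \sumx_ x f x.
Proof. by rewrite (bigD1 0). Qed.

Lemma qchar_exp4 a : a != 0 -> qchar (a ^+ 4) = 1.
Proof. by move=> a0; rewrite (exprM a 2 2) !expr2 !qcharM // !qchar_sqr. Qed.

Lemma add_exp4_neq0 (a b : F) : a != 0 -> (a ^+ 4 + b ^+ 4 == 0) = false.
Proof.
move=> a0; apply/negP; rewrite addr_eq0 => /eqP e.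
have := qchar_exp4 a0; rewrite e -mulN1r qcharM // qcharN1 //.
case: (eqVneq b 0) => [->|/qchar_exp4 -> //].
by rewrite expr0n qchar0 mulr0.
Qed.

Definition tri (a b c : F) : int := (a ^+ 4 + b ^+ 4 + c ^+ 4 == 0)%:R.

Lemma tri0 a b : a != 0 -> tri a b 0 = 0.
Proof. by move=> a0; rewrite /tri expr0n addr0 add_exp4_neq0. Qed.

Lemma tri_0 a b : a != 0 -> tri a 0 b = 0.
Proof. by move=> a0; rewrite /tri expr0n addr0 add_exp4_neq0. Qed.

Definition tri_count : int := \sumx_ a \sumx_ b \sumx_ c tri a b c.

Lemma sum_tri_neq0 a : a != 0 ->
  \sum_b \sum_c tri a b c = \sumx_ b \sumx_ c tri a b c.
Proof.
move=> a0; rewrite sumF big1 => [|c _]; last exact: tri_0.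
by rewrite add0r; apply: eq_bigr => b b0; rewrite sumF tri0 // add0r.
Qed.

Lemma sum_tri : \sum_a \sum_b \sum_c tri a b c = 1 + tri_count.
Proof.
rewrite sumF; congr (_ + _); last by apply: eq_bigr => a; exact: sum_tri_neq0.
rewrite sumF [X in _ + X]big1 ?addr0; last first.
  by move=> b b0; apply: big1 => c _; rewrite /tri expr0n add0r add_exp4_neq0.
rewrite sumF [X in _ + X]big1 ?addr0 => [|c c0]; first by rewrite /tri expr0n /= ?addr0 ?eqxx.
by rewrite /tri expr0n /= ?add0r expf_eq0 (negPf c0).
Qed.

Variable lam : F.

Definition quad (a b c d : F) : int :=
  (a ^+ 4 + b ^+ 4 + c ^+ 4 + d ^+ 4 == 4%:R * lam * (a * b * c * d))%:R.

Definition torus_count : int := \sumx_ a \sumx_ b \sumx_ c \sumx_ d quad a b c d.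

(** Two vanishing coordinates force all of them to vanish, since -1 is not a fourth power. Besides
    the origin, each coordinate hyperplane thus contributes only the solutions of a Fermat quartic
    with nonzero coordinates. *)
Lemma sum_quad : \sum_a \sum_b \sum_c \sum_d quad a b c d = 1 + 4%:R * tri_count + torus_count.
Proof.
have z : (0 : F) ^+ 4 = 0 by rewrite expr0n.
have q1 b c d : quad 0 b c d = tri b c d by rewrite /quad z add0r !mul0r mulr0.
have q2 a c d : quad a 0 c d = tri a c d by rewrite /quad z addr0 mulr0 !mul0r mulr0.
have q3 a b d : quad a b 0 d = tri a b d by rewrite /quad z addr0 mulr0 !mul0r mulr0.
have q4 a b c : quad a b c 0 = tri a b c by rewrite /quad z addr0 !mulr0.
rewrite sumF; under eq_bigr do under eq_bigr do under eq_bigr do rewrite q1.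
rewrite sum_tri.
have -> : \sumx_ a \sum_b \sum_c \sum_d quad a b c d =
   tri_count + (tri_count + (tri_count + torus_count)).
  rewrite /tri_count /torus_count -!big_split; apply: eq_bigr => a a0 /=.
  rewrite sumF; under eq_bigr do under eq_bigr do rewrite q2.
  rewrite sum_tri_neq0 //; congr (_ + _).
  rewrite -!big_split; apply: eq_bigr => b b0 /=.
  rewrite sumF; under eq_bigr do rewrite q3.
  rewrite sumF tri0 // add0r; congr (_ + _).
  rewrite -!big_split; apply: eq_bigr => c c0 /=.
  by rewrite sumF q4.
by rewrite !mulrDl !mul1r; ring.
Qed.

Lemma card_dwork :
  #|[set x : {ffun 'I_4 -> F} | [exists i, x i != 0%R] && dwork_eq lam x]|%:Z =
  4%:R * tri_count + torus_count.
Proof.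
have dE (x : {ffun 'I_4 -> F}) : (dwork_eq lam x)%:R = quad (x 0) (x 1) (x 2%:R) (x 3%:R).
  have e1 : lift ord0 ord0 = 1 :> 'I_4 by exact: val_inj.
  have e2 : lift ord0 (lift ord0 ord0) = 2%:R :> 'I_4 by exact: val_inj.
  have e3 : lift ord0 (lift ord0 (lift ord0 ord0)) = 3%:R :> 'I_4 by exact: val_inj.
  rewrite /dwork_eq /quad !big_ord_recl !big_ord0 e1 e2 e3 addr0 mulr1 !addrA !mulrA.
  by [].
have total : \sum_(x : {ffun 'I_4 -> F}) (dwork_eq lam x)%:R = 1 + 4%:R * tri_count + torus_count.
  by rewrite -sum_quad -sum_ffun4; apply: eq_bigr => x _; exact: dE.
rewrite -natz -sum1_card natr_sum big_mkcond /=.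
apply: (addrI 1); rewrite addrA -total.
pose x0 : {ffun 'I_4 -> F} := [ffun=> 0].
rewrite (bigD1 x0) //= [RHS](bigD1 x0) //=.
rewrite inE; have -> : [exists i, x0 i != 0] = false.
  by apply/negbTE; rewrite negb_exists; apply/forallP => i; rewrite ffunE eqxx.
rewrite dE !ffunE /quad expr0n !addr0 !mulr0 eqxx add0r; congr (_ + _).
apply: eq_bigr => x xn0; rewrite inE.
have -> : [exists i, x i != 0] = true.
  apply: contraNT xn0; rewrite negb_exists => /forallP h; apply/eqP/ffunP => i.
  by rewrite ffunE; apply/eqP; rewrite -[_ == _]negbK; exact: h.
by rewrite /=; case: (dwork_eq lam x).
Qed.

Lemma sum_fourth_int (G : F -> int) : \sumx_ x G (x ^+ 4) = \sumx_ w (1 + qchar w) * G w.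
Proof. by rewrite sum_fourth //; apply: eq_bigr => w _; rewrite intz. Qed.

Lemma cardF_neq0 : #|[pred x : F | x != 0]| = p.-1.
Proof.
transitivity #|predC1 (0 : F)|; last by rewrite cardC1 card_Fp.
by apply: eq_card => x; rewrite !inE.
Qed.

(** Scaling reduces to a = 1, and [sum_fourth] leaves the sum of (1 + chi(b)) (1 + chi(c)) over 1 +
    b + c = 0, computed from multiplicativity and chi(-1) = -1. The value p + 1 is that of a conic,
    because fourth powers and squares agree. *)
Lemma tri_countE : tri_count = p.-1%:R * p.+1%:R.
Proof.
have scale a : a != 0 -> \sumx_ b \sumx_ c tri a b c = \sumx_ b \sumx_ c tri 1 b c.
  move=> a0; rewrite (reindex_inj (mulfI a0)) /=; apply: eq_big => [b|b _].
    by rewrite mulf_eq0 (negPf a0).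
  rewrite (reindex_inj (mulfI a0)) /=; apply: eq_big => [c|c _].
    by rewrite mulf_eq0 (negPf a0).
  rewrite /tri !exprMn expr1n -{1}[a ^+ 4]mulr1 -!mulrDr mulf_eq0 expf_eq0 (negPf a0).
  by [].
rewrite /tri_count (eq_bigr _ scale) sumr_const cardF_neq0 -[LHS]mulr_natl; congr (_ * _).
transitivity (\sumx_ b (1 + qchar b) * (\sumx_ c (1 + qchar c) * (1 + b + c == 0)%:R)).
  rewrite -(sum_fourth_int (fun u => \sumx_ c (1 + qchar c) * (1 + u + c == 0)%:R)).
  apply: eq_bigr => b b0; rewrite -(sum_fourth_int (fun v => (1 + b ^+ 4 + v == 0)%:R)).
  by apply: eq_bigr => c _; rewrite /tri expr1n.
have inner b : \sumx_ c (1 + qchar c) * (1 + b + c == 0)%:R =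
    (b != -1)%:R * (1 + qchar (- (1 + b))).
  case: (eqVneq b (-1)) => [->|b1].
    by rewrite mul0r big1 // => c c0; rewrite subrr add0r (negPf c0) mulr0.
  have c1 : - (1 + b) != 0 by rewrite oppr_eq0 addrC addr_eq0.
  rewrite (bigD1 (- (1 + b))) //= subrr eqxx mulr1 mul1r big1 ?addr0 // => c /andP[_ cb].
  by rewrite [1 + b + c]addrC addr_eq0 (negPf cb) mulr0.
under eq_bigr do rewrite inner.
have N10 : (-1 : F) != 0 by rewrite oppr_eq0 oner_eq0.
have -> : \sumx_ b (1 + qchar b) * ((b != -1)%:R * (1 + qchar (- (1 + b)))) =
   \sumx_ b ((b != -1)%:R + (b != -1)%:R * qchar b + (b != -1)%:R * qchar (- (1 + b)) +
     - qchar (1 + b^-1)).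
  apply: eq_bigr => b b0; case: eqVneq => [->|b1].
    by rewrite !mul0r mulr0 !add0r invrN invr1 subrr qchar0 oppr0.
  have -> : qchar (- (1 + b)) = - qchar b * qchar (1 + b^-1).
    have -> : - (1 + b) = -1 * b * (1 + b^-1) by rewrite mulrDr mulr1 mulfK // !mulN1r; ring.
    by rewrite !qcharM // qcharN1 // mulN1r.
  have := qchar_sqr b0; move: (qchar b) (qchar (1 + b^-1)) => u v uu.
  rewrite !mul1r; transitivity (1 + u - u * v - (u * u) * v); first by ring.
  by rewrite uu /=; ring.
rewrite !big_split /= sumrN.
have F1 : \sumx_ b 1 = p.-1%:R :> int by rewrite sumr_const cardF_neq0.
have drop (G : F -> int) : \sumx_ b (b != -1)%:R * G b = \sumx_ b G b - G (-1).
  rewrite [in RHS](bigD1 (-1) N10) /= [RHS]addrC addKr [LHS](bigD1 (-1) N10) /= eqxx mul0r add0r.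
  by apply: eq_bigr => b /andP[_ ->]; rewrite mul1r.
have s1 : \sumx_ b (b != -1)%:R = p.-1%:R - 1 :> int.
  by rewrite -F1 -(drop (fun=> 1)); apply: eq_bigr => b _; rewrite mulr1.
have s3 : \sumx_ b (b != -1)%:R * qchar (- (1 + b)) = 1.
  rewrite (drop (fun b => qchar (- (1 + b)))) subrr oppr0 qchar0 subr0.
  have : \sum_b qchar (- (1 + b)) = \sum_w qchar w.
    by rewrite [RHS](reindex_inj (inj_comp oppr_inj (addrI 1))).
  rewrite !sumF sum_qchar // qchar0 !addr0 qcharN1 // => /eqP.
  by rewrite addrC subr_eq0 => /eqP.
have s4 : \sumx_ b qchar (1 + b^-1) = -1.
  rewrite (reindex_inj (@invr_inj F)) /=.
  under eq_bigl do rewrite invr_eq0.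
  under eq_bigr do rewrite invrK.
  have : \sum_b qchar (1 + b) = \sum_w qchar w by rewrite [RHS](reindex_inj (addrI 1)).
  rewrite !sumF sum_qchar // qchar0 !addr0 qchar1 // => /eqP.
  by rewrite addrC addr_eq0 => /eqP.
rewrite s1 (drop qchar) sum_qchar // qcharN1 // s3 s4.
have -> : p = p.-1.+1 by rewrite prednK.
by rewrite -!natr1 /=; ring.
Qed.

(** With m = abcd, the coordinates are u = a^4/m, v = b^4/m, w = c^4/m, and then d^4/m =
    (uvw)^-1. *)
Definition torus (u v w : F) : int := (u + v + w + (u * v * w)^-1 == 4%:R * lam)%:R.

Definition torus_sum : int := \sumx_ u \sumx_ v \sumx_ w torus u v w.
Definition torus_twist : int :=
  \sumx_ u \sumx_ v \sumx_ w qchar u * qchar v * torus u v w.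

Lemma torus_swap12 u v w : torus u v w = torus v u w.
Proof. by rewrite /torus [u + v]addrC [u * v]mulrC. Qed.
Lemma torus_swap23 u v w : torus u v w = torus u w v.
Proof. by rewrite /torus [u + v + w]addrAC [u * v * w]mulrAC. Qed.

Lemma quad_torus a b c m : a != 0 -> b != 0 -> c != 0 -> m != 0 ->
  quad a b c (m / (a * b * c)) = torus (a ^+ 4 / m) (b ^+ 4 / m) (c ^+ 4 / m).
Proof.
move=> a0 b0 c0 m0; rewrite /quad /torus; congr ((_ : bool)%:R).
have abc : a * b * c != 0 by rewrite !mulf_neq0.
rewrite [a * b * c * _]mulrC divfK // -subr_eq0 -[in RHS]subr_eq0.
have -> : a ^+ 4 / m + b ^+ 4 / m + c ^+ 4 / m +
   (a ^+ 4 / m * (b ^+ 4 / m) * (c ^+ 4 / m))^-1 - 4%:R * lam =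
   (a ^+ 4 + b ^+ 4 + c ^+ 4 + (m / (a * b * c)) ^+ 4 - 4%:R * lam * m) / m.
  by field; rewrite a0 b0 c0 m0.
by rewrite mulf_eq0 invr_eq0 (negPf m0) orbF.
Qed.

(** For fixed m, [sum_fourth] gives the weight (1 + chi(mu)) (1 + chi(mv)) (1 + chi(mw)). Summing
    over m retains the terms even in chi(m): 1 and three pair products, equal by symmetry of the
    equation. *)
Lemma torus_countE : torus_count = p.-1%:R * (torus_sum + 3%:R * torus_twist).
Proof.
have -> : torus_count = \sumx_ m \sumx_ a \sumx_ b \sumx_ c
    torus (a ^+ 4 / m) (b ^+ 4 / m) (c ^+ 4 / m).
  rewrite [RHS]exchange_big /torus_count; apply: eq_bigr => a a0.
  rewrite [RHS]exchange_big; apply: eq_bigr => b b0.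
  rewrite [RHS]exchange_big; apply: eq_bigr => c c0.
  have abc : (a * b * c)^-1 != 0 by rewrite invr_eq0 !mulf_neq0.
  rewrite [LHS](reindex_inj (mulIf abc)) /=; apply: eq_big => [m|m].
    by rewrite mulf_eq0 (negPf abc) orbF.
  rewrite mulf_eq0 (negPf abc) orbF => m0; exact: (quad_torus a0 b0 c0 m0).
have -> : \sumx_ m \sumx_ a \sumx_ b \sumx_ c torus (a ^+ 4 / m) (b ^+ 4 / m) (c ^+ 4 / m) =
   \sumx_ m \sumx_ u \sumx_ v \sumx_ w (1 + qchar m * qchar u) *
     ((1 + qchar m * qchar v) * ((1 + qchar m * qchar w) * torus u v w)).
  apply: eq_bigr => m m0.
  have four (G : F -> int) : \sumx_ x G (x ^+ 4 / m) = \sumx_ u (1 + qchar m * qchar u) * G u.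
    rewrite (sum_fourth_int (fun w => G (w / m))) (reindex_inj (mulfI m0)) /=.
    apply: eq_big => [u|u _]; first by rewrite mulf_eq0 (negPf m0).
    by rewrite qcharM // mulrC [m * u]mulrC mulfK // mulrC.
  rewrite (four (fun u => \sumx_ b \sumx_ c torus u (b ^+ 4 / m) (c ^+ 4 / m))).
  apply: eq_bigr => u _; rewrite (four (fun v => \sumx_ c torus u v (c ^+ 4 / m))) mulr_sumr.
  apply: eq_bigr => v _; rewrite (four (torus u v)) !mulr_sumr.
  by apply: eq_bigr => w _.
have twist13 : \sumx_ u \sumx_ v \sumx_ w qchar u * qchar w * torus u v w = torus_twist.
  apply: eq_bigr => u _; rewrite exchange_big; apply: eq_bigr => v _.
  by apply: eq_bigr => w _; rewrite torus_swap23.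
have twist23 : \sumx_ u \sumx_ v \sumx_ w qchar v * qchar w * torus u v w = torus_twist.
  rewrite -twist13 exchange_big; apply: eq_bigr => v _; apply: eq_bigr => u _.
  by apply: eq_bigr => w _; rewrite torus_swap12.
transitivity (\sumx_ u \sumx_ v \sumx_ w p.-1%:R * (torus u v w + qchar u * qchar v * torus u v w +
    (qchar u * qchar w * torus u v w + qchar v * qchar w * torus u v w))).
  rewrite exchange_big; apply: eq_bigr => u _.
  rewrite exchange_big; apply: eq_bigr => v _.
  rewrite exchange_big; apply: eq_bigr => w _.
  move: (torus u v w) (qchar u) (qchar v) (qchar w) => t x y z.
  transitivity (\sumx_ m ((t + x * y * t + (x * z * t + y * z * t)) +
      qchar m * ((x + y + z + x * y * z) * t))).
    apply: eq_bigr => m m0; have := qchar_sqr m0; move: (qchar m) => e ee.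
    transitivity (t + e * e * (x * y * t + (x * z * t + y * z * t)) +
      e * ((x + y + z + e * e * (x * y * z)) * t)); first by ring.
    by rewrite ee; ring.
  by rewrite big_split /= sumr_const cardF_neq0 -mulr_suml sum_qchar // mul0r addr0 -[LHS]mulr_natl.
have -> : p.-1%:R * (torus_sum + 3%:R * torus_twist) = p.-1%:R *
   \sumx_ u \sumx_ v \sumx_ w (torus u v w + qchar u * qchar v * torus u v w +
    (qchar u * qchar w * torus u v w + qchar v * qchar w * torus u v w)).
  have -> : 3%:R * torus_twist = torus_twist + (torus_twist + torus_twist) by ring.
  rewrite -{2}twist13 -{2}twist23 addrA /torus_sum /torus_twist -!big_split; congr (_ * _).
  apply: eq_bigr => u _ /=; rewrite -!big_split; apply: eq_bigr => v _ /=.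
  by rewrite -!big_split.
rewrite mulr_sumr; apply: eq_bigr => u _; rewrite mulr_sumr; apply: eq_bigr => v _.
by rewrite mulr_sumr.
Qed.

Lemma npointsE : (npoints lam)%:Z =
  torus_sum + 3%:R * torus_twist + 4%:R * p.+1%:R.
Proof.
have p1 : (1 < p)%N := prime_gt1 p_pr.
have cE := card_dwork; rewrite torus_countE tri_countE mulrCA -mulrDr addrC in cE.
rewrite /npoints; set n := #|_| in cE *.
(* The product of this integer with p - 1 is a cardinality, so it is nonnegative and the natural
   division in [npoints] is exact. *)
have [k kE] : exists k : nat, torus_sum + 3%:R * torus_twist + 4%:R * p.+1%:R = k%:Z.
  exists (absz (torus_sum + 3%:R * torus_twist + 4%:R * p.+1%:R)); rewrite gez0_abs //.
  have : 0 <= p.-1%:R * (torus_sum + 3%:R * torus_twist + 4%:R * p.+1%:R) by rewrite -cE.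
  by rewrite pmulr_rge0 // ltr0n -ltnS prednK // p1.
rewrite kE; move: cE; rewrite kE natz -PoszM => -[->].
by rewrite mulKn // -ltnS prednK.
Qed.

End PointCount.

(** * Expansion of the torus sums in Gauss sums *)

Section CharacterSums.
Variables (p N : nat).
Hypotheses (p_pr : prime p) (N_gt0 : (0 < N)%N).
Local Notation F := 'F_p.
Local Notation Z := 'Z_(p ^ N).
Let p_gt0 : (0 < p)%N := prime_gt0 p_pr.
Variables (R : comNzRingType) (iota : {rmorphism Z -> R}) (psi : F -> R).
Hypothesis psiD : forall x y, p%:R * psi (x + y) = p%:R * (psi x * psi y).
Hypothesis psi0 : psi 0 = 1.
Hypothesis sum_psi : \sum_x psi x = 0.
Local Notation t x := (iota (teich N x)).
Local Notation "\sumx_ x f" := (\sum_(x : F | x != 0) f)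
  (at level 41, x name, right associativity).

Definition gauss (a : nat) : R := \sumx_ x t x^-1 ^+ a * psi x.

Lemma tM x y : t (x * y) = t x * t y.
Proof. by rewrite teichM // rmorphM. Qed.

Lemma t1 : t 1 = 1.
Proof. by rewrite teich1 // rmorph1. Qed.

Lemma tX x n : t (x ^+ n) = t x ^+ n.
Proof. by rewrite teichX // rmorphXn. Qed.

Lemma t_exp1 x n : x != 0 -> (p.-1 %| n)%N -> t x ^+ n = 1.
Proof.
move=> x0 /dvdnP[k ->]; rewrite mulnC exprM -[t x ^+ p.-1]rmorphXn teich_exp1 //.
by rewrite rmorph1 expr1n.
Qed.

Lemma tV x : x != 0 -> t x^-1 * t x = 1.
Proof. by move=> x0; rewrite -tM mulVf // t1. Qed.

Lemma delta_psi s : (s == 0)%:R * p%:R = \sum_y psi (y * s).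
Proof.
case: eqVneq => [->|s0].
  by under eq_bigr do rewrite mulr0 psi0; rewrite sumr_const card_Fp // mul1r.
rewrite mul0r; transitivity (\sum_y psi y); first by rewrite sum_psi.
exact: (reindex_inj (mulIf s0)).
Qed.

Lemma gauss_twist y a : y != 0 -> \sumx_ x t x^-1 ^+ a * psi (y * x) = t y ^+ a * gauss a.
Proof.
move=> y0; rewrite /gauss mulr_sumr [RHS](reindex_inj (mulfI y0)) /=.
apply: eq_big => [x|x x0]; first by rewrite mulf_eq0 (negPf y0).
by rewrite mulrA -exprMn -tM invfM mulrA mulfV // mul1r.
Qed.

Lemma delta_t z : z != 0 -> \sum_(j < p.-1) t z^-1 ^+ j = (z == 1)%:R * p.-1%:R.
Proof.
move=> z0; have zi : z^-1 != 0 by rewrite invr_eq0.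
have := congr1 iota (sum_teich_exp p_pr N_gt0 zi); rewrite rmorph_sum.
under eq_bigr do rewrite rmorphXn.
move=> ->; rewrite invr_eq1; case: (z == 1); first by rewrite rmorph_nat mul1r.
by rewrite rmorph0 mul0r.
Qed.

Variables (hh : nat) (lam : F).
Hypotheses (hh2 : (p.-1 %| 2 * hh)%N) (lam0 : lam != 0).
Hypothesis c0 : (4%:R : F) != 0.

Let c : F := - (4%:R * lam).
Let c_neq0 : c != 0. Proof. by rewrite oppr_eq0 mulf_neq0. Qed.

(** Represents -4j modulo p - 1, the exponent left on the Fourier variable y. *)
Definition dual_exp (j : nat) : nat := (4 * (p.-1 - j)) %% p.-1.

(** Both torus sums at once: hh = 0 gives the plain one, hh = (p-1)/2 the one twisted by quadratic
    characters. *)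
Definition twisted_torus : R :=
  \sumx_ u \sumx_ v \sumx_ w t u^-1 ^+ hh * t v^-1 ^+ hh * (torus lam u v w)%:~R.

Definition trivial_part : R := \sumx_ u \sumx_ v \sumx_ w t u^-1 ^+ hh * t v^-1 ^+ hh.

Let X y : R := \sumx_ u \sumx_ v \sumx_ w
  t u^-1 ^+ hh * t v^-1 ^+ hh * (psi (y * u) * psi (y * v) * psi (y * w) * psi (y * (u * v * w)^-1)).

Lemma psi_sum5 a1 a2 a3 a4 a5 : p%:R * psi (a1 + a2 + a3 + a4 + a5) =
  p%:R * (psi a1 * psi a2 * psi a3 * psi a4 * psi a5).
Proof.
rewrite psiD mulrA psiD mulrA psiD mulrA psiD; ring.
Qed.

(** One factor p comes from detecting the equation by the additive character, the other from
    additivity of [psi], available only after multiplication by p. The trivial part is the frequency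
    y = 0. *)
Lemma fourier_expansion :
  p%:R ^+ 2 * twisted_torus = p%:R * trivial_part + p%:R * \sumx_ y psi (y * c) * X y.
Proof.
have -> : \sumx_ y psi (y * c) * X y = \sumx_ u \sumx_ v \sumx_ w
   t u^-1 ^+ hh * t v^-1 ^+ hh * \sumx_ y
   (psi (y * u) * psi (y * v) * psi (y * w) * psi (y * (u * v * w)^-1) * psi (y * c)).
  rewrite /X; under eq_bigr do rewrite mulr_sumr.
  rewrite exchange_big; apply: eq_bigr => u _; under eq_bigr do rewrite mulr_sumr.
  rewrite exchange_big; apply: eq_bigr => v _; under eq_bigr do rewrite mulr_sumr.
  rewrite exchange_big; apply: eq_bigr => w _; rewrite mulr_sumr.
  by apply: eq_bigr => y _; ring.
have inner (k : R) u v w : p%:R * (p%:R * (k * (torus lam u v w)%:~R)) = p%:R * k + p%:R * (k * \sumx_ y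
   (psi (y * u) * psi (y * v) * psi (y * w) * psi (y * (u * v * w)^-1) * psi (y * c))).
  have -> : (torus lam u v w)%:~R = (u + v + w + (u * v * w)^-1 + c == 0)%:R :> R.
    by rewrite /torus /c subr_eq0; case: (_ == _).
  rewrite [p%:R * (k * _)]mulrCA [p%:R * _%:R]mulrC delta_psi (bigD1 0) //= mul0r psi0.
  rewrite !mulrDr mulr1; congr (_ + _); rewrite mulrCA [RHS]mulrCA; congr (_ * _).
  rewrite !mulr_sumr; apply: eq_bigr => y _.
  by rewrite !mulrDr psi_sum5.
rewrite expr2 -mulrA /twisted_torus /trivial_part !mulr_sumr -big_split; apply: eq_bigr => u _.
rewrite /= !mulr_sumr -big_split; apply: eq_bigr => v _.
rewrite /= !mulr_sumr -big_split; apply: eq_bigr => w _.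
exact: inner.
Qed.

Lemma sum_delta (G : F -> R) a : a != 0 -> (forall z, z != a -> G z = 0) ->
  \sumx_ z G z = G a.
Proof.
by move=> a0 h; rewrite (bigD1 a) //= big1 ?addr0 // => z /andP[_ za]; exact: h.
Qed.

(** A fourth variable z with uvwz = 1 is introduced and the constraint detected by multiplicative
    characters. The four variables then separate into Gauss sums, with total twist 4j in y because 2
    hh is a multiple of p - 1. *)
Lemma X_gauss y : y != 0 -> p.-1%:R * X y =
  \sum_(j < p.-1) t y ^+ (4 * j) * (gauss (j + hh) ^+ 2 * gauss j ^+ 2).
Proof.
move=> y0.
transitivity (\sumx_ u \sumx_ v \sumx_ w \sumx_ z \sum_(j < p.-1)
   (t u^-1 ^+ (j + hh) * psi (y * u)) * ((t v^-1 ^+ (j + hh) * psi (y * v)) *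
   ((t w^-1 ^+ j * psi (y * w)) * (t z^-1 ^+ j * psi (y * z))))).
  rewrite mulr_sumr; apply: eq_bigr => u u0; rewrite mulr_sumr; apply: eq_bigr => v v0.
  rewrite mulr_sumr; apply: eq_bigr => w w0.
  have uvw : u * v * w != 0 by rewrite !mulf_neq0.
  have uvwi : (u * v * w)^-1 != 0 by rewrite invr_eq0.
  transitivity (\sumx_ z (t u^-1 ^+ hh * t v^-1 ^+ hh * (psi (y * u) * psi (y * v) * psi (y * w) *
      psi (y * z))) * ((u * v * w * z == 1)%:R * p.-1%:R)).
    rewrite (sum_delta uvwi) => [|z zn]; first by rewrite (mulfV uvw) eqxx mul1r mulrC.
    rewrite -(mulfV uvw) (inj_eq (mulfI uvw)) (negPf zn).
    by rewrite mul0r mulr0.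
  apply: eq_bigr => z z0; rewrite -delta_t; last by rewrite mulf_neq0.
  rewrite mulr_sumr; apply: eq_bigr => j _.
  by rewrite !invfM !tM !exprMn !exprD; ring.
transitivity (\sum_(j < p.-1) (\sumx_ u t u^-1 ^+ (j + hh) * psi (y * u)) *
  ((\sumx_ v t v^-1 ^+ (j + hh) * psi (y * v)) *
  ((\sumx_ w t w^-1 ^+ j * psi (y * w)) * \sumx_ z t z^-1 ^+ j * psi (y * z)))).
  under eq_bigr do under eq_bigr do under eq_bigr do rewrite exchange_big /=.
  under eq_bigr do under eq_bigr do rewrite exchange_big /=.
  under eq_bigr do rewrite exchange_big /=.
  rewrite exchange_big /=; apply: eq_bigr => j _.
  rewrite mulr_suml; apply: eq_bigr => u _; rewrite mulr_suml mulr_sumr; apply: eq_bigr => v _.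
  rewrite mulr_suml !mulr_sumr; apply: eq_bigr => w _.
  by rewrite !mulr_sumr.
apply: eq_bigr => j _; rewrite !gauss_twist //.
have -> : t y ^+ (4 * j) = t y ^+ (2 * hh) * (t y ^+ j) ^+ 4.
  by rewrite (t_exp1 y0 hh2) mul1r -exprM [(j * 4)%N]mulnC.
by rewrite [(2 * hh)%N]mulnC exprM exprD; ring.
Qed.

(** The remaining sum over y is a fifth Gauss sum, of exponent -4j, evaluated at c = -4 lam. *)
Lemma twisted_torus_gauss :
  p%:R ^+ 2 * (p.-1%:R * twisted_torus) = p%:R * (p.-1%:R * trivial_part) +
  p%:R * \sum_(j < p.-1) gauss (j + hh) ^+ 2 * gauss j ^+ 2 * (gauss (dual_exp j) * t c ^+ dual_exp j).
Proof.
rewrite mulrCA fourier_expansion mulrDr mulrCA [p.-1%:R * (p%:R * _)]mulrCA; congr (_ + _ * _).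
rewrite mulr_sumr.
transitivity (\sumx_ y \sum_(j < p.-1) gauss (j + hh) ^+ 2 * gauss j ^+ 2 *
    (t y^-1 ^+ dual_exp j * psi (c * y))).
  apply: eq_bigr => y y0; rewrite mulrCA X_gauss // mulr_sumr; apply: eq_bigr => j _.
  have -> : t y^-1 ^+ dual_exp j = t y ^+ (4 * j).
    have d : (p.-1 %| 4 * j + dual_exp j)%N.
      rewrite /dvdn /dual_exp modnDmr -mulnDr subnKC ?modnMl //.
      exact: ltnW.
    transitivity (t y ^+ (4 * j) * (t y ^+ dual_exp j * t y^-1 ^+ dual_exp j)).
      by rewrite mulrA -exprD (t_exp1 y0 d) mul1r.
    by rewrite -exprMn mulrC [t y * _]mulrC tV // expr1n mul1r.
  by rewrite [y * c]mulrC; ring.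
rewrite exchange_big; apply: eq_bigr => j _.
by rewrite -mulr_sumr gauss_twist // [t c ^+ _ * _]mulrC.
Qed.

End CharacterSums.

(** * Gross-Koblitz applied to the torus sums *)

Section TorusModq.
Variables (p N : nat).
Hypotheses (p_pr : prime p) (p_mod4 : (p %% 4 = 3)%N) (N_gt0 : (0 < N)%N).
Local Notation F := 'F_p.
Local Notation Z := 'Z_(p ^ N).
Local Notation tau := (@teich p N).
Local Notation "\sumx_ x f" := (\sum_(x : F | x != 0) f)
  (at level 41, x name, right associativity).
Let p_gt0 : (0 < p)%N := prime_gt0 p_pr.
Let p_odd : odd p.
Proof. by have := divn_eq p 4; rewrite p_mod4; lia. Qed.
Let p_gt2' : (2 < p)%N := p_gt2 p_pr p_odd.
Local Notation h := (p.-1./2).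

Definition inv_p1 : nat := val ((p.-1%:R : Z)^-1).

Lemma inv_p1E : (p.-1 * inv_p1)%:R = 1 :> Z.
Proof.
have -> : (p.-1 * inv_p1)%:R = p.-1%:R * inv_p1%:R :> Z by rewrite natrM.
by rewrite /inv_p1 natr_Zp mulrV // p1_unit.
Qed.

(** Gamma_p(a/(p-1)) modulo p^N. *)
Definition gmf (a : nat) : Z := gm p N (a * inv_p1).

Lemma gmfE a : (p.-1 * (a * inv_p1))%:R = a%:R :> Z.
Proof. by rewrite mulnCA natrM inv_p1E mulr1. Qed.

Lemma gmf0 : gmf 0 = 1.
Proof. by rewrite /gmf mul0n gm0. Qed.

Definition shift_exp (hh j : nat) : nat := ((j + hh) %% p.-1)%N.
(** The total exponent of pi in the five Gauss sums, in units of p - 1; the division is exact by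
    [pi_orderE]. *)
Definition pi_order (hh j : nat) : nat :=
  ((2 * shift_exp hh j + 2 * j + dual_exp p j) %/ p.-1)%N.

Lemma dual_exp_dvd j : (j < p.-1)%N -> (p.-1 %| 4 * j + dual_exp p j)%N.
Proof.
by move=> jp; rewrite /dvdn /dual_exp modnDmr -mulnDr subnKC ?modnMl // ltnW.
Qed.

(** Since p - 1 is even, reduction modulo p - 1 preserves the parity of 4(p-1-j). It makes the sign
    of -4 lam disappear. *)
Lemma dual_exp_even j : ~~ odd (dual_exp p j).
Proof.
rewrite /dual_exp; have := divn_eq (4 * (p.-1 - j)) p.-1.
move=> /(congr1 odd); rewrite oddM /= oddD oddM.
have -> : odd p.-1 = false by apply/negbTE; rewrite -oddS prednK.
by rewrite andbF addFb => <-.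
Qed.

Lemma pi_orderE hh j : (p.-1 %| 2 * hh)%N -> (j < p.-1)%N ->
  (2 * shift_exp hh j + 2 * j + dual_exp p j = p.-1 * pi_order hh j)%N.
Proof.
move=> h2 jp; rewrite /pi_order [RHS]mulnC divnK //.
have -> : (2 * shift_exp hh j + 2 * j + dual_exp p j = 2 * shift_exp hh j + (2 * j + dual_exp p j))%N by lia.
rewrite /dvdn -modnDml /shift_exp modnMmr modnDml.
have -> : (2 * (j + hh) + (2 * j + dual_exp p j) = 2 * hh + (4 * j + dual_exp p j))%N by lia.
by rewrite -/(dvdn _ _) dvdn_add // dual_exp_dvd.
Qed.

Lemma teichN1 : tau (-1) = -1.
Proof.
have u : tau (-1) - 1 \is a GRing.unit by apply: teich_sub1_unit => //; exact: FN1_neq1.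
apply/eqP; rewrite -addr_eq0; apply/eqP; apply: (mulrI u).
have -> : (tau (-1) - 1) * (tau (-1) + 1) = tau (-1) ^+ 2 - 1 by ring.
by rewrite mulr0 -teichX // sqrrN expr1n teich1 // subrr.
Qed.

Lemma teichN u : tau (- u) = - tau u.
Proof.
have -> : - u = -1 * u by rewrite mulN1r.
by rewrite teichM // teichN1 mulN1r.
Qed.

Lemma teich_half u : u != 0 -> tau u ^+ h = (qchar u)%:~R.
Proof.
move=> u0; rewrite -teichX // /qchar (negPf u0).
case: (expf_half p_pr p_mod4 u0) => ->; first by rewrite eqxx teich1.
by rewrite (negPf (FN1_neq1 p_pr p_mod4)) teichN1.
Qed.

Variable lam : F.
Hypothesis lam0 : lam != 0.

Lemma F4_neq0 : (4%:R : F) != 0.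
Proof.
rewrite natF_eq0' // (@Euclid_dvdM 2 2) // orbb gtnNdvd //.
Qed.

(** The leading sign is that of a product of five Gauss sums, each contributing -1. *)
Definition torus_term (hh j : nat) : Z :=
  - ((- p%:R) ^+ pi_order hh j *
     (gmf (shift_exp hh j) ^+ 2 * gmf j ^+ 2 * (gmf (dual_exp p j) * tau (4%:R * lam) ^+ dual_exp p j))).

Lemma torus_gamma hh : (p.-1 %| 2 * hh)%N ->
  p%:R ^+ 2 * (p.-1%:R * \sumx_ u \sumx_ v \sumx_ w
      tau u^-1 ^+ hh * tau v^-1 ^+ hh * (torus lam u v w)%:~R) =
  p%:R * (p.-1%:R * \sumx_ u \sumx_ v \sumx_ w tau u^-1 ^+ hh * tau v^-1 ^+ hh)
  + p%:R * \sum_(j < p.-1) torus_term hh j.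
Proof.
move=> h2; have p10 : (0 < p.-1)%N by lia.
have [R [iota [pi [iota_inj pi_exp']]]] := exists_root_extension (- p%:R : Z) p10.
have pi_exp : pi ^+ p.-1 = - p%:R by rewrite pi_exp' rmorphN rmorph_nat.
pose K := (p ^ 2 * (N + p.+3))%N; have K_big : (p ^ 2 * (N + p.+3) <= K)%N by [].
clearbody K; pose ps := psi iota pi K.
have psD : forall x y, p%:R * ps (x + y) = p%:R * (ps x * ps y) by exact: psiD.
have ps0 : ps 0 = 1 by exact: psi0.
have sps : \sum_x ps x = 0 by exact: sum_psi.
have gk a : (a < p.-1)%N -> gauss iota ps a = - (pi ^+ a * iota (gmf a)).
  by move=> ap; apply: gross_koblitz => //; exact: gmfE.
have gmod a : gauss iota ps a = gauss iota ps (a %% p.-1).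
  apply: eq_bigr => x x0; congr (_ * _).
  rewrite {1}(divn_eq a p.-1) exprD mulnC exprM -rmorphXn teich_exp1 ?invr_eq0 //.
  by rewrite rmorph1 expr1n mul1r.
clearbody ps.
have := twisted_torus_gauss p_pr N_gt0 iota psD ps0 sps h2 lam0 F4_neq0.
rewrite /twisted_torus /trivial_part.
(* The powers of pi combine into powers of pi^(p-1) = -p, so both sides come from ['Z_(p ^ N)] and
   the identity descends. *)
move=> e; apply: iota_inj; move: e.
rewrite rmorphD !rmorphM !rmorph_nat -expr2 !rmorph_sum.
have -> : \sumx_ u iota (\sumx_ v \sumx_ w tau u^-1 ^+ hh * tau v^-1 ^+ hh * (torus lam u v w)%:~R)
  = \sumx_ u \sumx_ v \sumx_ w iota (tau u^-1) ^+ hh * iota (tau v^-1) ^+ hh * (torus lam u v w)%:~R.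
  apply: eq_bigr => u _; rewrite rmorph_sum; apply: eq_bigr => v _; rewrite rmorph_sum.
  by apply: eq_bigr => w _; rewrite !rmorphM !rmorphXn rmorph_int.
have -> : \sumx_ u iota (\sumx_ v \sumx_ w tau u^-1 ^+ hh * tau v^-1 ^+ hh)
  = \sumx_ u \sumx_ v \sumx_ w iota (tau u^-1) ^+ hh * iota (tau v^-1) ^+ hh.
  apply: eq_bigr => u _; rewrite rmorph_sum; apply: eq_bigr => v _; rewrite rmorph_sum.
  by apply: eq_bigr => w _; rewrite !rmorphM !rmorphXn.
move=> ->; congr (_ + _ * _); apply: eq_bigr => j _; have jp := ltn_ord j.
have bp : (dual_exp p j < p.-1)%N by rewrite ltn_mod.
have sp : (shift_exp hh j < p.-1)%N by rewrite ltn_mod.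
rewrite gmod -/(shift_exp hh j) !gk // /torus_term.
have -> : iota (tau (- (4%:R * lam))) ^+ dual_exp p j = iota (tau (4%:R * lam) ^+ dual_exp p j).
  by rewrite teichN rmorphN exprNn -signr_odd (negPf (dual_exp_even j)) expr0 mul1r [RHS]rmorphXn.
have pE : iota ((- p%:R) ^+ pi_order hh j) =
    pi ^+ (2 * shift_exp hh j) * pi ^+ (2 * j) * pi ^+ dual_exp p j.
  by rewrite -!exprD pi_orderE // exprM pi_exp rmorphXn rmorphN rmorph_nat.
have mor P A B C T : iota (- (P * (A ^+ 2 * B ^+ 2 * (C * T)))) =
    - (iota P * (iota A * iota A * (iota B * iota B) * (iota C * iota T))).
  by rewrite rmorphN !expr2 !rmorphM.
rewrite mor pE ![(2 * _)%N]mulnC !exprM.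
move: (iota (_ ^+ dual_exp p j)) (pi ^+ _) (pi ^+ j) (pi ^+ _) => ? ? ? ?.
by move: (iota _) (iota _) (iota _) => ? ? ?; ring.
Qed.

Lemma torus_sum_gamma :
  p%:R ^+ 2 * (p.-1%:R * (torus_sum lam)%:~R) =
  p%:R * p.-1%:R ^+ 4 + p%:R * \sum_(j < p.-1) torus_term 0 j :> Z.
Proof.
have := @torus_gamma 0 (dvdn0 _); rewrite /torus_sum.
have -> : \sumx_ u \sumx_ v \sumx_ w tau u^-1 ^+ 0 * tau v^-1 ^+ 0 * (torus lam u v w)%:~R =
   (\sumx_ u \sumx_ v \sumx_ w torus lam u v w)%:~R.
  rewrite rmorph_sum; apply: eq_bigr => u _; rewrite rmorph_sum; apply: eq_bigr => v _.
  by rewrite rmorph_sum; apply: eq_bigr => w _; rewrite !mul1r.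
move=> ->; congr (_ * _ + _).
under eq_bigr do under eq_bigr do under eq_bigr do rewrite !expr0 mul1r.
under eq_bigr do under eq_bigr do rewrite sumr_const cardF_neq0 //.
under eq_bigr do rewrite sumr_const cardF_neq0 //.
by rewrite sumr_const cardF_neq0 // -!mulrnA -natrX -natrM; congr (_%:R).
Qed.

Lemma torus_twist_gamma :
  p%:R ^+ 2 * (p.-1%:R * (torus_twist lam)%:~R) =
  p%:R * \sum_(j < p.-1) torus_term h j :> Z.
Proof.
have h2 : (p.-1 %| 2 * h)%N.
  by have -> : (2 * h = p.-1)%N; [have := divn_eq p 4; rewrite p_mod4; lia | exact: dvdnn].
have := torus_gamma h2; rewrite /torus_twist.
have tv u : u != 0 -> tau u^-1 ^+ h = (qchar u)%:~R.
  by move=> u0; rewrite teich_half ?invr_eq0 // qcharV.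
have -> : \sumx_ u \sumx_ v \sumx_ w tau u^-1 ^+ h * tau v^-1 ^+ h * (torus lam u v w)%:~R =
   (\sumx_ u \sumx_ v \sumx_ w qchar u * qchar v * torus lam u v w)%:~R.
  rewrite rmorph_sum; apply: eq_bigr => u u0; rewrite rmorph_sum; apply: eq_bigr => v v0.
  by rewrite rmorph_sum; apply: eq_bigr => w _; rewrite !tv // !rmorphM.
move=> ->; rewrite [X in p.-1%:R * X](_ : _ = 0) ?mulr0 ?add0r //.
rewrite (eq_bigr (fun u => (qchar u)%:~R * \sumx_ v \sumx_ w tau v^-1 ^+ h)) => [|u u0].
  by rewrite -mulr_suml -rmorph_sum sum_qchar // rmorph0 mul0r.
rewrite mulr_sumr; apply: eq_bigr => v _; rewrite mulr_sumr; apply: eq_bigr => w _.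
by rewrite tv.
Qed.

End TorusModq.

(** * Residues modulo p^N of the p-adic approximants *)

Section Approximations.
Variables (p N k : nat).
Hypotheses (p_pr : prime p) (p_odd : odd p) (N_gt0 : (0 < N)%N) (leNk : (N <= k)%N).
Let p_gt0 : (0 < p)%N := prime_gt0 p_pr.
Let p_gt2 : (2 < p)%N.
Proof. by case: p p_pr p_odd => [|[|[|[]]]]. Qed.
Local Notation Z := 'Z_(p ^ N).

Definition reduces (x : rat) (z : Z) : Prop := pint p x /\ red p N x = z.

Lemma reduces_nat n : reduces n%:R n%:R.
Proof. by split; [exact: pint_nat | exact: red_nat]. Qed.

Lemma reducesN x y : reduces x y -> reduces (- x) (- y).
Proof. by case=> hx <-; split; [exact: pintN | exact: redN]. Qed.

Lemma reduces1 : reduces 1 1. Proof. exact: (reduces_nat 1). Qed.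

Lemma reducesM x y x' y' : reduces x x' -> reduces y y' -> reduces (x * y) (x' * y').
Proof. by case=> hx <- [hy <-]; split; [exact: pintM | exact: redM]. Qed.

Lemma reducesD x y x' y' : reduces x x' -> reduces y y' -> reduces (x + y) (x' + y').
Proof. by case=> hx <- [hy <-]; split; [exact: pintD | exact: redD]. Qed.

Lemma reducesX x x' n : reduces x x' -> reduces (x ^+ n) (x' ^+ n).
Proof. by case=> hx <-; split; [exact: pintX | exact: redX]. Qed.

Lemma reduces_sum n (f : 'I_n -> rat) (g : 'I_n -> Z) :
  (forall i, reduces (f i) (g i)) -> reduces (\sum_(i < n) f i) (\sum_(i < n) g i).
Proof.
move=> h; elim/big_rec2: _ => [|i y x _ hyx]; first exact: (reduces_nat 0).
exact: reducesD.
Qed.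

Lemma reduces_prod n (f : 'I_n -> rat) (g : 'I_n -> Z) :
  (forall i, reduces (f i) (g i)) -> reduces (\prod_(i < n) f i) (\prod_(i < n) g i).
Proof.
move=> h; elim/big_rec2: _ => [|i y x _ hyx]; first exact: reduces1.
exact: reducesM.
Qed.

(** A unit residue forces the numerator to be prime to p, so the inverse is again p-integral. *)
Lemma reducesV x z : reduces x z -> z \is a GRing.unit -> reduces x^-1 z^-1.
Proof.
case=> hx <- u; suff hV : pint p x^-1.
  split=> //; apply: (mulrI u); rewrite mulrV // -redM // divff ?red1 //.
  by apply: contraTneq u => ->; rewrite red0 // unitr0.
case: (hx) u => a [b pb xE]; rewrite {1}xE redE // => u.
have ub : (b%:R : Z) \is a GRing.unit by rewrite natZ_unit.
have ua : (a%:~R : Z) \is a GRing.unit by have := u; rewrite unitrMl ?unitrV.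
have pV n : (n%:R : Z) \is a GRing.unit -> pint p (b%:R / n%:R).
  by rewrite natZ_unit // => pn; exists b, n.
rewrite xE invf_div; case: a ua {u xE} => n; first exact: pV.
by rewrite NegzE !mulrNz unitrN invrN mulrN => /pV; exact: pintN.
Qed.

Lemma reduces_div x y m n : m%:R = n%:R * y%:R :> Z -> ~~ (p %| y)%N ->
  x = m%:R / y%:R -> reduces x n%:R.
Proof.
move=> h py ->; have uy : (y%:R : Z) \is a GRing.unit by rewrite natZ_unit.
have -> : n%:R = m%:R / y%:R :> Z by rewrite h mulrK.
by apply: reducesM (reduces_nat m) (reducesV (reduces_nat y) uy).
Qed.

(** By Euler's theorem the power of the denominator in [padic_lift] inverts it modulo p^k, and N <=
    k. *)
Lemma padic_liftE x : pint p x -> (padic_lift p k x)%:R = red p N x :> Z.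
Proof.
move=> hx; rewrite /padic_lift.
have pd := pint_denq hx; set M := (p ^ k)%N; set d := `|denq x|%N in pd *.
have M0 : M%:Z != 0 by rewrite eqz_nat -lt0n expn_gt0 p_gt0.
have Mz : (M%:R : Z) = 0.
  by apply/eqP; rewrite natZ_eq0 // dvdn_exp2l.
set c : int := numq x * _.
have -> : `|(c %% M%:Z)%Z|%N%:R = c%:~R :> Z.
  clearbody c; rewrite -[LHS]/((`|_|%N%:Z)%:~R) gez0_abs ?modz_ge0 //.
  rewrite [in RHS](divz_eq c M%:Z) [RHS]intrD [X in _ = X + _]intrM.
  by rewrite (_ : (M%:Z)%:~R = 0 :> Z) // mulr0 add0r.
rewrite /red rmorphM /=; congr (_ * _).
have -> : (denq x)%:~R = d%:R :> Z by rewrite -[denq x]gez0_abs.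
have ud : (d%:R : Z) \is a GRing.unit by rewrite natZ_unit.
apply: (mulrI ud); rewrite mulrV // -natrM -expnS prednK ?totient_gt0 ?expn_gt0 ?p_gt0 //.
apply/eqP; rewrite -[1]/(1%:R) natZ_eq //.
have : d ^ totient M = 1 %[mod M].
  by apply: Euler_exp_totient; rewrite coprime_sym coprimeXl // prime_coprime.
move/eqP; rewrite eqn_mod_dvd ?expn_gt0; last first.
  by case: (d) pd => // ; rewrite dvdn0.
have dv : (p ^ N %| M)%N by rewrite dvdn_exp2l.
move/(dvdn_trans dv); rewrite -eqn_mod_dvd // expn_gt0.
by case: (d) pd => // ; rewrite dvdn0.
Qed.

Lemma reduces_gammap x n : reduces x n%:R -> reduces (gammap_approx p k x) (gm p N n).
Proof.
case=> hx rx; split; first exact: pint_gammap.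
by rewrite /gammap_approx red_gammap //; apply: gm_eq => //; rewrite padic_liftE.
Qed.

Lemma reduces_omegabar j (u : 'F_p) : u != 0 ->
  reduces (omegabar_approx k j u) (teich N u^-1 ^+ j).
Proof.
move=> u0; rewrite /omegabar_approx (negPf u0); apply: reducesX.
rewrite /teich_approx; have := reduces_nat (val u^-1 ^ p ^ k).
by rewrite [X in reduces _ X]natrX teich_pow // (leq_trans leNk).
Qed.

(** The maps [A], [B], [A0], [B0] give natural representatives of the gamma arguments. The exponents
    of -p are required to be natural numbers, which keeps every summand p-integral. *)
Lemma reduces_G (a b : seq rat) (u : 'F_p) (A B : nat -> nat -> nat) (A0 B0 : nat -> nat)
    (e : nat -> nat -> nat) : u != 0 ->
  (forall i, (i < size a)%N -> reduces (Defs.frac (nth 0 a i)) (A0 i)%:R) ->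
  (forall i, (i < size a)%N -> reduces (Defs.frac (- nth 0 b i)) (B0 i)%:R) ->
  (forall i j, (i < size a)%N -> (j < p.-1)%N ->
     reduces (Defs.frac (nth 0 a i - j%:R / p.-1%:R)) (A i j)%:R) ->
  (forall i j, (i < size a)%N -> (j < p.-1)%N ->
     reduces (Defs.frac (- nth 0 b i + j%:R / p.-1%:R)) (B i j)%:R) ->
  (forall i j, (i < size a)%N -> (j < p.-1)%N ->
     - Num.floor (Defs.frac (nth 0 a i) - j%:R / p.-1%:R)
     - Num.floor (Defs.frac (- nth 0 b i) + j%:R / p.-1%:R) = (e i j)%:Z) ->
  reduces (G_approx k a b u)
   (- p.-1%:R^-1 * \sum_(j < p.-1) ((-1) ^+ (j * size a) * teich N u^-1 ^+ j *
     \prod_(i < size a) (gm p N (A i j) / gm p N (A0 i) *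
        (gm p N (B i j) / gm p N (B0 i)) * (- p%:R) ^+ e i j))).
Proof.
move=> u0 hA0 hB0 hA hB he; rewrite /G_approx.
apply: reducesM.
  rewrite mulN1r; apply: reducesN; apply: reducesV; first exact: reduces_nat.
  exact: p1_unit.
apply: reduces_sum => j; apply: reducesM.
  apply: reducesM; last exact: reduces_omegabar.
  by apply: reducesX; apply: reducesN; exact: reduces1.
apply: reduces_prod => i; rewrite he //.
have gV x n : reduces x n%:R -> reduces (gammap_approx p k x)^-1 (gm p N n)^-1.
  by move=> h; apply: reducesV; [exact: reduces_gammap | exact: gm_unit].
apply: reducesM; last first.
  by apply: (@reducesX (- p%:R)); apply: reducesN; exact: reduces_nat.
by do 2?[apply: reducesM];
  first [apply: gV | apply: reduces_gammap]; [exact: hA|exact: hA0|exact: hB|exact: hB0].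
Qed.

End Approximations.

(** * Floors and fractional parts of the hypergeometric parameters *)

Lemma floor_frac_eq (x y : rat) (m : int) : 0 <= y < 1 -> x = y + m%:~R ->
  Num.floor x = m /\ Defs.frac x = y.
Proof.
move=> /andP[y0 y1] xE; have fx : Num.floor x = m.
  by apply: floor_def; rewrite xE rmorphD /= lerDr y0 addrC ltrD2l.
by split; rewrite // /Defs.frac fx xE addrK.
Qed.

Section Fractions.
Variable p : nat.
Hypotheses (p_pr : prime p) (p_mod4 : (p %% 4 = 3)%N).
Let p_gt0 : (0 < p)%N := prime_gt0 p_pr.
Local Notation h := (p.-1./2).
Local Notation q := (p.-1).

Lemma p1_double : (q = h + h)%N.
Proof. by have := divn_eq p 4; rewrite p_mod4; lia. Qed.

Lemma half_odd : odd h.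
Proof. by have := divn_eq p 4; rewrite p_mod4; lia. Qed.

Let q_gt0 : (0 < q)%N.
Proof. by have := divn_eq p 4; rewrite p_mod4; lia. Qed.
Let qR : q%:R != 0 :> rat.
Proof. by rewrite pnatr_eq0 -lt0n. Qed.

(** The ceiling of 4j/(p-1), that is, how many of 0, 1/4, 2/4, 3/4 lie strictly below j/(p-1). *)
Definition carry (j : nat) : nat := ((4 * j + dual_exp p j) %/ q)%N.

Lemma carryE j : (j < q)%N -> (4 * j + dual_exp p j = q * carry j)%N.
Proof.
move=> jq; rewrite /carry mulnC [RHS]mulnC divnK 1?mulnC // /dvdn /dual_exp modnDmr.
by rewrite -mulnDr subnKC ?modnMl // ltnW.
Qed.

Lemma dual_exp_lt j : (dual_exp p j < q)%N.
Proof. by rewrite ltn_mod. Qed.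

Lemma carry_le4 j : (j < q)%N -> (carry j <= 4)%N.
Proof.
move=> jq; have := carryE jq; have := dual_exp_lt j => bq E.
by rewrite -ltnS -(ltn_pmul2l q_gt0) -E; lia.
Qed.

Lemma carry_gt0 j : (j < q)%N -> (0 < j)%N -> (0 < carry j)%N.
Proof.
move=> jq j0; have := carryE jq; rewrite lt0n; case: eqP => // ->; lia.
Qed.

Lemma shift_expE j : (j < q)%N ->
  shift_exp p h j = if (j < h)%N then (j + h)%N else (j - h)%N.
Proof.
move=> jq; rewrite /shift_exp; have := p1_double => qE; case: ltnP => jh.
  by rewrite modn_small; lia.
by rewrite -{1}(subnK jh) -addnA -qE modnDr modn_small; lia.
Qed.

Lemma carry_lo j : (j < h)%N -> (carry j <= 2)%N.
Proof.
move=> jh; have qE := p1_double; have jq : (j < q)%N by lia.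
have := carryE jq; have := dual_exp_lt j => bq E.
by rewrite -ltnS -(ltn_pmul2l q_gt0) -E; lia.
Qed.

Lemma carry_hi j : (j < q)%N -> (h < j)%N -> (3 <= carry j)%N.
Proof.
move=> jq jh; have qE := p1_double.
have := carryE jq => E; rewrite -(ltn_pmul2l q_gt0) -E; lia.
Qed.

Lemma dual_exp_half : dual_exp p h = 0%N /\ carry h = 2.
Proof.
have qE := p1_double; have hq : (h < q)%N by have := half_odd; case: (h) qE => //; lia.
have E := carryE hq; have bq := dual_exp_lt h.
have E2 : (q * carry h = q * 2 + dual_exp p h)%N by rewrite -E {3}qE; lia.
have d0 : dual_exp p h = 0%N.
  have : (q %| dual_exp p h)%N.
    by rewrite -(dvdn_addr _ (dvdn_mulr 2 (dvdnn q))) -E2 dvdn_mulr.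
  by case: (dual_exp p h) bq => // n nq; rewrite gtnNdvd.
split=> //; apply/eqP; rewrite -(eqn_pmul2l q_gt0) E2 d0 addn0 //.
Qed.

Lemma dual_exp0 : dual_exp p 0 = 0%N.
Proof. by rewrite /dual_exp subn0 modnMl. Qed.

Lemma carry0 : carry 0 = 0%N.
Proof. by rewrite /carry dual_exp0 div0n. Qed.

(** Since 4j = (p-1) [carry j] - [dual_exp p j], the number is a quarter of a - [carry j] +
    [dual_exp p j]/(p-1). It is negative exactly when a < [carry j], and reducing modulo 1 means
    reducing a - [carry j] modulo 4. *)
Lemma frac_quarter a j : (a <= 3)%N -> (j < q)%N ->
  Num.floor (a%:R / 4%:R - j%:R / q%:R : rat) = - (a < carry j)%N%:Z /\
  Defs.frac (a%:R / 4%:R - j%:R / q%:R) =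
  (q * ((a + 4 - carry j) %% 4) + dual_exp p j)%:R / (4 * q)%:R.
Proof.
move=> a3 jq; have E := carryE jq; have u4 := carry_le4 jq; have bq := dual_exp_lt j.
set u := carry j in E u4 *; set b := dual_exp p j in E bq *.
set r := ((a + 4 - u) %% 4)%N.
have rE : (r + u = a + 4 * (a < u))%N.
  rewrite /r; case: (ltnP a u) => au; first by rewrite modn_small; lia.
  have -> : (a + 4 - u = (a - u) + 4)%N by lia.
  by rewrite modnDr modn_small; lia.
have r3 : (r < 4)%N by rewrite ltn_mod.
apply: floor_frac_eq.
  rewrite divr_ge0 ?ler0n //= ltr_pdivrMr ?ltr0n ?muln_gt0 // mul1r ltr_nat.
  have : (q * r <= q * 3)%N by rewrite leq_mul2l -ltnS r3 orbT.
  lia.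
have jE : j%:R = (q%:R * u%:R - b%:R) / 4%:R :> rat.
  apply: (canRL (mulfK _)) => //; rewrite -natrM -E natrD addrK -natrM mulnC //.
have aE : a%:R = r%:R + u%:R - 4%:R * (a < u)%N%:R :> rat.
  by rewrite -natrD rE natrD natrM addrK.
rewrite jE {1}aE natrD !natrM rmorphN /= -[((a < u)%N%:Z)%:~R]/((a < u)%N%:R).
field; exact: qR.
Qed.

Lemma frac_p1 a : (a < q)%N ->
  Num.floor (a%:R / q%:R : rat) = 0 /\ Defs.frac (a%:R / q%:R) = a%:R / q%:R.
Proof.
move=> aq; apply: floor_frac_eq; last by rewrite addr0.
by rewrite divr_ge0 ?ler0n //= ltr_pdivrMr ?ltr0n // mul1r ltr_nat.
Qed.

Let qRE : q%:R = h%:R + h%:R :> rat.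
Proof. by rewrite -natrD -p1_double. Qed.

Lemma half_rat : 1 / 2%:R = h%:R / q%:R :> rat.
Proof.
by rewrite qRE; field; rewrite -qRE.
Qed.

Lemma frac_half j : (j < q)%N ->
  Defs.frac (- (1 / 2%:R) + j%:R / q%:R) = (shift_exp p h j)%:R / q%:R.
Proof.
move=> jq; rewrite half_rat.
have sq : (shift_exp p h j < q)%N by rewrite ltn_mod.
have s01 : 0 <= ((shift_exp p h j)%:R / q%:R : rat) < 1.
  by rewrite divr_ge0 ?ler0n //= ltr_pdivrMr ?ltr0n // mul1r ltr_nat.
suff E : - (h%:R / q%:R) + j%:R / q%:R = (shift_exp p h j)%:R / q%:R
   + (- (j < h)%N%:Z)%:~R :> rat by have [_ ->] := floor_frac_eq s01 E.
apply: (mulIf qR); rewrite mulrDl mulNr !divfK // mulrDl divfK //.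
rewrite shift_expE // rmorphN /= -[((j < h)%N%:Z)%:~R]/((j < h)%N%:R).
case: ltnP => jh; last by rewrite natrB //= oppr0 mul0r addr0 addrC.
by rewrite natrD qRE /=; ring.
Qed.

Lemma frac_Nhalf : Defs.frac (- (1 / 2%:R)) = h%:R / q%:R.
Proof.
have := frac_half q_gt0; rewrite mul0r addr0 => ->.
by rewrite shift_expE // ; case: ltnP => //; have := p1_double; lia.
Qed.

Lemma floor_half j : (j < q)%N -> 
  Num.floor (Defs.frac (- (1 / 2%:R)) + j%:R / q%:R) = (h <= j)%N%:Z.
Proof.
move=> jq; rewrite frac_Nhalf.
have sq : (shift_exp p h j < q)%N by rewrite ltn_mod.
have s01 : 0 <= ((shift_exp p h j)%:R / q%:R : rat) < 1.
  by rewrite divr_ge0 ?ler0n //= ltr_pdivrMr ?ltr0n // mul1r ltr_nat.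
suff E : (h%:R / q%:R) + j%:R / q%:R = (shift_exp p h j)%:R / q%:R
   + ((h <= j)%N%:Z)%:~R :> rat by have [-> _] := floor_frac_eq s01 E.
apply: (mulIf qR); rewrite mulrDl !divfK // mulrDl divfK //.
rewrite shift_expE // -[((h <= j)%N%:Z)%:~R]/((h <= j)%N%:R).
case: ltnP => jh; first by rewrite natrD /=; ring.
by rewrite natrB //= qRE; ring.
Qed.

End Fractions.

(** * Gamma products occurring in the hypergeometric summands *)

Lemma rotate_prod4 (V : comNzRingType) (G : nat -> V) u : (u <= 4)%N ->
  \prod_(a < 4) G ((a + 4 - u) %% 4)%N = \prod_(a < 4) G a.
Proof.
case: u => [|[|[|[|[|//]]]]] _; rewrite !big_ord_recr !big_ord0 /=.
- by change (1 * G 0%N * G 1%N * G 2 * G 3 = 1 * G 0%N * G 1%N * G 2 * G 3).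
- change (1 * G 3 * G 0%N * G 1%N * G 2 = 1 * G 0%N * G 1%N * G 2 * G 3); ring.
- change (1 * G 2 * G 3 * G 0%N * G 1%N = 1 * G 0%N * G 1%N * G 2 * G 3); ring.
- change (1 * G 1%N * G 2 * G 3 * G 0%N = 1 * G 0%N * G 1%N * G 2 * G 3); ring.
- by change (1 * G 0%N * G 1%N * G 2 * G 3 = 1 * G 0%N * G 1%N * G 2 * G 3).
Qed.

Section GammaQuotients.
Variables (p N : nat).
Hypotheses (p_pr : prime p) (p_mod4 : (p %% 4 = 3)%N) (N_gt0 : (0 < N)%N).
Local Notation F := 'F_p.
Local Notation Z := 'Z_(p ^ N).
Local Notation tau := (@teich p N).
Local Notation h := (p.-1./2).
Local Notation q := (p.-1).
Local Notation gm := (gm p N).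
Local Notation gmf := (gmf p N).
Local Notation inv_p1 := (inv_p1 p N).
Local Notation b := (dual_exp p).
Local Notation u := (carry p).
Local Notation sh := (shift_exp p h).
Let p_gt0 : (0 < p)%N := prime_gt0 p_pr.
Let p_odd : odd p.
Proof. by have := divn_eq p 4; rewrite p_mod4; lia. Qed.
Let qE : (q = h + h)%N := p1_double p_pr p_mod4.
Let q_gt0 : (0 < q)%N.
Proof. by have := divn_eq p 4; rewrite p_mod4; lia. Qed.
Let q_lt : (q < p)%N.
Proof. by rewrite prednK. Qed.

Definition inv4 : nat := val ((4%:R : Z)^-1).

Lemma ndvd4 : ~~ (p %| 4)%N.
Proof. by rewrite (@Euclid_dvdM 2 2) // orbb gtnNdvd // ltnNge; case: p p_odd p_pr => [|[|[|]]]. Qed.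

Lemma inv4E : (4 * inv4)%:R = 1 :> Z.
Proof.
have -> : (4 * inv4)%:R = 4%:R * inv4%:R :> Z by rewrite natrM.
by rewrite /inv4 natr_Zp mulrV // natZ_unit // ndvd4.
Qed.

Let inv1E : (q * inv_p1)%:R = 1 :> Z := inv_p1E p_pr p_mod4 N_gt0.

(** A natural representative modulo p^N of the fractional part of a/4 - j/(p-1). *)
Definition quarter_arg (a j : nat) : nat := ((b j * inv_p1 + (a + 4 - u j) %% 4) * inv4)%N.

Definition gquarter (a j : nat) : Z := gm (quarter_arg a j).

(** For a = 0, ..., 3 the fractional parts are a cyclic rotation of the four arguments in the
    multiplication formula at [dual_exp p j]/(p-1). *)
Lemma gquarter_prod j : (j < q)%N ->
  \prod_(a < 4) gquarter a j =
  tau 4%:R ^+ b j * gmf (b j) * \prod_(a < 4) gm (a * inv4).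
Proof.
move=> jq; have bq := dual_exp_lt p_pr p_mod4 j.
rewrite -(gm_multiplication_frac p_pr p_odd N_gt0 (ltn_trans bq q_lt) inv4E); last first.
  exact: gmfE p_pr p_mod4 N_gt0 (b j).
by apply: (rotate_prod4 (fun r => gm ((b j * inv_p1 + r) * inv4))); exact: carry_le4.
Qed.

Lemma gquarter0 a : (a < 4)%N -> gquarter a 0 = gm (a * inv4).
Proof.
move=> a4; rewrite /gquarter /quarter_arg dual_exp0 carry0 subn0 mul0n add0n.
by rewrite modnDr modn_small.
Qed.

(** The sign of Gamma_p(x) Gamma_p(1-x) at x = j/(p-1). At j = 0 the two fractional parts are both 0
    instead of adding up to 1, so the product is Gamma_p(0)^2 = 1; this anomaly creates the
    exceptional indices. *)
Definition refl_sign (j : nat) : Z := if j == 0%N then 1 else - (-1) ^+ j.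

(** The numerical hypothesis says that c/(p-1) and ([b j]/(p-1) + r)/4 add up to 1. *)
Lemma quarter_reflection c j r : (c < q)%N -> (4 * c + b j + q * r = 4 * q)%N ->
  (0 < c)%N -> gm ((b j * inv_p1 + r) * inv4) * gmf c = refl_sign c.
Proof.
move=> cq E c0; rewrite /refl_sign eqn0Ngt c0 /= mulrC.
apply: (gm_reflection_frac p_pr p_odd N_gt0 (ltn_trans cq q_lt) (gmfE p_pr p_mod4 N_gt0 c)).
have c4 := inv4E; have i1 := inv1E; rewrite !natrM in c4 i1.
have : 4%:R * c%:R + (b j)%:R + q%:R * r%:R = 4%:R * q%:R :> Z.
  by rewrite -!natrM -!natrD E.
rewrite natrD !natrM natrD natrM.
move: (4%:R) (q%:R) (c%:R) ((b j)%:R) (inv_p1%:R) (inv4%:R) (r%:R) c4 i1 => f Q C B i v R c4 i1 E'.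
have -> : C * i + (B * i + R) * v = i * v * (f * C + B + Q * R) + (1 - f * v) * C * i
    + (1 - Q * i) * R * v by ring.
rewrite E' c4 i1 subrr !mul0r !addr0.
have -> : i * v * (f * Q) = (f * v) * (Q * i) by ring.
by rewrite c4 i1 mul1r.
Qed.

Lemma gquarter_refl j : (j < q)%N -> gquarter 0 j * gmf j = refl_sign j.
Proof.
move=> jq; case: (posnP j) => [->|j0].
  by rewrite gquarter0 // gmf0 // mulr1 mul0n gm0.
apply: quarter_reflection => //.
have := carryE jq; have := carry_gt0 p_pr p_mod4 jq j0.
have := carry_le4 p_pr p_mod4 jq; rewrite /gquarter add0n => u4 u0 E.
have r4 : ((4 - u j) %% 4 = 4 - u j)%N by rewrite modn_small; lia.
have -> : (4 * q = q * u j + q * (4 - u j))%N by rewrite -mulnDr subnKC // mulnC.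
by rewrite r4 E.
Qed.

Lemma shift_half : sh h = 0%N.
Proof. by rewrite /shift_exp -qE modnn. Qed.

Lemma shift_gt0 j : (j < q)%N -> j != h -> (0 < sh j)%N.
Proof.
move=> jq jh; rewrite shift_expE //; have := half_odd p_pr p_mod4.
case: (ltnP j h) => [_|jh'] oh; last by rewrite subn_gt0 ltn_neqAle eq_sym jh.
by case: (h) oh => // n _; rewrite addnS.
Qed.

(** The fractional parts of 1/2 - j/(p-1) and -1/2 + j/(p-1) add up to 1, except at j = (p-1)/2
    where both vanish. *)
Lemma gquarter2_refl j : (j < q)%N -> gquarter 2 j * gmf (sh j) = refl_sign (sh j).
Proof.
move=> jq; case: (eqVneq j h) => [->|jh].
  rewrite shift_half gmf0 // mulr1 /gquarter /quarter_arg.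
  by have [-> ->] := dual_exp_half p_pr p_mod4; rewrite mul0n gm0.
apply: quarter_reflection; [by rewrite ltn_mod| |exact: shift_gt0].
have E := carryE jq; have u4 := carry_le4 p_pr p_mod4 jq.
rewrite shift_expE //; case: ltnP => jh'.
  have u2 := carry_lo p_pr p_mod4 jh'.
  have -> : ((2 + 4 - u j) %% 4 = 2 - u j)%N.
    by rewrite addnC -addnBA // addnC modnDr modn_small; lia.
  have -> : (4 * (j + h) + b j + q * (2 - u j) = 4 * j + b j + q * (2 - u j) + 4 * h)%N by lia.
  by rewrite E -mulnDr subnKC //; lia.
have u3 := carry_hi p_pr p_mod4 jq _; have {}u3 : (3 <= u j)%N by apply: u3; lia.
have -> : ((2 + 4 - u j) %% 4 = 6 - u j)%N by rewrite modn_small; lia.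
have : (q * u j + q * (6 - u j) = q * 6)%N by rewrite -mulnDr subnKC //; lia.
lia.
Qed.

(** Reflection at 1/2 gives -(-1)^h, and h is odd because p = 3 mod 4. *)
Lemma gmf_half_sqr : gmf h * gmf h = 1.
Proof.
have hq : (h < q)%N by have := half_odd p_pr p_mod4; lia.
have := gm_reflection_frac p_pr p_odd N_gt0 (ltn_trans hq q_lt) (gmfE p_pr p_mod4 N_gt0 h).
move=> -> //; first by rewrite -signr_odd half_odd // expr1 opprK.
by rewrite -mulnDl -qE inv1E.
Qed.

Lemma gm_two_quarter : gm (2 * inv4) = gmf h.
Proof.
apply: gm_eq => //; have c4 := inv4E; have i1 := inv1E; rewrite {1}qE !natrM natrD in c4 i1.
rewrite !natrM; move: (inv_p1%:R) (inv4%:R) (h%:R) c4 i1 => i v H c4 i1.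
have -> : 2%:R * v = ((H + H) * i) * (2%:R * v) by rewrite i1 mul1r.
have -> : (H + H) * i * (2%:R * v) = 4%:R * v * (H * i) by ring.
by rewrite c4 mul1r.
Qed.

(** In the multiplication formula the factor a = 0 is exchanged, by reflection, for the gamma value
    at j/(p-1); the three quarters of 3G3 remain. *)
Lemma gmf_prod3 j : (j < q)%N ->
  refl_sign j * (gquarter 1 j * gquarter 2 j * gquarter 3 j * gmf j ^+ 3) =
  tau 4%:R ^+ b j * gmf (b j) * gmf j ^+ 4 * 
  (gm (1 * inv4) * gm (2 * inv4) * gm (3 * inv4)).
Proof.
move=> jq; rewrite -gquarter_refl //.
transitivity ((\prod_(a < 4) gquarter a j) * gmf j ^+ 4).
  by rewrite !big_ord_recr big_ord0 /=; ring.
rewrite gquarter_prod // !big_ord_recr big_ord0 /= mul0n gm0; ring.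
Qed.

(** Here both a = 0 and a = 2 are exchanged by reflection, leaving the parameters 1/4 and 3/4 of
    2G2. *)
Lemma gmf_prod2 j : (j < q)%N ->
  refl_sign j * refl_sign (sh j) * (gquarter 3 j * gquarter 1 j * gmf j * gmf (sh j)) =
  tau 4%:R ^+ b j * gmf (b j) * gmf j ^+ 2 * gmf (sh j) ^+ 2 *
  (gm (3 * inv4) * gm (1 * inv4) * gmf h).
Proof.
move=> jq; rewrite -gquarter_refl // -gquarter2_refl // -gm_two_quarter.
transitivity ((\prod_(a < 4) gquarter a j) * gmf j ^+ 2 * gmf (sh j) ^+ 2).
  by rewrite !big_ord_recr big_ord0 /=; ring.
rewrite gquarter_prod // !big_ord_recr big_ord0 /= mul0n gm0; ring.
Qed.

(** The indices j and [sh j] differ by the odd number h, so they have opposite parity. *)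
Lemma refl_sign_shift j : (j < q)%N -> j != 0%N -> j != h ->
  refl_sign j * refl_sign (sh j) = -1.
Proof.
move=> jq j0 jh; rewrite /refl_sign (negPf j0) eqn0Ngt shift_gt0 //= mulrNN -exprD.
rewrite -signr_odd shift_expE //; suff -> : odd (j + (if (j < h)%N then (j + h)%N else (j - h)%N)) by rewrite expr1.
have := half_odd p_pr p_mod4; case: (ltnP j h) => jh'; lia.
Qed.

End GammaQuotients.

(** * Termwise comparison of the torus sums with the hypergeometric sums *)

Lemma cancel3 (A : comUnitRingType) (s g1 g2 g3 c1 c2 c3 f W x y z : A) :
  c1 \is a GRing.unit -> c2 \is a GRing.unit -> c3 \is a GRing.unit ->
  s * (g1 * g2 * g3 * f ^+ 3) = W * (c1 * c2 * c3) ->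
  s * (1 * (g1 / c1 * f * x) * (g2 / c2 * f * y) * (g3 / c3 * f * z)) = W * (x * y * z).
Proof.
move=> u1 u2 u3 E.
transitivity (s * (g1 * g2 * g3 * f ^+ 3) * (c1^-1 * c2^-1 * c3^-1) * (x * y * z)).
  by ring.
rewrite E; transitivity (W * ((c1 / c1) * (c2 / c2) * (c3 / c3)) * (x * y * z)); first by ring.
by rewrite !mulrV // !mulr1.
Qed.

Lemma cancel2 (A : comUnitRingType) (s g1 g2 f1 f2 c1 c2 c3 W x y : A) :
  c1 \is a GRing.unit -> c2 \is a GRing.unit -> c3 \is a GRing.unit ->
  s * (g1 * g2 * f1 * f2) = W * (c1 * c2 * c3) ->
  s * (1 * (g1 / c1 * f1 * x) * (g2 / c2 * (f2 / c3) * y)) = W * (x * y).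
Proof.
move=> u1 u2 u3 E.
transitivity (s * (g1 * g2 * f1 * f2) * (c1^-1 * c2^-1 * c3^-1) * (x * y)).
  by ring.
rewrite E; transitivity (W * ((c1 / c1) * (c2 / c2) * (c3 / c3)) * (x * y)); first by ring.
by rewrite !mulrV // !mulr1.
Qed.

Lemma sum_proportional0 (A : comNzRingType) n (f g : nat -> A) c : (0 < n)%N ->
  (forall j, (j < n)%N -> (0 < j)%N -> f j = c * g j) ->
  \sum_(j < n) f j = f 0%N + c * (\sum_(j < n) g j - g 0%N).
Proof.
move=> n0 E; have : \sum_(j < n) (f j - c * g j) = f 0%N - c * g 0%N.
  rewrite (bigD1 (Ordinal n0)) //= big1 ?addr0 // => j; rewrite -val_eqE /= -lt0n => j0.
  by rewrite E // subrr.
rewrite sumrB -mulr_sumr => /(canRL (subrK _)) ->.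
by move: (\sum_(j < n) g j) => S; ring.
Qed.

Lemma sum_proportional2 (A : comNzRingType) n m (f g : nat -> A) c : (0 < m)%N -> (m < n)%N ->
  (forall j, (j < n)%N -> (0 < j)%N -> j != m -> f j = c * g j) ->
  \sum_(j < n) f j = f 0%N + f m + c * (\sum_(j < n) g j - g 0%N - g m).
Proof.
move=> m0 mn E; have n0 := ltn_trans m0 mn.
have : \sum_(j < n) (f j - c * g j) = (f 0%N - c * g 0%N) + (f m - c * g m).
  rewrite (bigD1 (Ordinal n0)) //= (bigD1 (Ordinal mn)) /=; last by rewrite -val_eqE /= -lt0n.
  rewrite big1 ?addr0 // => j; rewrite -!val_eqE /= -lt0n => /andP[j0 jm].
  by rewrite E // subrr.
rewrite sumrB -mulr_sumr => /(canRL (subrK _)) ->.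
by move: (\sum_(j < n) g j) => S; ring.
Qed.

Section Comparison.
Variables (p N : nat).
Hypotheses (p_pr : prime p) (p_mod4 : (p %% 4 = 3)%N) (N_gt0 : (0 < N)%N).
Local Notation F := 'F_p.
Local Notation Z := 'Z_(p ^ N).
Local Notation tau := (@teich p N).
Local Notation h := (p.-1./2).
Local Notation q := (p.-1).
Local Notation gm := (gm p N).
Local Notation gmf := (gmf p N).
Local Notation inv_p1 := (inv_p1 p N).
Local Notation inv4 := (inv4 p N).
Local Notation b := (dual_exp p).
Local Notation u := (carry p).
Local Notation sh := (shift_exp p h).
Let p_gt0 : (0 < p)%N := prime_gt0 p_pr.
Let p_odd : odd p.
Proof. by have := divn_eq p 4; rewrite p_mod4; lia. Qed.
Let qE : (q = h + h)%N := p1_double p_pr p_mod4.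
Let q_gt0 : (0 < q)%N.
Proof. by have := divn_eq p 4; rewrite p_mod4; lia. Qed.
Let h_gt0 : (0 < h)%N.
Proof. by have := half_odd p_pr p_mod4; case: (h). Qed.
Let qZ : q%:R = p%:R - 1 :> Z.
Proof. have <- : q.+1%:R = p%:R :> Z by rewrite prednK. by rewrite -natr1 addrK. Qed.
Let qU : (q%:R : Z) \is a GRing.unit := p1_unit p_pr p_odd N_gt0.

Variable lam : F.
Hypothesis lam0 : lam != 0.

Lemma pi_order0 j : (j < q)%N -> pi_order p 0 j = u j.
Proof.
move=> jq; rewrite /pi_order /carry /shift_exp addn0 modn_small //.
by congr (_ %/ _)%N; lia.
Qed.

(** Shifting j by h upwards or downwards, counted twice, changes the total exponent by exactly p -
    1. *)
Lemma pi_order_half j : (j < q)%N ->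
  pi_order p h j = if (j < h)%N then (u j).+1 else (u j).-1.
Proof.
move=> jq; have h2 : (q %| 2 * h)%N by rewrite mul2n -addnn -qE.
have E := pi_orderE p_pr p_mod4 N_gt0 h2 jq; have E' := carryE jq.
apply/eqP; rewrite -(eqn_pmul2l q_gt0) -E shift_expE //.
case: (ltnP j h) => jh; first by rewrite mulnS -E'; lia.
have u0 : (0 < u j)%N by apply: carry_gt0 => //; lia.
have E2 : (q * (u j).-1 + q = q * u j)%N by rewrite addnC -mulnS prednK.
by apply/eqP; move: (q * _)%N (q * _)%N E2 E' => *; lia.
Qed.

Lemma teich_dual j : (j < q)%N -> tau lam ^+ b j = tau (lam ^+ 4)^-1 ^+ j.
Proof.
move=> jq; have U : tau lam ^+ (4 * j) \is a GRing.unit.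
  by rewrite unitrX // teich_unit.
apply: (mulIr U); rewrite -exprD addnC carryE // exprM teich_exp1 // expr1n.
rewrite exprM -exprMn -teichX // -teichM // mulVf ?expf_neq0 //.
by rewrite teich1 // expr1n.
Qed.

(** The exponent of -p in the factor i of 2G2; for i = 1 the lower parameter 1/2 contributes the
    subtracted term. The truncated subtraction loses nothing for j < p - 1, as h <= j then forces
    [carry] to be at least 2. *)
Definition e2 (i j : nat) : nat := if i == 0%N then nat_of_bool (3 < u j)%N else ((1 < u j) - (h <= j))%N.

Definition prod3 (j : nat) : Z := \prod_(i < 3)
  (gm (quarter_arg p N (nth 0%N [:: 1; 2; 3]%N i) j) / gm (nth 0%N [:: 1; 2; 3]%N i * inv4) *
   (gm (j * inv_p1) / gm 0) * (- p%:R) ^+ (nth 0%N [:: 1; 2; 3]%N i < u j)%N).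

Definition prod2 (j : nat) : Z := \prod_(i < 2)
  (gm (quarter_arg p N (nth 0%N [:: 3; 1]%N i) j) / gm (nth 0%N [:: 3; 1]%N i * inv4) *
   (gm (nth 0%N [:: j; sh j] i * inv_p1) / gm (nth 0%N [:: 0%N; h] i * inv_p1)) *
   (- p%:R) ^+ e2 i j).

Definition sum3 : Z := \sum_(j < q) ((-1) ^+ (j * 3) * tau (lam ^+ 4)^-1 ^+ j * prod3 j).
Definition sum2 : Z := \sum_(j < q) ((-1) ^+ (j * 2) * tau (lam ^+ 4)^-1 ^+ j * prod2 j).

Lemma prod3E j : (j < q)%N ->
  refl_sign p N j * prod3 j =
  tau 4%:R ^+ b j * gmf (b j) * gmf j ^+ 4 * (- p%:R) ^+ (u j).-1.
Proof.
move=> jq; have := gmf_prod3 p_pr p_mod4 N_gt0 jq.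
rewrite /prod3 /gquarter !big_ord_recr big_ord0 /= gm0 // divr1 -[gm (j * _)]/(gmf j).
have <- : (- p%:R : Z) ^+ (1 < u j)%N * (- p%:R) ^+ (2 < u j)%N * (- p%:R) ^+ (3 < u j)%N =
  (- p%:R) ^+ (u j).-1.
  rewrite -!exprD; congr (_ ^+ _); have := carry_le4 p_pr p_mod4 jq.
  by case: (u j) => [|[|[|[|[|]]]]].
by apply: cancel3; exact: gm_unit.
Qed.

Lemma e2_sum j : (j < q)%N -> j != h ->
  (e2 0 j + e2 1 j = if (j < h)%N then (u j).-1 else (u j).-2.-1)%N.
Proof.
move=> jq jh; rewrite /e2 /=; case: (ltnP j h) => jh'.
  have := carry_lo p_pr p_mod4 jh'; lia.
have : (3 <= u j)%N by apply: carry_hi => //; rewrite ltn_neqAle eq_sym jh.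
have := carry_le4 p_pr p_mod4 jq; lia.
Qed.

Lemma prod2E j : (j < q)%N ->
  refl_sign p N j * refl_sign p N (sh j) * prod2 j =
  tau 4%:R ^+ b j * gmf (b j) * gmf j ^+ 2 * gmf (sh j) ^+ 2 *
    (- p%:R) ^+ (e2 0 j + e2 1 j).
Proof.
move=> jq; have := gmf_prod2 p_pr p_mod4 N_gt0 jq.
rewrite /prod2 /gquarter !big_ord_recr big_ord0 /= mul0n gm0 // divr1 exprD.
rewrite -[gm (j * _)]/(gmf j) -[gm (sh j * _)]/(gmf (sh j)) -[gm (h * _)]/(gmf h).
by apply: cancel2; exact: gm_unit.
Qed.

Lemma expN1_3 j : (-1 : Z) ^+ (j * 3) = (-1) ^+ j.
Proof. by rewrite -[LHS]signr_odd oddM andbT signr_odd. Qed.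

Lemma expN1_2 j : (-1 : Z) ^+ (j * 2) = 1.
Proof. by rewrite -[LHS]signr_odd oddM andbF. Qed.

(** The order of p on the torus side is [carry j], but [carry j] - 1 in 3G3, where the quarter a = 0
    is absent; this leaves a factor -p, and reflection provides the sign. *)
Lemma torus_term0 j : (j < q)%N -> (0 < j)%N ->
  torus_term N lam 0 j = - p%:R * ((-1) ^+ (j * 3) * tau (lam ^+ 4)^-1 ^+ j * prod3 j).
Proof.
move=> jq j0; rewrite /torus_term pi_order0 // teichM // [(_ * tau lam) ^+ _]exprMn teich_dual // expN1_3.
have -> : shift_exp p 0 j = j by rewrite /shift_exp addn0 modn_small.
have u0 := carry_gt0 p_pr p_mod4 jq j0; rewrite -{1}(prednK u0) exprS; have := prod3E jq.
rewrite /refl_sign eqn0Ngt j0 /=.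
move: (tau _ ^+ j) (tau _ ^+ _) (gmf _) (gmf _) (prod3 j) => T S A B P.
move: (p%:R) ((-1) ^+ j) => x e; move: ((- x) ^+ _) => y E.
transitivity (x * T * (S * B * A ^+ 4 * y)); first by ring.
by rewrite -E; ring.
Qed.

Lemma torus_term00 : torus_term N lam 0 0 = -1.
Proof.
rewrite /torus_term pi_order0 // carry0 dual_exp0 /shift_exp mod0n gmf0 // !expr0 !expr1n.
by rewrite !mulr1.
Qed.

Lemma prod3_0 : prod3 0 = 1.
Proof.
have := prod3E q_gt0; rewrite /refl_sign eqxx mul1r => ->.
by rewrite carry0 dual_exp0 gmf0 // !expr0 expr1n !mulr1.
Qed.

(** At j = 0 the torus term is -1 where proportionality would predict -p; the difference is p -
    1. *)
Lemma sum_torus_term0 :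
  \sum_(j < q) torus_term N lam 0 j = p%:R - 1 - p%:R * sum3.
Proof.
rewrite (@sum_proportional0 Z _ (torus_term N lam 0) (fun j => (-1) ^+ (j * 3) * tau (lam ^+ 4)^-1 ^+ j * prod3 j)
  (- p%:R) q_gt0) -/sum3; last by move=> j jq j0; exact: torus_term0.
rewrite torus_term00 prod3_0 mul0n !expr0 !mulr1.
by move: sum3 (p%:R) => S x; ring.
Qed.

(** The order of p exceeds the exponent in 2G2 by exactly 2 on both halves of the range, and the two
    reflection signs multiply to -1. *)
Lemma torus_term_half j : (j < q)%N -> j != 0%N -> j != h ->
  torus_term N lam h j =
  p%:R ^+ 2 * ((-1) ^+ (j * 2) * tau (lam ^+ 4)^-1 ^+ j * prod2 j).
Proof.
move=> jq j0 jh; rewrite /torus_term teichM // [(_ * tau lam) ^+ _]exprMn teich_dual // expN1_2.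
have -> : pi_order p h j = (2 + (e2 0 j + e2 1 j))%N.
  rewrite pi_order_half // e2_sum //; case: (ltnP j h) => jh'.
    by have := @carry_gt0 p p_pr p_mod4 j jq; lia.
  have : (3 <= u j)%N by apply: carry_hi => //; rewrite ltn_neqAle eq_sym jh.
  lia.
have := prod2E jq; rewrite refl_sign_shift // mulN1r [_ ^+ (2 + _)]exprD.
move: (tau _ ^+ j) (tau _ ^+ _) (gmf (b j)) (gmf (sh j)) (gmf j) (prod2 j) => T S A C B P.
move: (p%:R) => x; move: ((- x) ^+ (_ + _)) => y E.
transitivity (- x ^+ 2 * T * (S * A * B ^+ 2 * C ^+ 2 * y)); first by ring.
by rewrite -E; ring.
Qed.

Lemma shift0 : sh 0 = h.
Proof. by rewrite /shift_exp add0n modn_small // qE; lia. Qed.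

Lemma e2_ends j : j = 0%N \/ j = h -> (e2 0 j + e2 1 j = 0)%N.
Proof.
rewrite /e2 /=; case=> ->; first by rewrite carry0.
by have [_ ->] := dual_exp_half p_pr p_mod4; rewrite leqnn.
Qed.

Let hq : (h < q)%N.
Proof. by rewrite qE; lia. Qed.

Lemma refl_sign_half : refl_sign p N h = 1.
Proof.
by rewrite /refl_sign eqn0Ngt h_gt0 /= -signr_odd half_odd // expr1 opprK.
Qed.

Lemma refl_sign0 : refl_sign p N 0 = 1. Proof. by []. Qed.

Lemma prod2_ends j : j = 0%N \/ j = h -> prod2 j = 1.
Proof.
move=> jE; have jq : (j < q)%N by case: jE => ->.
have h2 := gmf_half_sqr p_pr p_mod4 N_gt0; rewrite -expr2 in h2.
have := prod2E jq; rewrite e2_ends // expr0 mulr1.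
case: jE => ->; rewrite ?shift0 ?(shift_half p_pr p_mod4) refl_sign_half refl_sign0 !mul1r => ->.
  by rewrite dual_exp0 expr0 gmf0 // h2 expr1n !mulr1.
by have [-> _] := dual_exp_half p_pr p_mod4; rewrite expr0 gmf0 // h2 expr1n !mulr1.
Qed.

Lemma teich_ends j : j = 0%N \/ j = h -> tau (lam ^+ 4)^-1 ^+ j = 1.
Proof.
case=> ->; first by rewrite expr0.
by rewrite -teich_dual //; have [-> _] := dual_exp_half p_pr p_mod4.
Qed.

(** At these two indices the gamma factors multiply to 1 and a single p survives, against the p^2
    that [torus_term_half] would predict. *)
Lemma torus_term_ends j : j = 0%N \/ j = h -> torus_term N lam h j = p%:R.
Proof.
move=> jE; have jq : (j < q)%N by case: jE => ->.
have h2 := gmf_half_sqr p_pr p_mod4 N_gt0; rewrite -expr2 in h2.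
rewrite /torus_term; have -> : pi_order p h j = 1%N.
  rewrite pi_order_half //; case: jE => ->; first by rewrite h_gt0 carry0.
  by rewrite ltnn; have [_ ->] := dual_exp_half p_pr p_mod4.
have -> : b j = 0%N.
  by case: jE => ->; [exact: dual_exp0 | have [] := dual_exp_half p_pr p_mod4].
have -> : gmf (sh j) ^+ 2 * gmf j ^+ 2 = 1.
  case: jE => ->; rewrite ?shift0 ?(shift_half p_pr p_mod4) gmf0 // h2 expr1n ?mulr1 ?mul1r //.
by rewrite gmf0 // expr0 expr1 !mulr1 opprK.
Qed.

Lemma sum_torus_term_half :
  \sum_(j < q) torus_term N lam h j = p%:R ^+ 2 * sum2 - 2%:R * p%:R ^+ 2 + 2%:R * p%:R.
Proof.
rewrite (@sum_proportional2 Z _ h (torus_term N lam h)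
  (fun j => (-1) ^+ (j * 2) * tau (lam ^+ 4)^-1 ^+ j * prod2 j) (p%:R ^+ 2) h_gt0 hq) -/sum2; last first.
  by move=> j jq j0 jh; apply: torus_term_half => //; rewrite -lt0n.
have e0 : 0%N = 0%N \/ 0%N = h by left.
have eh : h = 0%N \/ h = h by right.
rewrite (torus_term_ends e0) (torus_term_ends eh) (prod2_ends e0) (prod2_ends eh).
rewrite (teich_ends e0) (teich_ends eh) !expN1_2 !mulr1.
by move: sum2 (p%:R) => S x; ring.
Qed.

(** The polynomial is ((p-1)^3 + 1)/p: the cube is the trivial part of the Fourier expansion, the 1
    the correction at j = 0. The factor p^2 cannot be cancelled in Z/p^N. *)
Lemma torus_sum_hypergeom :
  p%:R ^+ 2 * (torus_sum lam)%:~R =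
  p%:R ^+ 2 * (p%:R ^+ 2 - 3%:R * p%:R + 3%:R + - q%:R^-1 * sum3) :> Z.
Proof.
apply: (mulrI qU); rewrite mulrCA (torus_sum_gamma p_pr p_mod4 N_gt0 lam0) sum_torus_term0.
have -> : q%:R * (p%:R ^+ 2 * (p%:R ^+ 2 - 3%:R * p%:R + 3%:R + - q%:R^-1 * sum3)) =
  p%:R ^+ 2 * (q%:R * (p%:R ^+ 2 - 3%:R * p%:R + 3%:R) - q%:R / q%:R * sum3) :> Z by ring.
by rewrite mulrV // qZ; ring.
Qed.

(** The constant -2 collects the corrections at j = 0 and j = h, since 2p - 2p^2 = -2p(p-1); the
    trivial part vanishes here. *)
Lemma torus_twist_hypergeom :
  p%:R ^+ 2 * (torus_twist lam)%:~R =
  p%:R ^+ 2 * (- 2%:R - p%:R * (- q%:R^-1 * sum2)) :> Z.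
Proof.
apply: (mulrI qU); rewrite mulrCA (torus_twist_gamma p_pr p_mod4 N_gt0 lam0) sum_torus_term_half.
have -> : q%:R * (p%:R ^+ 2 * (- 2%:R - p%:R * (- q%:R^-1 * sum2))) =
  p%:R ^+ 2 * (- 2%:R * q%:R + p%:R * (q%:R / q%:R * sum2)) :> Z by ring.
by rewrite mulrV // qZ; ring.
Qed.

End Comparison.

(** * Passage from residues modulo p^N to the p-adic limit *)

Section Approximants.
Variables (p N k : nat).
Hypotheses (p_pr : prime p) (p_mod4 : (p %% 4 = 3)%N) (N_gt0 : (0 < N)%N) (leNk : (N <= k)%N).
Local Notation Z := 'Z_(p ^ N).
Local Notation h := (p.-1./2).
Local Notation q := (p.-1).
Local Notation reduces := (@reduces p N).
Let p_odd : odd p.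
Proof. by have := divn_eq p 4; rewrite p_mod4; lia. Qed.
Let q_gt0 : (0 < q)%N.
Proof. by have := divn_eq p 4; rewrite p_mod4; lia. Qed.
Let q_ndvd : ~~ (p %| q)%N.
Proof. by rewrite gtnNdvd // prednK // prime_gt0. Qed.

Lemma reduces_p1 a x : x = a%:R / q%:R -> reduces x (a * inv_p1 p N)%:R.
Proof.
apply: reduces_div => //.
by have := gmfE p_pr p_mod4 N_gt0 a; rewrite natrM mulrC => ->.
Qed.

Lemma reduces_quarter a j : (a <= 3)%N -> (j < q)%N ->
  reduces (Defs.frac (a%:R / 4%:R - j%:R / q%:R)) (quarter_arg p N a j)%:R.
Proof.
move=> a3 jq; have [_ ->] := frac_quarter p_pr p_mod4 a3 jq.
apply: reduces_div (erefl _) => //; last by rewrite Euclid_dvdM // negb_or (ndvd4 p_pr p_mod4 N_gt0).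
have c4 := inv4E p_pr p_mod4 N_gt0; have i1 := inv_p1E p_pr p_mod4 N_gt0; rewrite !natrM in c4 i1.
rewrite /quarter_arg natrM natrD natrM [RHS]mulrC natrM natrD natrM.
move: (4%:R) (q%:R) (inv_p1 p N)%:R (inv4 p N)%:R ((dual_exp p j)%:R) ((_ %% _)%:R) c4 i1
  => f Q i v B R c4 i1.
transitivity ((f * v) * (Q * R + (Q * i) * B)); first by rewrite c4 i1 !mul1r.
by ring.
Qed.

Lemma frac_quarter0 a : (a <= 3)%N ->
  reduces (Defs.frac (a%:R / 4%:R)) (a * inv4 p N)%:R.
Proof.
move=> a3; have := reduces_quarter a3 q_gt0.
rewrite mul0r subr0 /quarter_arg dual_exp0 carry0 subn0 mul0n add0n modnDr modn_small //.
Qed.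

Lemma floor_frac_quarter a j : (a <= 3)%N -> (j < q)%N ->
  Num.floor (Defs.frac (a%:R / 4%:R) - j%:R / q%:R : rat) = - (a < carry p j)%N%:Z.
Proof.
move=> a3 jq; have [<- _] := frac_quarter p_pr p_mod4 a3 jq; congr (Num.floor (_ - _)).
have [_] := frac_quarter p_pr p_mod4 a3 q_gt0; rewrite mul0r subr0 => ->.
rewrite dual_exp0 carry0 subn0 addn0 modnDr modn_small // [(q * a)%N]mulnC !natrM -mulf_div divff ?mulr1 //.
by rewrite pnatr_eq0 -lt0n.
Qed.

Variable lam : 'F_p.
Hypothesis lam0 : lam != 0.

Lemma reduces_G3 :
  reduces (G_approx k [:: 1/4%:R; 2%:R/4%:R; 3%:R/4%:R] [:: 0; 0; 0] (lam ^+ 4))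
    (- q%:R^-1 * sum3 N lam).
Proof.
have nthE i : (i < 3)%N -> nth 0 [:: 1/4%:R; 2%:R/4%:R; 3%:R/4%:R] i =
    (nth 0 [:: 1; 2; 3] i)%:R / 4%:R :> rat /\ (nth 0 [:: 1; 2; 3] i <= 3)%N.
  by case: i => [|[|[]]].
have nth0 i : (i < 3)%N -> - nth 0 [:: 0; 0; 0] i = 0 :> rat.
  by case: i => [|[|[]]] //= _; rewrite oppr0.
have f0 : Defs.frac 0 = 0 by rewrite /Defs.frac floor0 subrr.
apply: (@reduces_G p N k p_pr p_odd N_gt0 leNk _ _ _
  (fun i j => quarter_arg p N (nth 0 [:: 1; 2; 3] i) j)%N (fun _ j => j * inv_p1 p N)%N
  (fun i => nth 0 [:: 1; 2; 3] i * inv4 p N)%N (fun _ => 0%N)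
  (fun i j => (nth 0 [:: 1; 2; 3] i < carry p j)%N : nat)%N).
- exact: expf_neq0.
- by move=> i /nthE[-> a3]; exact: frac_quarter0.
- by move=> i /nth0 ->; rewrite f0; exact: (reduces_nat p_pr N_gt0 0).
- by move=> i j /nthE[-> a3] jq; exact: reduces_quarter.
- move=> i j /nth0 -> jq; rewrite add0r; have [_ ->] := frac_p1 p_pr p_mod4 jq.
  exact: reduces_p1.
- move=> i j ii jq; have [-> a3] := nthE i ii; rewrite nth0 // f0 add0r.
  by rewrite floor_frac_quarter //; have [-> _] := frac_p1 p_pr p_mod4 jq; rewrite opprK subr0.
Qed.

Lemma reduces_G2 :
  reduces (G_approx k [:: 3%:R/4%:R; 1/4%:R] [:: 0; 1/2%:R] (lam ^+ 4))
    (- q%:R^-1 * sum2 N lam).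
Proof.
have nthE i : (i < 2)%N -> nth 0 [:: 3%:R/4%:R; 1/4%:R] i =
    (nth 0 [:: 3; 1] i)%:R / 4%:R :> rat /\ (nth 0 [:: 3; 1] i <= 3)%N.
  by case: i => [|[|[]]].
have f0 : Defs.frac 0 = 0 by rewrite /Defs.frac floor0 subrr.
apply: (@reduces_G p N k p_pr p_odd N_gt0 leNk _ _ _
  (fun i j => quarter_arg p N (nth 0 [:: 3; 1] i) j)%N
  (fun i j => nth 0 [:: j; shift_exp p h j] i * inv_p1 p N)%N
  (fun i => nth 0 [:: 3; 1] i * inv4 p N)%N (fun i => nth 0 [:: 0; h] i * inv_p1 p N)%N
  (e2 p)).
- exact: expf_neq0.
- by move=> i /nthE[-> a3]; exact: frac_quarter0.
- case=> [|[|//]] _ /=; first by rewrite oppr0 f0 mul0n; exact: (reduces_nat p_pr N_gt0 0).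
  by apply: reduces_p1; exact: frac_Nhalf.
- by move=> i j /nthE[-> a3] jq; exact: reduces_quarter.
- case=> [|[|//]] j _ jq /=; apply: reduces_p1; last exact: frac_half.
  by rewrite oppr0 add0r; have [_ ->] := frac_p1 p_pr p_mod4 jq.
- move=> i j ii jq; have [-> a3] := nthE i ii; rewrite floor_frac_quarter // opprK.
  case: i ii a3 => [|[|//]] _ _ /=; rewrite /e2 /=.
    by rewrite oppr0 f0 add0r; have [-> _] := frac_p1 p_pr p_mod4 jq; rewrite subr0.
  (* The natural subtraction in [e2] is legitimate because h <= j forces [carry p j] > 1: at j = h
     it equals 2, and beyond h it is at least 3. *)
  rewrite floor_half // subzn //; case: (ltngtP h j) => // hj.
    by have := carry_hi p_pr p_mod4 jq hj; case: (carry p j) => [|[]].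
  by rewrite -hj; have [_ ->] := dual_exp_half p_pr p_mod4.
Qed.

(** The residues of both approximants combine with [npointsE] to show that p^2 times the difference
    vanishes modulo p^N; dividing by p^2 in the rationals costs two digits. *)
Lemma close_approximants :
  vge p (N%:Z - 2%:Z)
   ((p ^ 3 - 1)%N%:R / (p - 1)%N%:R
    + G_approx k [:: 1/4%:R; 2%:R/4%:R; 3%:R/4%:R] [:: 0; 0; 0] (lam ^+ 4)
    - 3%:R * p%:R * G_approx k [:: 3%:R/4%:R; 1/4%:R] [:: 0; 1/2%:R] (lam ^+ 4)
    - (npoints lam)%:R).
Proof.
have g3 := reduces_G3; have g2 := reduces_G2.
move: (G_approx _ _ _ _) g3 (G_approx _ _ _ _) g2 => x g3 y g2.
have -> : (p ^ 3 - 1)%N%:R / (p - 1)%N%:R = (p ^ 2 + p + 1)%N%:R :> rat.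
  apply: (canLR (mulfK _)); first by rewrite subn1 pnatr_eq0 -lt0n.
  rewrite -natrM; congr (_%:R); rewrite mulnBr; have := prime_gt0 p_pr.
  rewrite !expnS expn0; nia.
set D := _ - (npoints lam)%:R.
have rD : reduces (p%:R ^+ 2 * D) 0.
  have -> : 0 = p%:R ^+ 2 * ((p ^ 2 + p + 1)%N%:R + - q%:R^-1 * sum3 N lam
     - 3%:R * p%:R * (- q%:R^-1 * sum2 N lam) - (npoints lam)%:R) :> Z.
    have -> : (npoints lam)%:R = (torus_sum lam)%:~R + 3%:R * (torus_twist lam)%:~R
        + 4%:R * (p%:R + 1) :> Z.
      rewrite natr1 -[LHS]/((npoints lam)%:Z%:~R) npointsE //.
      by rewrite intrD [X in X + _]intrD intrM [X in _ + X]intrM !natz.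
    have := torus_sum_hypergeom p_pr p_mod4 N_gt0 lam0.
    have := torus_twist_hypergeom p_pr p_mod4 N_gt0 lam0.
    rewrite !natrD natrX.
    move: (- q%:R^-1 * _) (- q%:R^-1 * _) (torus_sum lam)%:~R (torus_twist lam)%:~R (p%:R)
      => S T U V P e2 e3.
    (* The point count enters only through the products of P^2 with the two torus sums [U] and [V],
       because only these products are known. *)
    transitivity (P ^+ 2 * (P ^+ 2 + P + 1 + S - 3%:R * P * T - 4%:R * (P + 1))
      - P ^+ 2 * U - 3%:R * (P ^+ 2 * V)); last by ring.
    by rewrite e2 e3; ring.
  apply: reducesM => //; first by apply: reducesX => //; exact: reduces_nat.
  apply: reducesD => //; last by apply: reducesN => //; exact: reduces_nat.
  apply: reducesD => //; first by apply: reducesD => //; exact: reduces_nat.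
  apply: reducesN => //; apply: reducesM => //.
  by rewrite -!natrM; exact: reduces_nat.
case: rD => pD rD.
have -> : D = p%:R ^+ 2 * D * p%:R ^ (- 2%:Z).
  rewrite mulrAC -[_ ^+ 2]/(p%:R ^ 2%:Z) -expfzDr ?subrr ?expr0z ?mul1r //.
  exact: natr_prime_neq0.
apply: vgeM => //; [exact: red_eq0 | exact: vge_exp].
Qed.

End Approximants.

Theorem theorem2 (p : nat) (lam : 'F_p) :
  prime p -> (p %% 4 = 3)%N -> lam != 0 ->
  padic_limit p
    (fun k =>
       ((p ^ 3 - 1)%N%:R / (p - 1)%N%:R : rat)
       + @G_approx p k [:: 1/4; 2/4; 3/4] [:: 0; 0; 0] (lam ^+ 4)
       - 3%:R * p%:R * @G_approx p k [:: 3/4; 1/4] [:: 0; 1/2] (lam ^+ 4))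
    (npoints lam)%:R.
Proof.
(* Working modulo p^(m+2) makes up for the two digits lost in [close_approximants]. *)
move=> p_pr p_mod4 lam0 m; exists m.+2 => k mk.
have := close_approximants p_pr p_mod4 (ltn0Sn m.+1) mk lam0.
move/(vge_le p_pr (f := m%:Z)) => V; have {}V := V _.
have /V/(vge_vp p_pr) : (m%:Z <= m.+2%:Z - 2%:Z)%R by lia.
by rewrite subr_eq0.
Qed.
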